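(* For an infinite connected simple vertex-transitive graph $G$ with bounded degrees and $0\le p<p_T(G)$, let $c_p=c_{G,p}:=E^{\mathbb{P}_p}[|C_o|\,P^o(T_{C_o}=+\infty)]$, where $o$ is any vertex of $G$. (i) If $G$ is vertex-transitive and transient, then $p\mapsto c_p$ is analytic on $[0,p_T(G))$. (ii) If $G$ is a Cayley graph of a finitely generated infinite group and $G$ is transient, then $\frac{d}{dp}c_p>0$ for all $0<p<p_T(G)$. (iii) If $G=\mathbb{Z}^d$ with $d\ge 11$ (nearest-neighbour graph), then $\lim_{p\to p_T(\mathbb{Z}^d)}c_p=+\infty$, the limit being taken over $p<p_T(\mathbb{Z}^d)$.
   Context: $(S_n)_{n\ge0}$ is the simple random walk on $G$, and $P^x$ is its law started at $x$; $G$ is transient if this walk is transient. For a set $A$ of vertices, $T_A:=\inf\{n\ge1:S_n\in A\}$ (with $\inf\emptyset=+\infty$). $\mathbb{P}_p$ is the law of Bernoulli bond percolation on $G$ with parameter $p$ and $C_x$ is the open cluster of the vertex $x$. $p_T(G):=\inf\{p\in[0,1]:E^{\mathbb{P}_p}[|C_o|]=+\infty\}$ (independent of $o$). $E^\mu$ is expectation with respect to $\mu$. *)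

(* Defs.v *)
From HB Require Import structures.
From mathcomp Require Import all_boot all_order all_algebra finmap.
From mathcomp Require Import all_classical all_reals all_analysis.
From mathcomp Require Import ring lra.

Set Implicit Arguments.
Unset Strict Implicit.
Unset Printing Implicit Defensive.

Import Order.TTheory GRing.Theory Num.Theory numFieldNormedType.Exports.

Local Open Scope classical_set_scope.
Local Open Scope ring_scope.

Record sgraph (V : choiceType) := SGraph {
  adj : rel V;
  adj_sym : symmetric adj;
  adj_irr : irreflexive adj }.

Section graphs.
Context {V : choiceType}.
Implicit Type G : sgraph V.

Definition nbhd G (x : V) : set V := [set y | adj G x y].

(* [fset_set] is the junk value [fset0] on infinite sets: [degree] is only
   meaningful together with the finiteness clause of [bounded_degree]. *)
Definition degree G (x : V) : nat := #|` fset_set (nbhd G x)|.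

Definition bounded_degree G : Prop :=
  exists D : nat, forall x, finite_set (nbhd G x) /\ (degree G x <= D)%N.

Definition connected_graph G : Prop :=
  forall x y, exists p : seq V, path (adj G) x p /\ last x p = y.

Definition graph_automorphism G (f : V -> V) : Prop :=
  bijective f /\ forall x y, adj G (f x) (f y) = adj G x y.

Definition vertex_transitive G : Prop :=
  forall x y, exists2 f, graph_automorphism G f & f x = y.

Definition is_edge G (e : {fset V}) : bool :=
  `[< exists x y, adj G x y /\ e = [fset x; y]%fset >].

Definition edge G : choiceType := {e : {fset V} | is_edge G e}.

End graphs.

(* Generators of the product over [I] of copies of the discrete sigma-algebra
   on [T]. *)
Definition coordinate_sets (I T : Type) : set (set (I -> T)) :=
  [set C | exists (i : I) (B : set T), C = [set w | B (w i)]].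

(* Infinite trajectories.  The index [o] only provides the base point that
   measurable types are required to have; trajectories are arbitrary maps, and
   need not start at [o]. *)
Definition trajectory (V : choiceType) (o : V) : Type := nat -> V.

HB.instance Definition _ (V : choiceType) (o : V) :=
  gen_eqMixin (trajectory o).
HB.instance Definition _ (V : choiceType) (o : V) :=
  gen_choiceMixin (trajectory o).
HB.instance Definition _ (V : choiceType) (o : V) :=
  isPointed.Build (trajectory o) (fun=> o).

Definition trajectories (V : choiceType) (o : V) :=
  g_sigma_algebraType (@coordinate_sets nat V : set (set (trajectory o))).

Definition configurations (V : choiceType) (G : sgraph V) :=
  g_sigma_algebraType (@coordinate_sets (edge G) bool).

Section random_walk.
Context {R : realType} {V : choiceType}.
Implicit Types (G : sgraph V) (o : V).

Definition transition G (x y : V) : R :=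
  if adj G x y then (degree G x)%:R^-1 else 0.

Definition is_walk_law G o (P : probability (trajectories o) R) : Prop :=
  forall (n : nat) (s : nat -> V),
    P [set S | forall i, (i <= n)%N -> S i = s i] =
    ((s 0%N == o)%:R * \prod_(i < n) transition G (s i) (s i.+1))%:E.

(* [is_walk_law G o] is satisfiable, so that the default value of [xget] plays
   no role, on infinite connected graphs of bounded degree: see [walkP]. *)
Definition walk G o : probability (trajectories o) R :=
  xget (\d_(point : trajectories o) : probability (trajectories o) R)
       [set P | is_walk_law G P].

Definition hitting_time (A : set V) (S : nat -> V) : \bar R :=
  ereal_inf [set n%:R%:E | n in [set n : nat | (1 <= n)%N /\ A (S n)]].

End random_walk.

Definition transient (R : realType) (V : choiceType) (G : sgraph V) : Prop :=
  forall o : V,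
    (0 < walk G o [set S | hitting_time [set o] S = +oo%E :> \bar R] :> \bar R)%E.

Section percolation.
Context {R : realType} {V : choiceType}.
Variable G : sgraph V.

Definition is_percolation_law (p : R) (P : probability (configurations G) R) :=
  forall (F : {fset edge G}) (b : edge G -> bool),
    P [set w | forall e, e \in F -> w e = b e] =
    (\prod_(e <- F) (if b e then p else 1 - p))%:E.

(* For [0 <= p <= 1], the default value of [xget] plays no role on connected
   graphs of bounded degree: see [percolationP]. *)
Definition percolation (p : R) : probability (configurations G) R :=
  xget (\d_(point : configurations G) : probability (configurations G) R)
       [set P | is_percolation_law p P].

Definition open_adj (w : edge G -> bool) : rel V := fun x y =>
  `[< exists e : edge G, val e = [fset x; y]%fset /\ w e >].

Definition cluster (w : edge G -> bool) (x : V) : set V :=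
  [set y | exists p : seq V, path (open_adj w) x p /\ last x p = y].

Definition expected_cluster_size (p : R) (o : V) : \bar R :=
  (\int[percolation p]_w counting (cluster w o))%E.

Definition p_T (o : V) : R :=
  inf [set p : R | 0 <= p <= 1 /\ expected_cluster_size p o = +oo%E].

Definition escape_probability (A : set V) (o : V) : \bar R :=
  walk G o [set S | hitting_time A S = +oo%E :> \bar R].

Definition c_ereal (o : V) (p : R) : \bar R :=
  (\int[percolation p]_w
     (counting (cluster w o) * escape_probability (cluster w o) o))%E.

(* [c_ereal o p] is at most [expected_cluster_size p o], hence finite when
   [0 <= p < p_T o]; this is the only range in which [c_] is meaningful. *)
Definition c_ (o : V) (p : R) : R := fine (c_ereal o p).

End percolation.

(* For [A] an interval, this includes one-sided expansions at the endpoints of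
   [A] that belong to [A]. *)
Definition analytic_on (R : realType) (A : set R) (f : R -> R) : Prop :=
  forall x, A x -> exists (a : nat -> R) (r : R), 0 < r /\
    forall y, A y -> `|y - x| < r ->
      series (fun n => a n * (y - x) ^+ n) @ \oo --> f y.

Section cayley.
Context {gT : groupType}.
Variable S : {fset gT}.
Local Open Scope group_scope.

Definition cayley_adj : rel gT :=
  fun x y => (x != y) && ((x^-1 * y \in S) || (y^-1 * x \in S)).

Lemma cayley_adj_sym : symmetric cayley_adj.
Proof. by move=> x y; rewrite /cayley_adj eq_sym orbC. Qed.

Lemma cayley_adj_irr : irreflexive cayley_adj.
Proof. by move=> x; rewrite /cayley_adj eqxx. Qed.

Definition cayley_graph : sgraph gT := SGraph cayley_adj_sym cayley_adj_irr.

Definition generates : Prop :=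
  forall x : gT, exists s : seq gT,
    (forall y, y \in s -> (y \in S) || (y^-1 \in S)) /\
    x = \prod_(y <- s) y.

End cayley.

Section lattice.
Variable d : nat.

Definition lattice_adj : rel 'rV[int]_d :=
  fun x y => (\sum_(i < d) `|x 0 i - y 0 i|)%R == 1.

Lemma lattice_adj_sym : symmetric lattice_adj.
Proof.
by move=> x y; rewrite /lattice_adj; under eq_bigr do rewrite distrC.
Qed.

Lemma lattice_adj_irr : irreflexive lattice_adj.
Proof.
move=> x; rewrite /lattice_adj big1 // => i _.
by rewrite subrr normr0.
Qed.

Definition lattice : sgraph 'rV[int]_d := SGraph lattice_adj_sym lattice_adj_irr.

End lattice.

(* Existence of the two laws, by driving both processes with a single uniform
   random variable on [0, 1[: a step splits [0, 1[ into intervals of lengths the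
   transition probabilities, and rescales the selected interval to [0, 1[. *)
Section existence.
Context {R : realType}.

Local Notation unif := (uniform_prob (@ltr01 R)).
Local Notation mu := (@lebesgue_measure R).

Lemma measure_pushforward d d' (T : measurableType d) (T' : measurableType d')
    (P : {measure set T -> \bar R}) (f : T -> T') : measurable_fun setT f ->
  exists Q : {measure set T' -> \bar R}, forall A, Q A = P (f @^-1` A).
Proof.
move=> mf; unshelve eexists (pushforward P f : {measure set _ -> \bar R}) => //.
Qed.

Lemma probability_pushforward d d' (T : measurableType d) (T' : measurableType d')
    (P : probability T R) (f : T -> T') : measurable_fun setT f ->
  exists Q : probability T' R, forall A, Q A = P (f @^-1` A).
Proof.
move=> mf; pose F : {mfun T >-> T'} := HB.pack f (isMeasurableFun.Build _ _ _ _ _ mf).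
by exists (distribution P F).
Qed.

Lemma unifE (A : set R) : measurable A -> unif A = mu (A `&` `[0, 1[).
Proof.
move=> mA; rewrite /uniform_prob integral_uniform_pdf.
rewrite (eq_integral (cst 1%E)); last first.
  move=> x; rewrite inE => -[_]; rewrite /= in_itv /= /uniform_pdf => ->.
  by rewrite subr0 invr1.
rewrite integral_cst ?mul1e; last exact: measurableI.
have mc : measurable (A `&` `[0%R, 1%R] : set R) by exact: measurableI.
have mo : measurable (A `&` `[0%R, 1%R[ : set R) by exact: measurableI.
have -> : A `&` `[0, 1] = (A `&` `[0, 1[) `|` (A `&` [set 1]).
  by rewrite -setIUr setUitv1 // bnd_simp.
have m1 : measurable (A `&` [set 1] : set R) by exact: measurableI.
rewrite measureU //; last first.
  rewrite -subset0 => x [[_ /=]]; rewrite in_itv /= => /andP[_ xlt] [_ /= x1].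
  by move: xlt; rewrite x1 ltxx.
rewrite [X in (_ + X)%E](_ : _ = 0%E) ?adde0 //.
apply: (@subset_measure0 _ (measurableTypeR R) R mu _ [set 1%R]) => //.
by have := lebesgue_measure_set1 (1 : R).
Qed.

Lemma measurable_affine (a b : R) : measurable_fun setT (fun u : R => a * u + b).
Proof.
by apply: measurable_realfun.measurable_funD => //;
  apply: measurable_realfun.measurable_funM.
Qed.

Lemma lebesgue_affine (a b : R) (A : set R) : 0 < a -> measurable A ->
  mu [set u | A (a * u + b)] = (a^-1%:E * mu A)%E.
Proof.
move=> a0 mA.
have [Q QE] := @measure_pushforward _ _ (measurableTypeR R) (measurableTypeR R) mu _ (measurable_affine a b).
have -> : mu A = mscale (NngNum (ltW a0)) Q A.
  apply: lebesgue_measure_unique => // _ [[x y] _ <-] /=.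
  rewrite /mscale /= QE /= lebesgue_measure_itv /=.
  have -> : (fun u : R => a * u + b) @^-1` `]x, y] = `](x - b) / a, (y - b) / a]%classic.
    apply/seteqP; split => u /=; rewrite !in_itv /= ltr_pdivrMr // ler_pdivlMr // ltrBlDr lerBrDr [u * a]mulrC //.
  rewrite lebesgue_measure_itv /= !lte_fin ltr_pM2r ?invr_gt0 // ltrD2r.
  case: ifPn => xy; last by rewrite mule0.
  rewrite -!EFinD -EFinM; congr EFin; field; exact: lt0r_neq0.
rewrite /mscale /= QE muleA -EFinM mulVf ?mul1e //; exact: lt0r_neq0.
Qed.

Lemma unif_affine (a b : R) (A B : set R) : 0 < a -> measurable A ->
    measurable B ->
    (forall u, B u /\ 0 <= u < 1 <-> A (a * u + b) /\ 0 <= a * u + b < 1) ->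
  unif B = (a^-1%:E * unif A)%E.
Proof.
move=> a0 mA mB BA; rewrite !unifE // -(lebesgue_affine b) //; last first.
  exact: measurableI.
by congr (mu _); apply/seteqP; split => u; rewrite /= !in_itv /=; move/BA.
Qed.

Lemma unif_eq0 (A : set R) : measurable A ->
  (forall u, A u -> 0 <= u < 1 -> False) -> unif A = 0%E.
Proof.
move=> mA A0; rewrite unifE // (_ : _ `&` _ = set0) ?measure0 //.
by rewrite -subset0 => u [Au /=]; rewrite in_itv /=; exact: A0.
Qed.

Section driven_chain.
Variables (X : choiceType) (g : X -> R -> X) (h : X -> R -> R).

Fixpoint driven (x : X) (u : R) (n : nat) : X :=
  if n is n'.+1 then driven (g x u) (h x u) n' else x.

Hypothesis cX : countable [set: X].
Hypothesis mg : forall x y, measurable [set u | g x u = y].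
Hypothesis mh : forall x, measurable_fun setT (h x).

Lemma measurable_step x y (A : set R) : measurable A ->
  measurable ([set u | g x u = y] `&` h x @^-1` A).
Proof.
by move=> mA; apply: measurableI => //; rewrite -[X in measurable X]setTI;
   exact: mh.
Qed.

Lemma measurable_driven x n (B : set X) : measurable [set u | B (driven x u n)].
Proof.
elim: n x => [|n IHn] x /=.
  have [Bx|Bx] := pselect (B x).
    by rewrite (_ : [set _ | _] = setT); [|apply/seteqP; split].
  by rewrite (_ : [set _ | _] = set0); [|apply/seteqP; split].
rewrite (_ : [set _ | _] = \bigcup_(y in [set: X])
    ([set u | g x u = y] `&` h x @^-1` [set u | B (driven y u n)])).
  by apply: countable_bigcupT_measurable => // y; exact: measurable_step.
apply/seteqP; split => u /=.
  by move=> Bu; exists (g x u).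
by case=> y _ /= [-> ].
Qed.

Lemma measurable_driven_prefix x n (B : nat -> set X) :
  measurable [set u | forall i, (i < n)%N -> B i (driven x u i)].
Proof.
rewrite (_ : [set _ | _] =
    \bigcap_(i in [set i | (i < n)%N]) [set u | B i (driven x u i)]).
  by apply: bigcap_measurableType => i _; exact: measurable_driven.
by apply/seteqP; split => u /= Bu i; exact: Bu.
Qed.

Variable K : X -> X -> R.
Hypothesis gK : forall x y A, measurable A ->
  unif ([set u | g x u = y] `&` h x @^-1` A) = ((K x y)%:E * unif A)%E.

Lemma driven_law x n (s : nat -> X) :
  unif [set u | forall i, (i <= n)%N -> driven x u i = s i] =
  ((s 0%N == x)%:R * \prod_(i < n) K (s i) (s i.+1))%:E.
Proof.
elim: n x s => [|n IHn] x s.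
  rewrite big_ord0 mulr1; have [sx|sx] := eqVneq.
    rewrite (_ : [set _ | _] = setT) ?probability_setT //.
    by apply/seteqP; split => // u _ [|//] _; rewrite /= sx.
  rewrite (_ : [set _ | _] = set0) ?measure0 //.
  rewrite -subset0 => u /(_ 0%N (leqnn _)) /= xs.
  by move: sx; rewrite xs eqxx.
have [sx|sx] := eqVneq; last first.
  rewrite mul0r (_ : [set _ | _] = set0) ?measure0 //.
  rewrite -subset0 => u /(_ 0%N (leq0n _)) /= xs.
  by move: sx; rewrite xs eqxx.
rewrite mul1r big_ord_recl /= sx.
pose s' i := s i.+1.
have -> : [set u | forall i, (i <= n.+1)%N -> driven x u i = s i] =
    [set u | g x u = s 1%N] `&`
    h x @^-1` [set u | forall i, (i <= n)%N -> driven (s 1%N) u i = s' i].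
  apply/seteqP; split => u /=.
    move=> us; have gs : g x u = s 1%N := us 1%N isT.
    by split=> // i ni; rewrite -[RHS](us i.+1) //= gs.
  by case=> gs us [|i] ni /=; [rewrite sx|rewrite gs us].
rewrite gK; last first.
  have := @measurable_driven_prefix (s 1%N) n.+1 (fun i => [set s' i]).
  by [].
by rewrite IHn eqxx mul1r EFinM.
Qed.

End driven_chain.

Section independent_bits.
Variables (g : R -> bool) (h : R -> R) (p : R).
Hypothesis mg : forall y, measurable [set u | g u = y].
Hypothesis mh : measurable_fun setT h.
Let K (b : bool) : R := if b then p else 1 - p.
Hypothesis gK : forall y A, measurable A ->
  unif ([set u | g u = y] `&` h @^-1` A) = ((K y)%:E * unif A)%E.

Let bits u n := driven (fun=> g) (fun=> h) false u n.+1.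

Lemma driven_bits n (s : nat -> option bool) :
  unif [set u | forall i, (i < n)%N -> forall b, s i = Some b -> bits u i = b] =
  (\prod_(i < n) (if s i is Some b then K b else 1))%:E.
Proof.
rewrite /bits; elim: n false s => [|n IHn] x s.
  rewrite big_ord0 (_ : [set _ | _] = setT) ?probability_setT //.
  by apply/seteqP.
rewrite big_ord_recl /=; pose s' i := s i.+1.
pose E y := [set u | forall i, (i < n)%N -> forall b, s' i = Some b ->
  driven (fun=> g) (fun=> h) y u i.+1 = b].
have mE y : measurable (E y).
  rewrite (_ : E y = \bigcap_(i in [set i | (i < n)%N])
    [set u | [set c | forall b, s' i = Some b -> c = b]
             (driven (fun=> g) (fun=> h) y u i.+1)]).
    apply: bigcap_measurableType => i _.
    by apply: (@measurable_driven bool (fun=> g) (fun=> h)) => //; exact: countableP.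
  by apply/seteqP; split => u /= Bu i; exact: Bu.
have Ey y z : E y = E z by [].
have -> : [set u | forall i, (i < n.+1)%N -> forall b, s i = Some b ->
      driven (fun=> g) (fun=> h) (g u) (h u) i = b] =
    (if s 0%N is Some b then [set u | g u = b] else setT) `&` h @^-1` E x.
  apply/seteqP; split => u /=.
    move=> us; split; first by case s0 : (s 0%N) => [b|] //=; exact: us s0.
    by move=> i ni b sb; exact: (us i.+1).
  by case=> us0 us [|i] ni b sb /=; [rewrite sb in us0|exact: us sb].
have mhE : measurable (h @^-1` E x) by rewrite -[X in measurable X]setTI; exact: mh.
have IH : unif (E x) = (\prod_(i < n) (if s i.+1 is Some b then K b else 1))%:E.
  exact: IHn.
case: (s 0%N) => [b|]; first by rewrite gK // EFinM -IH.
rewrite mul1r -IH setTI.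
have -> : h @^-1` E x = ([set u | g u = true] `&` h @^-1` E x) `|`
                        ([set u | g u = false] `&` h @^-1` E x).
  rewrite -setIUl (_ : _ `|` _ = setT) ?setTI //.
  by apply/seteqP; split => // u _ /=; case: (g u); [left|right].
rewrite measureU; [|by apply: measurableI; [exact: mg|exact: mhE]|by apply: measurableI; [exact: mg|exact: mhE]|].
  transitivity (unif ([set u | g u = true] `&` h @^-1` E x) +
    unif ([set u | g u = false] `&` h @^-1` E x))%E; first by [].
  rewrite !gK //.
  have /fineK <- : unif (E x) \is a fin_num by rewrite IH.
  rewrite -!EFinM -EFinD /K; congr EFin; ring.
by rewrite -subset0 => u [[/= -> _] []].
Qed.

End independent_bits.

Lemma measurable_cylinders d (T : measurableType d) (Y : pointedType)
    (G : set (set Y)) (f : T -> g_sigma_algebraType G) :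
  (forall A, G A -> measurable (f @^-1` A)) -> measurable_fun setT f.
Proof.
move=> Gf; apply: (@measurability _ _ _ (g_sigma_algebraType G) _ _ G) => //.
by move=> _ [A GA <-]; rewrite setTI; exact: Gf.
Qed.

Lemma measurable_preimage_bool (f : R -> bool) y :
  measurable_fun setT f -> measurable [set u | f u = y].
Proof.
by move=> mf; rewrite -[X in measurable X]setTI; exact: (mf measurableT [set y]).
Qed.

Section existence_percolation.
Context {V : choiceType} (G : sgraph V).

Lemma exists_percolation_law (p : R) : 0 <= p <= 1 -> countable [set: V] ->
  exists P : probability (configurations G) R, is_percolation_law p P.
Proof.
move=> /andP[p0 p1] /countable_injP[f /in2TT finj].
pose iota (e : edge G) := choice.pickle (map f (enum_fset (val e)) : seq nat).
have iota_inj : injective iota.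
  move=> e e' /(pcan_inj choice.pickleK) /(inj_map finj) ee'.
  by apply: val_inj; apply: val_inj.
pose g (u : R) := u < p.
pose h (u : R) := if u < p then p^-1 * u + 0 else (1 - p)^-1 * u + - p / (1 - p).
have mg0 : measurable_fun setT g.
  by apply: measurable_realfun.measurable_fun_ltr.
have mg y : measurable [set u | g u = y] by exact: measurable_preimage_bool.
have mh : measurable_fun setT h.
  by apply: measurable_fun_ifT => //; exact: measurable_affine.
have mgh y A : measurable A -> measurable ([set u | g u = y] `&` h @^-1` A).
  move=> mA; apply: measurableI => //; rewrite -[X in measurable X]setTI.
  exact: mh.
have gK y A : measurable A -> unif ([set u | g u = y] `&` h @^-1` A) =
    ((if y then p else 1 - p)%:E * unif A)%E.
  move=> mA; case: y (mgh y A mA) => mB.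
    have [pz|pn0] := eqVneq p 0.
      rewrite pz mul0e; apply: unif_eq0 => // u [+ _] /andP[u0 _].
      by rewrite /g /= pz ltNge u0.
    have pgt0 : 0 < p by rewrite lt_def pn0.
    rewrite (@unif_affine p^-1 0 A) ?invr_gt0 ?invrK // => u.
    have -> : (0 <= p^-1 * u + 0 < 1) = (0 <= u < p).
      by rewrite addr0 pmulr_rge0 ?invr_gt0 // mulrC ltr_pdivrMr // mul1r.
    rewrite /g /h /=; split.
      by case=> -[-> Au] /andP[-> _].
    by case=> Au /andP[u0 up]; rewrite up u0 (lt_le_trans up).
  have [pz|pn0] := eqVneq p 1.
    rewrite pz subrr mul0e; apply: unif_eq0 => // u [+ _] /andP[_ u1].
    by rewrite /g /= pz u1.
  have pgt0 : 0 < 1 - p by rewrite subr_gt0 lt_def eq_sym pn0.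
  rewrite (@unif_affine (1 - p)^-1 (- p / (1 - p)) A) ?invr_gt0 ?invrK // => u.
  have -> : (0 <= (1 - p)^-1 * u + - p / (1 - p) < 1) = (p <= u < 1).
    have -> : (1 - p)^-1 * u + - p / (1 - p) = (u - p) / (1 - p) by ring.
    by rewrite pmulr_lge0 ?invr_gt0 // subr_ge0 ltr_pdivrMr // mul1r ltrD2r.
  rewrite /g /h /=; split.
    by case=> -[up Au] /andP[_ ->]; rewrite up in Au; rewrite leNgt up.
  case=> Au /andP[pu ->]; rewrite ltNge pu /= (le_trans p0 pu) //.
have mbits n (B : set bool) : measurable
    [set u | B (driven (fun=> g) (fun=> h) false u n)].
  by apply: (@measurable_driven bool) => //; exact: countableP.
pose w (u : R) : configurations G :=
  fun e => driven (fun=> g) (fun=> h) false u (iota e).+1.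
have mw : measurable_fun setT w.
  by apply: measurable_cylinders => _ [e [B ->]]; exact: mbits.
have [P PE] := probability_pushforward unif mw.
exists P => F b; rewrite PE.
pose s i := omap b (ohead [seq e <- enum_fset F | iota e == i]).
pose n := (\max_(e <- enum_fset F) iota e).+1.
have ltn e : e \in F -> (iota e < n)%N.
  by move=> eF; rewrite ltnS (@leq_bigmax_seq _ _ xpredT iota e).
have sE e : e \in F -> s (iota e) = Some (b e).
  move=> eF; rewrite /s.
  have -> : [seq e' <- enum_fset F | iota e' == iota e] =
            [seq e' <- enum_fset F | pred1 e e'].
    by apply: eq_filter => e'; rewrite (inj_eq iota_inj).
  by rewrite filter_pred1_uniq ?fset_uniq.
have sN i c : s i = Some c -> exists2 e, e \in F & iota e = i /\ c = b e.
  rewrite /s; case E: (seq.filter _ _) => [|e l] //= -[<-].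
  have : e \in [seq e <- enum_fset F | iota e == i] by rewrite E mem_head.
  by rewrite mem_filter => /andP[/eqP ? ?]; exists e.
transitivity (unif [set u | forall i, (i < n)%N -> forall b, s i = Some b ->
   driven (fun=> g) (fun=> h) false u i.+1 = b]).
  congr (unif _); apply/seteqP; split => u /= uw.
    by move=> i ni c /sN[e eF [<- ->]]; exact: uw.
  by move=> e eF; apply: (uw _ (ltn _ eF)); exact: sE.
rewrite (driven_bits mg mh gK); congr EFin.
transitivity (\prod_(i < n) \prod_(e <- enum_fset F | iota e == i)
    (if b e then p else 1 - p)).
  apply: eq_bigr => i _; rewrite -big_filter /s.
  have : uniq [seq e <- enum_fset F | iota e == i] by rewrite filter_uniq ?fset_uniq.
  have : all (fun e => iota e == i) [seq e <- enum_fset F | iota e == i].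
    exact: filter_all.
  case: (seq.filter _ _) => [|e [|e' l]] /=; rewrite ?big_nil ?big_seq1 //.
  case/and3P=> /eqP ei /eqP e'i _; rewrite inE.
  by rewrite (iota_inj e e') ?eqxx // ei e'i.
rewrite (exchange_big_dep xpredT) //= [LHS]big_seq [RHS]big_seq.
apply: eq_bigr => e eF.
by rewrite (big_pred1 (Ordinal (ltn e eF))) // => i; rewrite eq_sym -val_eqE.
Qed.

End existence_percolation.

Section existence_walk.
Context {V : choiceType} (G : sgraph V).
Hypotheses (infV : infinite_set [set: V]) (cG : connected_graph G)
  (bG : bounded_degree G).

Lemma nbhd_finite x : finite_set (nbhd G x).
Proof. by case: bG => D /(_ x) []. Qed.

Lemma connected_countable : countable [set: V].
Proof.
have [inhV|noV] := pselect (inhabited V); last first.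
  rewrite (_ : [set: V] = set0); first exact: countable0.
  by rewrite -subset0 => x _; apply: noV; constructor.
case: inhV => o; pose ball := fix ball n : set V :=
  if n is n'.+1 then \bigcup_(x in ball n') nbhd G x else [set o].
have cball n : countable (ball n).
  elim: n => [|n IHn] /=; first exact: countable1.
  by apply: bigcup_countable => // x _; apply: finite_set_countable; exact: nbhd_finite.
rewrite (_ : [set: V] = \bigcup_n ball n); first exact: bigcup_countable.
apply/seteqP; split => // y _; have [p [op <-]] := cG o y.
exists (size p) => //; elim/last_ind: p op => [//|p z IHp].
rewrite rcons_path last_rcons size_rcons => /andP[op pz] /=.
by exists (last o p); first exact: IHp.
Qed.

Lemma degree_gt0 x : (0 < degree G x)%N.
Proof.
have [y yx] : exists y, y <> x.
  apply: contrapT => noy; apply: infV; rewrite (_ : [set: V] = [set x]) //.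
  by apply/seteqP; split => // y _ /=; apply: contrapT => yx; apply: noy; exists y.
have [q [+ +]] := cG x y; case: q => [|z p] /= xp lst; first by case: yx.
have /andP[xz _] := xp.
by rewrite /degree cardfs_gt0; apply/fset0Pn; exists z; rewrite in_fset_set ?inE //; exact: nbhd_finite.
Qed.

Lemma exists_walk_law (o : V) :
  exists P : probability (trajectories o) R, is_walk_law G P.
Proof.
pose nb x : seq V := enum_fset (fset_set (nbhd G x)).
have nbE x y : (y \in nb x) = adj G x y.
  rewrite /nb -[LHS]/(y \in fset_set (nbhd G x)) in_fset_set; last exact: nbhd_finite.
  by apply/idP/idP; rewrite inE.
pose d x : R := (degree G x)%:R.
have d_gt0 x : 0 < d x by rewrite ltr0n degree_gt0.
pose g x (u : R) := nth x (nb x) (Num.trunc (d x * u)).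
pose tr x (u : R) : R := (Num.trunc (d x * u))%:R.
pose h x (u : R) := d x * u - tr x u.
have mtr x : measurable_fun setT (tr x).
  apply: measurable_realfun.nondecreasing_measurable => // u v uv.
  by rewrite /tr ler_nat le_truncn // ler_pM2l.
have mh x : measurable_fun setT (h x).
  apply: measurable_realfun.measurable_funB; last exact: mtr.
  by apply: measurable_realfun.measurable_funM.
have mg x y : measurable [set u | g x u = y].
  rewrite (_ : [set _ | _] = \bigcup_(k in [set k | nth x (nb x) k = y])
    (tr x @^-1` [set k%:R])).
    apply: bigcup_measurable => k _; rewrite -[X in measurable X]setTI.
    exact: mtr.
  apply/seteqP; split => u /=; first by move=> gu; exists (Num.trunc (d x * u)).
  by case=> k /= <- /eqP; rewrite /tr eqr_nat => /eqP tk; rewrite /g tk.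
have trlt x u : 0 <= u < 1 -> (Num.trunc (d x * u) < size (nb x))%N.
  move=> /andP[u0 u1]; rewrite truncn_lt_nat; last by rewrite mulr_ge0 // ltW.
  by rewrite -[ltRHS]mulr1 ltr_pM2l.
have gK x y A : measurable A -> unif ([set u | g x u = y] `&` h x @^-1` A) =
    ((transition G x y)%:E * unif A)%E.
  move=> mA.
  have mB : measurable ([set u | g x u = y] `&` h x @^-1` A).
    apply: measurableI => //; rewrite -[X in measurable X]setTI.
    exact: mh.
  rewrite /transition; case: ifPn => xy; last first.
    rewrite mul0e; apply: unif_eq0 => // u [gu _] u01.
    move/negP: xy; apply; rewrite -nbE -gu; exact/mem_nth/trlt.
  pose j := index y (nb x).
  have jd : (j < size (nb x))%N by rewrite index_mem nbE.
  rewrite (@unif_affine (d x) (- j%:R) A) // => u; split.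
    case=> -[gu Au] u01.
    have tj : Num.trunc (d x * u) = j.
      by rewrite /j -gu /g index_uniq ?fset_uniq // trlt.
    move: Au; rewrite /= /h /tr tj => Au; split => //.
    have /truncn_itv : 0 <= d x * u by case/andP: u01 => u0 _; rewrite mulr_ge0 // ltW.
    by rewrite tj -natr1 subr_ge0 ltrBlDl.
  case=> Au /andP[]; rewrite subr_ge0 ltrBlDl => ju uj.
  have tj : Num.trunc (d x * u) = j by apply: truncn_def; rewrite ju -natr1.
  split; first by split; [rewrite /g /= tj nth_index ?nbE|rewrite /= /h /tr tj].
  rewrite -(@pmulr_rge0 _ (d x)) // (le_trans _ ju) //=.
  rewrite -(@ltr_pM2l _ (d x)) // mulr1 (lt_le_trans uj) //.
  by rewrite natr1 ler_nat.
have mS n (B : set V) : measurable [set u | B (driven g h o u n)].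
  by apply: measurable_driven => //; exact: connected_countable.
pose S (u : R) : trajectories o := driven g h o u.
have mSf : measurable_fun setT S.
  by apply: measurable_cylinders => _ [n [B ->]]; exact: mS.
have [P PE] := probability_pushforward unif mSf.
exists P => n s; rewrite PE.
exact: (driven_law connected_countable mg mh gK).
Qed.

End existence_walk.
End existence.

Theorem walkP (R : realType) (V : choiceType) (G : sgraph V) (o : V) :
  infinite_set [set: V] -> connected_graph G -> bounded_degree G ->
  is_walk_law G (walk G o : probability (trajectories o) R).
Proof.
move=> infV cG bG; have [P GP] := exists_walk_law (R := R) infV cG bG o.
exact: (xgetPex _ (ex_intro _ P GP)).
Qed.

Theorem percolationP (R : realType) (V : choiceType) (G : sgraph V) (p : R) :
  0 <= p <= 1 -> connected_graph G -> bounded_degree G ->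
  is_percolation_law p (percolation G p).
Proof.
move=> p01 cG bG.
have [P GP] := exists_percolation_law G p01 (connected_countable cG bG).
exact: (xgetPex _ (ex_intro _ P GP)).
Qed.

(* Main.v *)
(* Write [chi p = E |C_o|] and [c_p = sum_A |A| P^o(T_A = oo) P_p(C_o = A)].

   If [chi p] is finite, exploring the cluster through balls, together with an
   inequality of van den Berg-Kesten type, bounds an exponential moment of
   [|C_o|] uniformly in the parameters near [p].  Hence [{chi < oo}] is open,
   so that [chi] diverges at [p_T], and the power series at [p] of the
   polynomials [P_p(C_o = A)] are summable against [|A|], which gives (i).

   On a group, mass transport replaces [|A| P^o(T_A = oo)] by the capacity
   [cap A = sum_(x in A) P^x(T_A = oo)], which is nondecreasing in [A], and
   strictly larger at [{o, y}] than at [{o}] for some neighbour [y] of [o].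
   Thus [c_p] is the expectation of an increasing function of the percolation
   configuration, and the event that the edge [{o, y}] is the only one that can
   be open around [o] and [y] already makes it grow linearly, which gives (ii).

   On [Z^d], the superharmonic function [(|x|^2 + K)^-s] with [2 s + 2 < d]
   gives [cap A >= c |A| / (|A| U^-s + U^(k - s))] for [2 k > d] and all
   [U >= 1], while [E |C_o|^2 <= chi^3]: typically [|C_o| <= chi^2].  With
   [U^k] of the order of [chi^2], [c_p] is at least of the order of
   [chi^((2 s - k) / k)], and [2 s > k] is possible when [d >= 11]: this is
   (iii). *)
From HB Require Import structures.
From mathcomp Require Import all_boot all_order all_algebra finmap.
From mathcomp Require Import all_classical all_reals all_analysis.
From mathcomp Require Import measurable_realfun.
From mathcomp Require Import ring lra zify.
Require Import Defs.

Set Implicit Arguments.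
Unset Strict Implicit.
Unset Printing Implicit Defensive.

Import Order.TTheory GRing.Theory Num.Theory numFieldNormedType.Exports.

Local Open Scope classical_set_scope.
Local Open Scope ring_scope.

(** * Finite product measures *)

(** [percolation] and [walk] are known only through their finite-dimensional laws. Probability is
    therefore done on finite lists of edges, where expectations are polynomials in the weights and
    inequalities are proved by induction on the list; bounds uniform in the window pass to the
    measure by monotone convergence. Keeping both weights free allows them to be polynomials, or not
    to add up to 1, as the majorants of the analyticity argument require.

    The obstacle to the exponential moment is circularity: the bound for what hangs off a ball is
    the bound being proved. The exploration leaves no unexplored edge at the centre, so each step
    uses up edges, and an induction on their number needs no finiteness in advance.

    The power series comes with a remainder estimate at every order. Order two gives the derivative,
    and a linear lower bound on increments gives its sign, so no series is differentiated. Since the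
    base vertex [o] is arbitrary, the group law is transported so that [o] is its identity. *)

Section configurations.
Context {T : eqType}.
Implicit Types (e : T) (w : T -> bool) (l : seq T).

Definition upd e w : T -> bool := fun f => (f == e) || w f.

Definition subconfig w w' := forall e, w e -> w' e.

Definition on_list l w := forall e, w e -> e \in l.

Definition restr l w : T -> bool := fun e => (e \in l) && w e.

Lemma subconfig_upd e w w' : subconfig w w' -> subconfig (upd e w) (upd e w').
Proof. by move=> ww' f /orP[fe|/ww' wf]; rewrite /upd ?fe ?wf ?orbT. Qed.

Lemma subconfig_updr e w : subconfig w (upd e w).
Proof. by move=> f wf; rewrite /upd wf orbT. Qed.

Lemma on_list_upd e l w : on_list l w -> on_list (e :: l) (upd e w).
Proof. by move=> lw f /orP[/eqP->|/lw]; rewrite inE ?eqxx // => ->; rewrite orbT. Qed.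

Lemma on_list_cons e l w : on_list l w -> on_list (e :: l) w.
Proof. by move=> lw f /lw; rewrite inE => ->; rewrite orbT. Qed.

Lemma upd_restr e l w : w e -> upd e (restr l w) = restr (e :: l) w.
Proof.
by move=> we; apply/funext => f; rewrite /upd /restr inE; case: eqVneq => [->|].
Qed.

Lemma restr_cons_closed e l w : ~~ w e -> restr (e :: l) w = restr l w.
Proof.
move=> we; apply/funext => f; rewrite /restr inE.
by case: eqVneq => [->|//]; rewrite (negbTE we) !andbF.
Qed.

Lemma subconfig_restr l w : subconfig (restr l w) w.
Proof. by move=> e /andP[]. Qed.

End configurations.

(* [bern a b l F] is the sum over the subsets [w] of the list [l] of
   [a ^ #|w| * b ^ #|l \ w| * F w]: for [a = p] and [b = 1 - p] it is the
   expectation of [F] under Bernoulli percolation on [l]. *)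
Fixpoint bern (T : eqType) (K : pzSemiRingType) (a b : K) (l : seq T)
    (F : (T -> bool) -> K) : K :=
  if l is e :: l' then
    a * bern a b l' (fun w => F (upd e w)) + b * bern a b l' F
  else F (fun=> false).

Section bern_algebra.
Context {T : eqType} {K : comNzRingType}.
Implicit Types (a b c : K) (l : seq T) (F G : (T -> bool) -> K).

Lemma eq_bern_on a b l F G : (forall w, on_list l w -> F w = G w) ->
  bern a b l F = bern a b l G.
Proof.
elim: l F G => [|e l IHl] F G FG /=; first exact: FG.
congr (_ * _ + _ * _); apply: IHl => w lw; apply: FG.
  exact: on_list_upd.
exact: on_list_cons.
Qed.

Lemma eq_bern a b l F G : F =1 G -> bern a b l F = bern a b l G.
Proof. by move=> FG; apply: eq_bern_on => w _; exact: FG. Qed.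

Lemma bernD a b l F G :
  bern a b l (fun w => F w + G w) = bern a b l F + bern a b l G.
Proof. by elim: l F G => //= e l IHl F G; rewrite !IHl; ring. Qed.

Lemma bernZ a b l c F : bern a b l (fun w => c * F w) = c * bern a b l F.
Proof. by elim: l F => //= e l IHl F; rewrite !IHl; ring. Qed.

Lemma bern0 a b l : bern a b l (fun=> 0) = 0.
Proof. by elim: l => //= e l ->; ring. Qed.

Lemma bern_sum a b l (I : Type) (r : seq I) (P : pred I) (F : I -> (T -> bool) -> K) :
  bern a b l (fun w => \sum_(i <- r | P i) F i w) =
  \sum_(i <- r | P i) bern a b l (F i).
Proof.
elim: r => [|i r IHr].
  by rewrite big_nil -[RHS](bern0 a b l); apply: eq_bern => w; rewrite big_nil.
rewrite big_cons -IHr.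
under eq_bern do rewrite big_cons.
by case: (P i) => //; rewrite bernD.
Qed.

(** Homogeneity: weights larger than [p] and [1 - p] by a common factor are traded for one power of
    that factor per edge. *)
Lemma bern_scale a b c l F :
  bern (c * a) (c * b) l F = c ^+ size l * bern a b l F.
Proof. by elim: l F => [|e l IHl] F /=; rewrite ?mul1r // !IHl exprS; ring. Qed.

Lemma bern_cst a b l c : a + b = 1 -> bern a b l (fun=> c) = c.
Proof. by move=> ab; elim: l => //= e l ->; rewrite -mulrDl ab mul1r. Qed.

Lemma upd_comm e f (w : T -> bool) : upd e (upd f w) = upd f (upd e w).
Proof. by apply/funext => g; rewrite /upd orbCA. Qed.

Lemma bern_rem a b e l F : uniq l -> e \in l ->
  bern a b l F = bern a b (e :: rem e l) F.
Proof.
elim: l F => //= f l IHl F /andP[fl ul]; rewrite inE eq_sym.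
have [->|fe] := eqVneq f e; rewrite ?eqxx //= => el.
rewrite !(IHl _ ul el) /=.
under [X in _ = _ * (_ * X + _) + _]eq_bern do rewrite upd_comm.
by ring.
Qed.

Lemma bern_perm a b l l' F : uniq l -> perm_eq l l' ->
  bern a b l F = bern a b l' F.
Proof.
elim: l l' F => [|e l IHl] l' F ul ll'.
  by move: (perm_size ll') => /esym/size0nil ->.
have el' : e \in l' by rewrite -(perm_mem ll') mem_head.
have ul' : uniq l' by rewrite -(perm_uniq ll').
case/andP: ul => _ ul; rewrite (bern_rem _ _ _ ul' el') /=.
have lr : perm_eq l (rem e l').
  by rewrite -(perm_cons e) (perm_trans ll') // perm_to_rem.
by rewrite !(IHl _ _ ul lr).
Qed.

(** An edge at which [F] does not look contributes the factor [a + b = 1]. *)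
Lemma bern_filter a b l (q : pred T) F : a + b = 1 ->
    (forall w, F w = F (fun e => q e && w e)) ->
  bern a b l F = bern a b (seq.filter q l) F.
Proof.
move=> ab; elim: l F => //= e l IHl F Fq.
have Fu : forall w, F (upd e w) = F (upd e (fun f => q f && w f)).
  move=> w; rewrite Fq [RHS]Fq; congr F; apply/funext => f; rewrite /upd.
  by case: (q f).
case: ifPn => qe /=.
  by rewrite !(IHl _ Fq); congr (_ * _ + _); exact: IHl.
rewrite -IHl //; under eq_bern => w.
  rewrite (_ : F (upd e w) = F w); first over.
  rewrite Fq [RHS]Fq; congr F; apply/funext => f; rewrite /upd.
  by case: eqVneq => // ->; rewrite (negbTE qe).
by rewrite -mulrDl ab mul1r.
Qed.

End bern_algebra.

Lemma horner_bern (T : eqType) (K : comNzRingType) (a b : {poly K}) (l : seq T)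
    (F : (T -> bool) -> {poly K}) (h : K) :
  (bern a b l F).[h] = bern a.[h] b.[h] l (fun w => (F w).[h]).
Proof. by elim: l F => //= e l IHl F; rewrite hornerD !hornerM !IHl. Qed.

Lemma bern_map (T T' : eqType) (K : comNzRingType) (f : T -> T') (g : T' -> T)
    (a b : K) (l : seq T) (F : (T' -> bool) -> K) :
  cancel f g -> cancel g f ->
  bern a b (map f l) F = bern a b l (fun w => F (fun e => w (g e))).
Proof.
move=> fK gK; elim: l F => //= e l IHl F; rewrite !IHl.
congr (_ * _ + _); apply: eq_bern => w; congr F; apply/funext => e'.
by rewrite /upd -(can_eq gK) fK.
Qed.

Section bern_order.
Context {T : eqType} {R : realFieldType}.
Implicit Types (p a b : R) (l : seq T) (F G : (T -> bool) -> R).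

Definition increasing F := forall w w', subconfig w w' -> F w <= F w'.

Lemma bern_le a b l F G : 0 <= a -> 0 <= b ->
  (forall w, on_list l w -> F w <= G w) -> bern a b l F <= bern a b l G.
Proof.
move=> a0 b0; elim: l F G => [|e l IHl] F G FG /=; first exact: FG.
apply: lerD; apply: ler_wpM2l => //; apply: IHl => w lw; apply: FG.
  exact: on_list_upd.
exact: on_list_cons.
Qed.

Lemma bern_ge0 a b l F : 0 <= a -> 0 <= b -> (forall w, on_list l w -> 0 <= F w) ->
  0 <= bern a b l F.
Proof. by move=> a0 b0 F0; rewrite -(bern0 a b l); apply: bern_le. Qed.

Lemma bern_le_weights a b a' b' l F : 0 <= a <= a' -> 0 <= b <= b' ->
  (forall w, 0 <= F w) -> bern a b l F <= bern a' b' l F.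
Proof.
move=> /andP[a0 aa'] /andP[b0 bb']; elim: l F => //= e l IHl F F0.
by apply: lerD; apply: ler_pM => //; try (exact: bern_ge0); apply: IHl.
Qed.

Section probability.
Variables (p : R).
Hypothesis p01 : 0 <= p <= 1.
Let p0 : 0 <= p. Proof. by case/andP: p01. Qed.
Let q0 : 0 <= 1 - p. Proof. by case/andP: p01; rewrite subr_ge0. Qed.
Let pq1 : p + (1 - p) = 1. Proof. by rewrite addrC subrK. Qed.

Lemma bern_le_cst l F c : (forall w, on_list l w -> F w <= c) ->
  bern p (1 - p) l F <= c.
Proof. by move=> Fc; rewrite -[leRHS](@bern_cst T _ _ _ l c pq1); apply: bern_le. Qed.

Lemma bern_sub l l' F : uniq l -> uniq l' -> {subset l <= l'} -> increasing F ->
  bern p (1 - p) l F <= bern p (1 - p) l' F.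
Proof.
elim: l l' F => [|e l IHl] l' F ul ul' ll' iF /=.
  elim: l' F {ul' ll'} iF => [|e l' IHl'] F iF //=.
  rewrite -[leLHS]mul1r -{1}pq1 mulrDl; apply: lerD; apply: ler_wpM2l => //.
    apply: (le_trans (iF _ (upd e (fun=> false)) (@subconfig_updr _ _ _))).
    by apply: (IHl' (fun w => F (upd e w))) => w w' ww'; apply/iF/subconfig_upd.
  exact: IHl'.
have el' : e \in l' by rewrite ll' ?mem_head.
case/andP: ul => el ul; rewrite (bern_rem _ _ _ ul' el') /=.
have ll'' : {subset l <= rem e l'}.
  move=> f fl; rewrite mem_rem_uniq // inE ll' ?inE ?fl ?orbT // andbT.
  by apply: contraNneq el => <-.
apply: lerD; apply: ler_wpM2l => //; apply: IHl => //; rewrite ?rem_uniq //.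
by move=> w w' ww'; apply/iF/subconfig_upd.
Qed.

(** For one edge the increment splits into three nonnegative terms: the increments of the two inner
    expectations, and [p' - p] times the gain from opening that edge. *)
Lemma bern_mono_p p' l F : p <= p' <= 1 -> increasing F ->
  bern p (1 - p) l F <= bern p' (1 - p') l F.
Proof.
move=> /andP[pp' p'1]; elim: l F => //= e l IHl F iF.
have iF' : increasing (fun w => F (upd e w)).
  by move=> w w' ww'; apply/iF/subconfig_upd.
have h1 := IHl _ iF; have h2 := IHl _ iF'.
have h3 : bern p (1 - p) l F <= bern p (1 - p) l (fun w => F (upd e w)).
  by apply: bern_le => // w _; apply/iF/subconfig_updr.
move: h1 h2 h3.
set x := bern _ _ _ _; set x' := bern _ _ _ _.
set y := bern _ _ _ _; set y' := bern _ _ _ _ => h1 h2 h3.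
have := p0; have := q0; nra.
Qed.

(** Changing the weight of a single edge moves the expectation of a function with values between 0
    and [M] by at most [M |p' - p|]; the edges are changed one by one. *)
Lemma bern_lipschitz p' l F M : 0 <= p' <= 1 -> (forall w, 0 <= F w <= M) ->
  `|bern p' (1 - p') l F - bern p (1 - p) l F| <= (size l)%:R * M * `|p' - p|.
Proof.
move=> p'01; elim: l F => [|e l IHl] F FM /=.
  by rewrite subrr normr0 !mul0r.
have h1 := IHl _ FM; have h2 := IHl (fun w => F (upd e w)) (fun w => FM _).
have B G : (forall w, 0 <= G w <= M) -> 0 <= bern p (1 - p) l G <= M.
  move=> GM; apply/andP; split; first by apply: bern_ge0 => // w _; case/andP: (GM w).
  by apply: bern_le_cst => w _; case/andP: (GM w).
have b1 := B _ FM; have b2 := B (fun w => F (upd e w)) (fun w => FM _).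
move: h1 h2 b1 b2.
set x := bern _ _ _ _; set x' := bern _ _ _ _.
set y := bern _ _ _ _; set y' := bern _ _ _ _ => h1 h2 b1 b2.
have -> : p' * y + (1 - p') * x - (p * y' + (1 - p) * x') =
   (p' * (y - y') + (1 - p') * (x - x')) + (p' - p) * (y' - x') by ring.
have p'q : 0 <= 1 - p' by case/andP: p'01; rewrite subr_ge0.
have p'0 : 0 <= p' by case/andP: p'01.
apply: (le_trans (ler_normD _ _)); rewrite -natr1.
have -> : ((size l)%:R + 1) * M * `|p' - p| =
  (size l)%:R * M * `|p' - p| + M * `|p' - p| by ring.
apply: lerD.
  apply: (le_trans (ler_normD _ _)); rewrite !normrM (ger0_norm p'0) (ger0_norm p'q).
  have -> : (size l)%:R * M * `|p' - p| = p' * ((size l)%:R * M * `|p' - p|) +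
    (1 - p') * ((size l)%:R * M * `|p' - p|) by ring.
  by rewrite lerD // ler_wpM2l.
rewrite normrM mulrC ler_wpM2r //.
by rewrite ler_norml; case/andP: b1 => ? ?; case/andP: b2 => ? ?; apply/andP; split; lra.
Qed.

(* The van den Berg-Kesten inequality: doubling the edges one at a time. *)
Lemma bern_disjoint l (Phi : (T -> bool) -> R) (F : (T -> bool) -> (T -> bool) -> R) :
  (forall K L K' L', subconfig K K' -> subconfig L L' -> F K L <= F K' L') ->
  (forall w, on_list l w -> exists K L, [/\ subconfig K w, subconfig L w,
     forall e, K e -> L e -> False & Phi w <= F K L]) ->
  bern p (1 - p) l Phi <=
  bern p (1 - p) l (fun K => bern p (1 - p) l (fun L => F K L)).
Proof.
elim: l Phi F => [|e l IHl] Phi F iF PhiF /=.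
  have [//|K [L [K0 L0 _ /le_trans]]] := PhiF (fun=> false).
  by apply; exact: iF.
(* An edge that is open in the single copy serves at most one of the two disjoint witnesses; [F1]
   gives it to the better one. *)
pose F1 K L := Num.max (F (upd e K) L) (F K (upd e L)).
have h0 : bern p (1 - p) l Phi <= bern p (1 - p) l (fun K => bern p (1 - p) l (F K)).
  by apply: IHl => // w lw; apply: PhiF; exact: on_list_cons.
have h1 : bern p (1 - p) l (fun w => Phi (upd e w)) <=
    bern p (1 - p) l (fun K => bern p (1 - p) l (F1 K)).
  apply: IHl => [K L K' L' KK' LL'|w lw].
    rewrite /F1 ge_max !le_max; apply/andP; split; apply/orP; [left|right];
      by apply: iF => //; exact: subconfig_upd.
  have [K [L [Kw Lw KL PhiKL]]] := PhiF _ (on_list_upd lw).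
  exists (fun f => K f && w f), (fun f => L f && w f); split.
  - by move=> f /andP[].
  - by move=> f /andP[].
  - by move=> f /andP[Kf _] /andP[Lf _]; exact: (KL f).
  have inU H f : subconfig H (upd e w) -> H f -> f == e \/ (H f && w f).
    by move=> Hw Hf; case/orP: (Hw _ Hf) => [|wf]; [left|right; rewrite Hf].
  apply: (le_trans PhiKL); rewrite /F1 le_max.
  have [Ke|Ke] := boolP (K e); apply/orP; [left|right]; apply: iF => f Hf.
  - by rewrite /upd; case: (inU _ _ Kw Hf) => ->; rewrite ?orbT.
  - by case: (inU _ _ Lw Hf) => // /eqP fe; case: (KL e); rewrite // -fe.
  - by case: (inU _ _ Kw Hf) => // /eqP fe; rewrite -fe Hf in Ke.
  - by rewrite /upd; case: (inU _ _ Lw Hf) => ->; rewrite ?orbT.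
apply: (le_trans (lerD (ler_wpM2l p0 h1) (ler_wpM2l q0 h0))).
rewrite -!bernZ -!bernD; apply: bern_le => // K _ /=.
rewrite -!bernZ -!bernD -!bernZ -!bernD; apply: bern_le => // L _ /=.
(* In the doubled copy the edge is open on both sides, on one side or on none; as [F] increases in
   each argument, this average dominates [p * F1 + (1 - p) * F]. *)
have a1 : F (upd e K) L <= F (upd e K) (upd e L) by apply: iF => //; exact: subconfig_updr.
have a2 : F K (upd e L) <= F (upd e K) (upd e L) by apply: iF => //; exact: subconfig_updr.
have a3 : F K L <= F (upd e K) L by apply: iF => //; exact: subconfig_updr.
have a4 : F K L <= F K (upd e L) by apply: iF => //; exact: subconfig_updr.
have pq : 0 <= p * (1 - p) by rewrite mulr_ge0.
have pp : 0 <= p * p by rewrite mulr_ge0.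
have m1 : 0 <= p * p * (F (upd e K) (upd e L) - F (upd e K) L).
  by rewrite mulr_ge0 // subr_ge0.
have m2 : 0 <= p * p * (F (upd e K) (upd e L) - F K (upd e L)).
  by rewrite mulr_ge0 // subr_ge0.
have m3 : 0 <= p * (1 - p) * (F (upd e K) L - F K L).
  by rewrite mulr_ge0 // subr_ge0.
have m4 : 0 <= p * (1 - p) * (F K (upd e L) - F K L).
  by rewrite mulr_ge0 // subr_ge0.
move: m1 m2 m3 m4; rewrite /F1.
move: (F _ _) (F _ _) (F _ _) (F _ _) => x y z t.
by case: (leP z y) => _; lra.
Qed.

End probability.
End bern_order.

(** * Clusters and their moments *)

Section clusters.
Context {V : choiceType} {G : sgraph V}.
Implicit Types (w K L : edge G -> bool) (x y z u : V) (S : {fset V}) (U : seq V).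

Lemma open_adjP w x y :
  reflect (exists e : edge G, val e = [fset x; y]%fset /\ w e) (open_adj w x y).
Proof. exact: asboolP. Qed.

Lemma open_adj_sym w : symmetric (open_adj w).
Proof.
by move=> x y; apply/open_adjP/open_adjP => -[e [ee we]]; exists e; rewrite ee fsetUC.
Qed.

Lemma edgeP (e : edge G) : exists x y, adj G x y /\ val e = [fset x; y]%fset.
Proof. by case: e => e /= /asboolP. Qed.

Lemma edge_of_adj x y : adj G x y -> exists e : edge G, val e = [fset x; y]%fset.
Proof.
move=> xy; have ee : is_edge G [fset x; y]%fset by apply/asboolP; exists x, y.
by exists (exist (fun e => is_true (is_edge G e)) [fset x; y]%fset ee).
Qed.

Lemma open_adj_adj w x y : open_adj w x y -> adj G x y.
Proof.
case/open_adjP => e [exy _]; have [a [b [ab eab]]] := edgeP e.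
have ab0 : a != b by apply: contraTneq ab => ->; rewrite adj_irr.
have : (a \in [fset x; y])%fset by rewrite -exy eab !inE eqxx.
have : (b \in [fset x; y])%fset by rewrite -exy eab !inE eqxx orbT.
rewrite !inE => /orP[/eqP bE|/eqP bE] /orP[/eqP aE|/eqP aE].
- by rewrite aE bE eqxx in ab0.
- by rewrite adj_sym -aE -bE.
- by rewrite -aE -bE.
- by rewrite aE bE eqxx in ab0.
Qed.

Lemma open_adj_mono w w' x y : subconfig w w' -> open_adj w x y -> open_adj w' x y.
Proof. by move=> ww' /open_adjP[e [exy /ww' we]]; apply/open_adjP; exists e. Qed.

Lemma cluster_refl w x : cluster w x x.
Proof. by exists [::]. Qed.

Lemma cluster_step w x y z : cluster w x y -> open_adj w y z -> cluster w x z.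
Proof.
move=> [p [xp <-]] yz; exists (rcons p z); rewrite rcons_path last_rcons.
by rewrite xp.
Qed.

Lemma cluster_ind w x (Q : V -> Prop) : Q x ->
  (forall y z, cluster w x y -> Q y -> open_adj w y z -> Q z) ->
  forall y, cluster w x y -> Q y.
Proof.
move=> Qx Qstep y [p [xp <-]]; elim/last_ind: p xp => // p z IHp.
rewrite rcons_path last_rcons => /andP[xp pz].
by apply: Qstep (IHp xp) pz; exists p.
Qed.

Lemma cluster_trans w x y z : cluster w x y -> cluster w y z -> cluster w x z.
Proof. by move=> xy; apply: cluster_ind => // u v _ xu uv; exact: cluster_step uv. Qed.

Lemma cluster_sym w x y : cluster w x y -> cluster w y x.
Proof.
apply: (@cluster_ind _ _ (fun y => cluster w y x)); first exact: cluster_refl.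
move=> u v _ ux uv; apply: cluster_trans ux.
by apply: cluster_step (@cluster_refl _ _) _; rewrite open_adj_sym.
Qed.

Lemma cluster_mono w w' x : subconfig w w' -> cluster w x `<=` cluster w' x.
Proof.
move=> ww' y; apply: cluster_ind; first exact: cluster_refl.
by move=> u v _ xu /(open_adj_mono ww'); exact: cluster_step.
Qed.

Lemma eq_cluster w x y : cluster w x y -> cluster w x = cluster w y.
Proof.
move=> xy; apply/seteqP; split => z; first exact/cluster_trans/cluster_sym.
exact: cluster_trans.
Qed.

Lemma cluster_invariant w x (A : set V) : A x ->
  (forall y z, A y -> open_adj w y z -> A z) -> cluster w x `<=` A.
Proof. by move=> Ax stepA y; apply: cluster_ind => // u v _; exact: stepA. Qed.

(** [K] collects the open edges reached from [x] inside [S], and [L] the other open edges that avoid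
    [x]. Avoiding [x] loses nothing: an open edge at [x] that stays in [S] belongs to [K], and one
    that leaves [S] would put [x] in [Bd]. *)
Lemma explore_ball w x S (Bd : seq V) : x \in S -> x \notin Bd ->
  (forall y z, y \in S -> adj G y z -> z \notin S -> y \in Bd) ->
  exists K L, [/\ subconfig K w, subconfig L w, forall e, K e -> L e -> False,
     (forall e, K e -> (val e `<=` S)%fset) /\ (forall e, L e -> x \notin val e)
   & forall y, cluster w x y -> cluster K x y \/
       exists2 u, u \in Bd /\ cluster K x u & cluster L u y].
Proof.
move=> xS xBd SBd.
pose K0 : edge G -> bool := fun e => w e && (val e `<=` S)%fset.
pose K : edge G -> bool :=
  fun e => K0 e && `[< forall v, v \in val e -> cluster K0 x v >].
pose L : edge G -> bool := fun e => [&& w e, ~~ K e & x \notin val e].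
have KK0 : cluster K0 x `<=` cluster K x.
  apply: cluster_ind; first exact: cluster_refl.
  move=> y z xy Kxy yz; apply: cluster_step Kxy _.
  case/open_adjP: (yz) => e [eyz Ke]; apply/open_adjP; exists e; split => //.
  rewrite /K Ke; apply/asboolP => v; rewrite eyz !inE => /orP[/eqP->|/eqP->] //.
  exact: cluster_step yz.
have KsubK0 : subconfig K K0 by move=> e /andP[].
have inS : cluster K0 x `<=` [set y | y \in S].
  apply: cluster_invariant => // y z _ /open_adjP[e [eyz /andP[_ /fsubsetP eS]]].
  by apply: eS; rewrite eyz !inE eqxx orbT.
exists K, L; split.
- by move=> e /KsubK0 /andP[].
- by move=> e /and3P[].
- by move=> e Ke /and3P[_]; rewrite Ke.
- by split=> e; [case/KsubK0/andP|case/and3P].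
have xL u v e : val e = [fset u; v]%fset -> w e -> ~ cluster K x v -> u != x -> L e.
  move=> euv we vK ux; apply/and3P; split => //; last first.
    rewrite euv !inE negb_or eq_sym ux; apply/eqP => xv.
    by apply: vK; rewrite -xv; exact: cluster_refl.
  apply/negP => /andP[_ /asboolP /(_ v)]; rewrite euv !inE eqxx orbT => vK0.
  by apply/vK/KK0/vK0.
apply: cluster_ind; first by left; exact: cluster_refl.
move=> y z _ IHy yz; have [Kz|Kz] := pselect (cluster K x z); [by left|right].
case/open_adjP: (yz) => e [eyz we].
have yx : ~ cluster K x y -> y != x.
  by move=> yK; apply/eqP => yx; apply: yK; rewrite yx; exact: cluster_refl.
have LE : y != x -> open_adj L y z.
  by move=> yx'; apply/open_adjP; exists e; split => //; exact: xL eyz we Kz yx'.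
have [Ky|Ky] := pselect (cluster K x y); last first.
  by case: IHy => // -[u uB uy]; exists u => //; apply: cluster_step uy (LE (yx Ky)).
have yS : y \in S by apply: inS; exact: cluster_mono Ky.
have zS : z \notin S.
  apply/negP => zS; apply: Kz; apply: KK0.
  apply: (@cluster_step _ _ y); first exact: cluster_mono Ky.
  apply/open_adjP; exists e; split => //; rewrite /K0 we /= eyz.
  by apply/fsubsetP => v; rewrite !inE => /orP[/eqP->|/eqP->].
have yB : y \in Bd by apply: SBd yS (open_adj_adj yz) zS.
exists y; first by split.
apply: cluster_step (@cluster_refl _ _) (LE _).
by apply: contraNneq xBd => <-.
Qed.

(** [K] consists of the open edges of the cluster of [x]; a connection that stays out of that
    cluster uses only the remaining edges. This lets several clusters be explored with disjoint sets
    of edges. *)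
Lemma explore_cluster w x :
  exists K L, [/\ subconfig K w, subconfig L w, forall e, K e -> L e -> False,
     cluster w x `<=` cluster K x
   & forall z y, cluster w z y -> cluster K x y \/ cluster L z y].
Proof.
pose K : edge G -> bool := fun e => w e && `[< forall v, v \in val e -> cluster w x v >].
have KE : cluster w x `<=` cluster K x.
  apply: cluster_ind; first exact: cluster_refl.
  move=> u v xu Kxu uv; apply: cluster_step Kxu _.
  case/open_adjP: (uv) => e [euv we]; apply/open_adjP; exists e; split => //.
  rewrite /K we; apply/asboolP => v'; rewrite euv !inE => /orP[/eqP->|/eqP->] //.
  exact: cluster_step uv.
exists K, (fun e => w e && ~~ K e); split => //.
- by move=> e /andP[].
- by move=> e /andP[].
- by move=> e -> /andP[].
move=> z; apply: cluster_ind; first by right; exact: cluster_refl.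
move=> u v _ IHu uv; have [xv|xv] := pselect (cluster w x v); [by left; exact: KE|right].
have xu : ~ cluster w x u by move=> xu; apply: xv; exact: cluster_step uv.
case: IHu => [Kxu|zu]; first by case: xu; apply: cluster_mono Kxu => e /andP[].
apply: cluster_step zu _.
case/open_adjP: (uv) => e [euv we]; apply/open_adjP; exists e; split => //.
rewrite we /=; apply/negP => /andP[_ /asboolP/(_ v)].
by rewrite euv !inE eqxx orbT => /(_ isT).
Qed.

Fixpoint path_edges (x : V) (p : seq V) (e : edge G) : bool :=
  if p is y :: p' then (val e == [fset x; y]%fset) || path_edges y p' e else false.

Lemma path_edges_cat x p q e :
  path_edges x (p ++ q) e = path_edges x p e || path_edges (last x p) q e.
Proof.
by elim: p x => [|a p IHp] x //=; rewrite IHp orbA.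
Qed.

Lemma path_edges_verts x p e v : path_edges x p e -> v \in val e -> v \in x :: p.
Proof.
elim: p x => [|y p IHp] x //= /orP[/eqP->|/IHp{}IHp].
  by rewrite !inE => /orP[->|->]; rewrite ?orbT.
by move=> /IHp yp; rewrite inE yp orbT.
Qed.

Lemma cluster_path_edges x p : path (adj G) x p -> cluster (path_edges x p) x (last x p).
Proof.
elim: p x => [|y p IHp] x /=; first by move=> _; exact: cluster_refl.
move=> /andP[xy yp]; apply: (@cluster_trans _ _ y).
  apply: cluster_step (@cluster_refl _ _) _; apply/open_adjP.
  have [e exy] := edge_of_adj xy.
  by exists e; rewrite /= exy eqxx.
apply: cluster_mono (IHp _ yp) => e /= ->.
by rewrite orbT.
Qed.

Lemma path_edges_sub w x p : path (open_adj w) x p -> subconfig (path_edges x p) w.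
Proof.
elim: p x => [|y p IHp] x //= /andP[/open_adjP[e' [e'xy we']] yp] e.
case/orP => [/eqP ee|]; last exact: IHp.
by rewrite (_ : e = e') //; apply: val_inj; rewrite /= e'xy -ee.
Qed.

(** A common edge would have both its ends at the junction, and the graph has no loops. *)
Lemma path_edges_disjoint x p q e : uniq (x :: p ++ q) ->
  path_edges x p e -> path_edges (last x p) q e -> False.
Proof.
move=> upq ep eq; have [a [b [ab eab]]] := edgeP e.
have onlast v : v \in val e -> v = last x p.
  move=> ve; have := path_edges_verts ep ve; have := path_edges_verts eq ve.
  rewrite inE => /orP[/eqP //|vq] vp.
  by move: upq; rewrite -cat_cons cat_uniq => /and3P[_ /hasPn/(_ _ vq)]; rewrite vp.
move: ab; rewrite (onlast a) ?eab ?inE ?eqxx // (onlast b) ?eab ?inE ?eqxx ?orbT //.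
by rewrite adj_irr.
Qed.

Lemma cluster_simple_path w x y : cluster w x y ->
  exists p, [/\ path (open_adj w) x p, last x p = y & uniq (x :: p)].
Proof.
by move=> [p [xp <-]]; case: (shortenP xp) => q xq uq _; exists q.
Qed.

(** Disjoint occurrence of two connections, in the sense of van den Berg and Kesten. *)
Definition connected_via w x u y := exists K L,
  [/\ subconfig K w, subconfig L w, forall e, K e -> L e -> False,
      cluster K x u & cluster L u y].

(** Every point of the cluster hangs off a simple open path from [x] to [y] at some vertex [u], and
    simplicity makes the two arms of the path at [u] edge-disjoint. This is the decomposition behind
    the tree-graph inequality for three connected points. *)
Lemma explore_path w x y : cluster w x y ->
  exists K L, [/\ subconfig K w, subconfig L w, forall e, K e -> L e -> False
   & forall z, cluster w x z ->
       exists2 u, connected_via K x u y /\ cluster w x u & cluster L u z].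
Proof.
move=> /cluster_simple_path[p [xp py up]].
have vias u : u \in x :: p -> connected_via (path_edges x p) x u y /\ cluster w x u.
  move=> uxp; have [p1 [p2 [pE pu]]] : exists p1 p2, p = p1 ++ p2 /\ last x p1 = u.
    by case/splitPl: uxp => p1 p2 lu; exists p1, p2.
  have : path (open_adj w) x (p1 ++ p2) by rewrite -pE.
  rewrite cat_path pu => /andP[xp1 up2].
  have sub1 : subconfig (path_edges x p1) w by exact: path_edges_sub.
  have xu : cluster (path_edges x p1) x u.
    rewrite -pu; apply: cluster_path_edges.
    by apply: sub_path xp1 => a b; exact: open_adj_adj.
  split; last exact: cluster_mono xu.
  have catE e : path_edges x p e = path_edges x p1 e || path_edges u p2 e.
    by rewrite pE path_edges_cat pu.
  exists (path_edges x p1), (path_edges u p2); split => //.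
  - by move=> e ep; rewrite catE ep.
  - by move=> e ep; rewrite catE ep orbT.
  - by move=> e e1 e2; apply: (@path_edges_disjoint x p1 p2 e); rewrite -?pE ?pu.
  - rewrite -py pE last_cat pu; apply: cluster_path_edges.
    by apply: sub_path up2 => a b; exact: open_adj_adj.
exists (path_edges x p), (fun e => w e && ~~ path_edges x p e); split.
- exact: path_edges_sub.
- by move=> e /andP[].
- by move=> e -> /andP[].
apply: cluster_ind => [|a b _ [u uv ua] ab].
  by exists x; [apply: vias; rewrite mem_head|exact: cluster_refl].
case/open_adjP: (ab) => e [eab we].
have [pe|pe] := boolP (path_edges x p e).
  exists b; last exact: cluster_refl.
  by apply/vias/(path_edges_verts pe); rewrite eab !inE eqxx orbT.
exists u => //; apply: cluster_step ua _.
by apply/open_adjP; exists e; rewrite we pe.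
Qed.

Lemma connected_via_mono w w' x u y : subconfig w w' ->
  connected_via w x u y -> connected_via w' x u y.
Proof.
move=> ww' [K [L [Kw Lw KL xu uy]]]; exists K, L; split => //.
- by move=> e /Kw/ww'.
- by move=> e /Lw/ww'.
Qed.

(** The cluster may be infinite; counting it within a finite list keeps all expectations within
    [bern]. *)
Definition csize U w x : nat := count (mem (cluster w x)) U.

Lemma csizeE (R : pzSemiRingType) U w x :
  (csize U w x)%:R = \sum_(y <- U) (y \in cluster w x)%:R :> R.
Proof.
rewrite /csize -sum1_count natr_sum big_mkcond /=; apply: eq_bigr => y _.
by case: (_ \in _).
Qed.

Lemma csize_mono U w w' x : subconfig w w' -> (csize U w x <= csize U w' x)%N.
Proof.
move=> ww'; apply: sub_count => y /=; rewrite !inE.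
exact: cluster_mono.
Qed.

Lemma csize_le U w x : (csize U w x <= size U)%N.
Proof. exact: count_size. Qed.

Definition touched (l : seq (edge G)) : seq V := flatten [seq enum_fset (val e) | e <- l].

Lemma cluster_touched l w x y : on_list l w -> cluster w x y -> y \in x :: touched l.
Proof.
move=> lw; apply: (cluster_invariant (A := [set y | y \in x :: touched l])).
  by rewrite /= mem_head.
move=> a b _ /open_adjP[e [eab /lw el]] /=; rewrite inE; apply/orP; right.
rewrite /touched; apply/(@flatten_mapP (edge G) V (fun e => enum_fset (val e))).
exists e => //.
by rewrite -[_ \in _]/(b \in val e) eab !inE eqxx orbT.
Qed.

End clusters.

Section cluster_moments.
Context {R : realType} {V : choiceType} {G : sgraph V}.
Implicit Types (p M : R) (l : seq (edge G)) (U X : seq V) (x y u : V).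
Implicit Types (w K L : edge G -> bool).

Lemma bern_prod p l (f g : (edge G -> bool) -> R) :
  bern p (1 - p) l (fun K => bern p (1 - p) l (fun L => f K * g L)) =
  bern p (1 - p) l f * bern p (1 - p) l g.
Proof.
under eq_bern do rewrite bernZ mulrC.
by rewrite bernZ mulrC.
Qed.

(** Stands for a bound on the expected cluster size, expressed by finite windows only and uniform in
    the window and in the root. *)
Definition chi_bound p M := forall l U x, uniq l -> uniq U ->
  bern p (1 - p) l (fun w => (csize U w x)%:R) <= M.

Section fixed_parameter.
Variable p : R.
Hypothesis p01 : 0 <= p <= 1.
Let p0 : 0 <= p. Proof. by case/andP: p01. Qed.
Let q0 : 0 <= 1 - p. Proof. by case/andP: p01; rewrite subr_ge0. Qed.

Let ind_mono w w' x y : subconfig w w' ->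
  (y \in cluster w x)%:R <= (y \in cluster w' x)%:R :> R.
Proof.
move=> ww'; rewrite ler_nat; case: (boolP (_ \in cluster w x)) => //.
by rewrite inE => /(cluster_mono ww') h; rewrite mem_set.
Qed.

Lemma bern_connected_via l x u y :
  bern p (1 - p) l (fun w => `[< connected_via w x u y >]%:R) <=
  bern p (1 - p) l (fun w => (u \in cluster w x)%:R) *
  bern p (1 - p) l (fun w => (y \in cluster w u)%:R).
Proof.
rewrite -bern_prod; apply: bern_disjoint => // [K L K' L' KK' LL'|w lw].
  by apply: ler_pM => //; exact: ind_mono.
have [[K [L [Kw Lw KL xu uy]]]|nv] := pselect (connected_via w x u y).
  by exists K, L; split => //; rewrite !mem_set // mulr1 lern1 leq_b1.
by exists (fun=> false), (fun=> false); split => //; rewrite asboolF // mulr_ge0.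
Qed.

(* An open simple path from [x] to [y] and the clusters that hang off it use
   disjoint edges. *)
Lemma second_moment M l U x : 0 <= M -> chi_bound p M -> uniq l -> uniq U ->
  bern p (1 - p) l (fun w => (csize U w x)%:R ^+ 2) <= M ^+ 3.
Proof.
move=> M0 chiM ul uU.
(* For a configuration on [l] the cluster of [x] consists of [x] and of ends of edges of [l], so the
   sum over the branching vertex [u] is finite. *)
pose W := undup (x :: touched l).
have step y : bern p (1 - p) l
      (fun w => (y \in cluster w x)%:R * (csize U w x)%:R) <=
    M * \sum_(u <- W) bern p (1 - p) l (fun w => `[< connected_via w x u y >]%:R).
  pose F K L : R := \sum_(u <- W) (`[< connected_via K x u y >]%:R * (csize U L u)%:R).
  apply: (@le_trans _ _ (bern p (1 - p) l (fun K => bern p (1 - p) l (F K)))).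
    apply: bern_disjoint => // [K L K' L' KK' LL'|w lw].
      apply: ler_sum => u _; apply: ler_pM => //; rewrite ler_nat ?csize_mono //.
      case: (pselect (connected_via K x u y)) => [h|h].
        by rewrite !asboolT //; exact: connected_via_mono h.
      by rewrite asboolF.
    have [xy|xy] := boolP (y \in cluster w x); last first.
      exists (fun=> false), (fun=> false); split => //.
      by rewrite mul0r sumr_ge0 // => u _; rewrite mulr_ge0.
    rewrite inE in xy; have [K [L [Kw Lw KL cov]]] := explore_path xy.
    exists K, L; split => //; rewrite mul1r /F.
    under eq_bigr do rewrite csizeE mulr_sumr.
    rewrite csizeE exchange_big /=; apply: ler_sum => z _.
    have [xz|_] := boolP (z \in cluster w x); last first.
      by apply: sumr_ge0 => u _; rewrite mulr_ge0.
    rewrite inE in xz; have [u [viau xu] uz] := cov _ xz.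
    have uW : u \in W by rewrite mem_undup; exact: cluster_touched xu.
    rewrite (bigD1_seq u) ?undup_uniq //= asboolT // mem_set // mulr1 lerDl.
    by apply: sumr_ge0 => v _; rewrite mulr_ge0.
  under eq_bern do rewrite /F bern_sum.
  rewrite bern_sum mulr_sumr; apply: ler_sum => u _.
  rewrite bern_prod mulrC ler_wpM2r //; last exact: chiM.
  by apply: bern_ge0.
under eq_bern do rewrite expr2 {1}csizeE mulr_suml.
rewrite bern_sum; apply: (le_trans (ler_sum _ (fun y _ => step y))).
rewrite -mulr_sumr exprS ler_wpM2l // exchange_big /=.
have chi1 z (T : seq V) : uniq T ->
    \sum_(u <- T) bern p (1 - p) l (fun w => (u \in cluster w z)%:R) <= M.
  move=> uT; apply: le_trans (chiM l T z ul uT); rewrite -bern_sum.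
  by under [leRHS]eq_bern do rewrite csizeE.
apply: (@le_trans _ _ (\sum_(u <- W)
    bern p (1 - p) l (fun w => (u \in cluster w x)%:R) * M)).
  apply: ler_sum => u _.
  apply: (le_trans (ler_sum _ (fun y _ => bern_connected_via l x u y))).
  by rewrite -mulr_sumr ler_wpM2l ?chi1 // bern_ge0.
by rewrite -mulr_suml expr2 ler_wpM2r // chi1 // undup_uniq.
Qed.

Definition csizes U (w : edge G -> bool) X : nat :=
  count (fun y => has (fun x => y \in cluster w x) X) U.

(** The clusters are explored in turn, each with edges left over by the previous ones; the van den
    Berg-Kesten inequality then compares their union with independent clusters. *)
Lemma bern_csizes (theta : R) l U X : 1 <= theta ->
  bern p (1 - p) l (fun w => theta ^+ csizes U w X) <=
  \prod_(x <- X) bern p (1 - p) l (fun w => theta ^+ csize U w x).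
Proof.
move=> theta1; have theta0 : 0 <= theta by exact: le_trans theta1.
elim: X => [|x X IHX].
  rewrite big_nil; apply: bern_le_cst => // w _.
  by rewrite /csizes (eq_count (a2 := pred0)) // count_pred0.
rewrite big_cons; apply: (@le_trans _ _ (bern p (1 - p) l (fun K =>
    bern p (1 - p) l (fun L => theta ^+ csize U K x * theta ^+ csizes U L X)))).
  apply: bern_disjoint => // [K L K' L' KK' LL'|w _].
    rewrite -!exprD ler_weXn2l // leq_add ?csize_mono //.
    apply: sub_count => y /hasP[z zX yz]; apply/hasP; exists z => //.
    by move: yz; rewrite !inE; exact: cluster_mono.
  have [K [L [Kw Lw KL covx cov]]] := explore_cluster w x.
  exists K, L; split => //; rewrite -exprD ler_weXn2l //.
  rewrite /csizes /csize -count_predUI -[leqLHS]addn0 leq_add //.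
  apply: sub_count => y /= /orP[|/hasP[z zX]].
    by move=> /set_mem xy; rewrite mem_set //; exact: covx.
  move=> /set_mem /cov[xy|zy]; first by rewrite mem_set.
  by apply/orP; right; apply/hasP; exists z => //; rewrite mem_set.
by rewrite bern_prod ler_wpM2l // bern_ge0 // => w _; rewrite exprn_ge0.
Qed.

Section exploration.
Variables (S : V -> {fset V}) (Bd : V -> seq V) (b : nat).
Hypotheses (xS : forall x, x \in S x) (xBd : forall x, x \notin Bd x)
  (SBd : forall x y z, y \in S x -> adj G y z -> z \notin S x -> y \in Bd x)
  (Sb : forall x, (#|` S x| <= b)%N) (Bdb : forall x, (size (Bd x) <= b)%N).

Definition inside (A : {fset V}) (w : edge G -> bool) : edge G -> bool :=
  fun e => (val e `<=` A)%fset && w e.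

Definition exits x w := csize (Bd x) (inside (S x) w) x.

Hypothesis half : forall x l, uniq l ->
  bern p (1 - p) l (fun w => (exits x w)%:R) <= 1 / 2.

Variables (s theta : R).
Hypotheses (s0 : 0 <= s) (theta1 : 1 <= theta) (theta_s : theta <= 1 + s)
  (contract : theta ^+ b * (1 + s * (1 + s) ^+ b / 2) <= 1 + s).

Let theta0 : 0 <= theta. Proof. exact: le_trans theta1. Qed.

(** Linearity in [n] leaves the expected number of exits as the only quantity to control; with it,
    [contract] says that the bound [1 + s] on the exponential moment reproduces itself. *)
Lemma expr_le_secant n : (n <= b)%N -> (1 + s) ^+ n <= 1 + n%:R * (s * (1 + s) ^+ b).
Proof.
have s1 : 1 <= 1 + s by rewrite lerDl.
elim: n => [|n IHn] nb; first by rewrite expr0 mul0r addr0.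
have h := IHn (ltnW nb); have h2 : (1 + s) ^+ n <= (1 + s) ^+ b.
  by rewrite ler_weXn2l // ltnW.
have h3 : s * (1 + s) ^+ n <= s * (1 + s) ^+ b by rewrite ler_wpM2l.
rewrite exprS -natr1; lra.
Qed.

(* The part of the cluster inside [S x] is explored first; what hangs off its
   exits uses other edges, none of them at [x], which allows an induction on
   the number of edges. *)
Lemma exponential_moment l U x : uniq l -> uniq U ->
  bern p (1 - p) l (fun w => theta ^+ csize U w x) <= 1 + s.
Proof.
move=> + uU; have [n] := ubnP (size l); elim: n l x => // n IHn l x sl ul.
(* [star] selects the edges that avoid [x]. If all of [l] does, the cluster is [{x}]; otherwise
   filtering by [star] shortens [l]. *)
pose star := [pred e : edge G | x \notin val e].
have [noedge|edge_x] := boolP (all star l).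
  apply: bern_le_cst => // w lw; apply: le_trans theta_s.
  rewrite -[leRHS]expr1 ler_weXn2l //.
  suff Cx y : y \in cluster w x -> y == x.
    have -> : csize U w x = count (pred1 x) U.
      apply: eq_count => y /=; apply/idP/idP; first exact: Cx.
      by move=> /eqP ->; rewrite mem_set //; exact: cluster_refl.
    by rewrite count_uniq_mem // leq_b1.
  rewrite inE => xy; apply/eqP; move: y xy.
  apply: (@cluster_ind _ _ w x (fun y => y = x)) => // y z _ -> /open_adjP[e [exz /lw el]].
  by move/allP/(_ _ el): noedge; rewrite /= exz !inE eqxx.
have sl' : (size (seq.filter star l) < n)%N.
  rewrite -ltnS (leq_trans _ sl) // ltnS size_filter -(count_predC star l).
  by rewrite -[X in (X < _)%N]addn0 ltn_add2l -has_count has_predC.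
pose Y K := [seq u <- Bd x | u \in cluster (inside (S x) K) x].
pose L' (L : edge G -> bool) : edge G -> bool := fun e => star e && L e.
(* The factor [theta ^+ b] pays for the vertices of [S x]; the clusters of the exits reached inside
   [S x] cover the rest. *)
apply: (@le_trans _ _ (bern p (1 - p) l (fun K => bern p (1 - p) l (fun L =>
    theta ^+ b * theta ^+ csizes U (L' L) (Y K))))).
  apply: bern_disjoint => // [K L K1 L1 KK1 LL1|w _].
    rewrite ler_wpM2l ?exprn_ge0 // ler_weXn2l //; apply: sub_count => y /hasP[u].
    rewrite mem_filter => /andP[/set_mem uK uB] /set_mem uy; apply/hasP; exists u.
      rewrite mem_filter uB andbT mem_set //; apply: (cluster_mono _ uK) => e.
      by rewrite /inside => /andP[-> /KK1 ->].
    rewrite mem_set //; apply: (cluster_mono _ uy) => e.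
    by rewrite /L' => /andP[-> /LL1 ->].
  have [K [L [Kw Lw KL [KS Lx] cov]]] := explore_ball w (xS x) (xBd x) (@SBd x).
  have KE : inside (S x) K = K.
    apply/funext => e; rewrite /inside; have [Ke|Ke] := boolP (K e); last by rewrite andbF.
    by rewrite KS.
  have LE : L' L = L.
    apply/funext => e; rewrite /L'; have [Le|Le] := boolP (L e); last by rewrite andbF.
    by rewrite /= Lx.
  exists K, L; split => //; rewrite LE -exprD ler_weXn2l //.
  have KinS : cluster K x `<=` [set y | y \in S x].
    apply: cluster_invariant => [|y z _ /open_adjP[e [eyz /KS /fsubsetP]]]; first exact: xS.
    by apply; rewrite eyz !inE eqxx orbT.
  apply: (@leq_trans (count (mem (S x)) U + csizes U L (Y K))).
    rewrite /csizes /csize -count_predUI -[leqLHS]addn0 leq_add //.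
    apply: sub_count => y /=; rewrite inE => /cov[Ky|[u [uB xu] uy]].
      by rewrite (KinS _ Ky).
    apply/orP; right; apply/hasP; exists u; last by rewrite mem_set.
    by rewrite mem_filter uB andbT KE mem_set.
  rewrite leq_add2r (leq_trans _ (Sb x)) // -size_filter.
  by apply: uniq_leq_size => [|y]; rewrite ?filter_uniq // mem_filter => /andP[].
(* For fixed [K], the clusters of the exits live on the shortened list, where the induction
   hypothesis bounds each factor by [1 + s]. *)
apply: (@le_trans _ _ (bern p (1 - p) l (fun K =>
    theta ^+ b * (1 + (exits x K)%:R * (s * (1 + s) ^+ b))))).
  apply: bern_le => // K _; rewrite bernZ ler_wpM2l ?exprn_ge0 //.
  have -> : bern p (1 - p) l (fun L => theta ^+ csizes U (L' L) (Y K)) =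
      bern p (1 - p) (seq.filter star l) (fun L => theta ^+ csizes U L (Y K)).
    transitivity (bern p (1 - p) (seq.filter star l)
        (fun L => theta ^+ csizes U (L' L) (Y K))).
      apply: bern_filter => [|L]; first by rewrite addrC subrK.
      congr (_ ^+ csizes _ _ _); apply/funext => e.
      by rewrite /L' andbA andbb.
    apply: eq_bern_on => L lL; congr (_ ^+ csizes _ _ _); apply/funext => e.
    rewrite /L'; case Le: (L e); rewrite ?andbF // andbT.
    by move/lL: Le; rewrite mem_filter => /andP[].
  apply: (le_trans (bern_csizes _ _ _ _)) => //.
  apply: (@le_trans _ _ (\prod_(u <- Y K) (1 + s))).
    rewrite big_seq [leRHS]big_seq; apply: ler_prod => u _; apply/andP; split.
      by apply: bern_ge0 => // w _; rewrite exprn_ge0.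
    by apply: IHn; rewrite ?filter_uniq.
  rewrite big_const_seq count_predT iter_mulr_1 /Y size_filter; apply: expr_le_secant.
  by rewrite (leq_trans _ (Bdb x)) // count_size.
rewrite bernZ bernD bern_cst; last by rewrite addrC subrK.
under eq_bern do rewrite mulrC.
rewrite bernZ; apply: le_trans contract; rewrite ler_wpM2l ?exprn_ge0 // lerD2l.
rewrite -mulrA mulrA ler_wpM2l //; last by rewrite -div1r half.
by rewrite mulr_ge0 // exprn_ge0 // addr_ge0.
Qed.

End exploration.
End fixed_parameter.
End cluster_moments.

(** * Balls, constants of the exploration and the finite-size criterion *)

Section balls.
Context {V : choiceType} (G : sgraph V).
Implicit Types (x y z : V) (A : {fset V}).

Definition nbs x : {fset V} := fset_set (nbhd G x).

Fixpoint ball_seq n x : seq V :=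
  if n is n'.+1 then ball_seq n' x ++ flatten [seq enum_fset (nbs y) | y <- ball_seq n' x]
  else [:: x].

Definition ball n x : {fset V} := [fset y in ball_seq n x]%fset.

(** These are the vertices at distance [n + 1], so that [sphere n x] contains the inner boundary of
    [ball n.+1 x]. *)
Definition sphere n x : seq V := [seq y <- ball n.+1 x | y \notin ball n x].

(** One end in [A] is enough: the edges that leave [A] also take part in deciding whether a cluster
    equals [A]. *)
Definition edges_at A : seq (edge G) :=
  undup (pmap insub (flatten [seq [seq [fset x; y]%fset | y <- nbs x] | x <- A])).

Hypothesis fin : forall x, finite_set (nbhd G x).

Lemma in_nbs x y : (y \in nbs x) = adj G x y.
Proof. by rewrite /nbs in_fset_set //; apply/idP/idP; rewrite inE. Qed.

Lemma in_ball n x y : (y \in ball n x) = (y \in ball_seq n x).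
Proof. by rewrite /ball inE. Qed.

Lemma ballS n x y z : y \in ball n x -> adj G y z -> z \in ball n.+1 x.
Proof.
rewrite !in_ball /= mem_cat => yb yz; apply/orP; right.
by apply/flattenP; exists (enum_fset (nbs y)); [apply/mapP; exists y|rewrite -[_ \in _]/(z \in nbs y) in_nbs].
Qed.

Lemma sub_ballS n x : (ball n x `<=` ball n.+1 x)%fset.
Proof. by apply/fsubsetP => y; rewrite !in_ball /= mem_cat => ->. Qed.

Lemma ball_center n x : x \in ball n x.
Proof.
elim: n => [|n IHn]; first by rewrite in_ball mem_head.
by move/fsubsetP: (sub_ballS n x); exact.
Qed.

Lemma mem_edges_at A (e : edge G) x : x \in A -> x \in val e -> e \in edges_at A.
Proof.
move=> xA xe; rewrite mem_undup mem_pmap_sub /=.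
have [a [b [ab eab]]] := edgeP e.
suff [y xy ->] : exists2 y, adj G x y & val e = [fset x; y]%fset.
  apply/flattenP; exists [seq [fset x; y]%fset | y <- nbs x]; first by apply/mapP; exists x.
  by apply/mapP; exists y => //; rewrite in_nbs.
move: xe; rewrite eab !inE => /orP[/eqP->|/eqP->]; first by exists b.
by exists a; rewrite 1?adj_sym // fsetUC.
Qed.

Lemma edges_at_touch A (e : edge G) : e \in edges_at A -> exists2 x, x \in A & x \in val e.
Proof.
rewrite mem_undup mem_pmap_sub => /flattenP[_ /mapP[x xA ->] /mapP[y _ ey]].
by exists x; rewrite // [val e]ey !inE eqxx.
Qed.

Lemma edges_at_uniq A : uniq (edges_at A).
Proof. exact: undup_uniq. Qed.

Variable D : nat.
Hypothesis deg : forall x, (degree G x <= D)%N.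

Lemma size_ball n x : (#|` ball n x| <= D.+1 ^ n)%N.
Proof.
apply: (@leq_trans (size (ball_seq n x))).
  apply: uniq_leq_size => [|y]; first exact: fset_uniq.
  by rewrite -[_ \in enum_fset _]/(y \in ball n x) in_ball.
elim: n => // n IHn; rewrite /= size_cat expnS mulSn leq_add //.
rewrite size_flatten (leq_trans _ (leq_mul (leqnn D) IHn)) //.
elim: (ball_seq n x) => //= y s IHs; rewrite mulnS leq_add //.
exact: deg.
Qed.

Lemma size_edges_at A : (size (edges_at A) <= D * #|` A|)%N.
Proof.
apply: (leq_trans (size_undup _)); rewrite size_pmap_sub.
apply: (leq_trans (count_size _ _)); rewrite size_flatten /shape -map_comp.
elim: (enum_fset A) => //= y s IHs; rewrite mulnS leq_add // size_map.
exact: deg.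
Qed.

Lemma sum_csize_sphere N x (w : edge G -> bool) :
  (\sum_(n < N) csize (sphere n x) w x <= csize (ball N x) w x)%N.
Proof.
elim: N => [|N IHN]; first by rewrite big_ord0.
rewrite big_ord_recr /= (leq_trans (leq_add IHN (leqnn _))) //.
have -> : csize (ball N x) w x = csize [seq y <- ball N.+1 x | y \in ball N x] w x.
  apply/permP/uniq_perm; rewrite ?filter_uniq ?fset_uniq // => y.
  rewrite mem_filter -[_ \in enum_fset (ball N x)]/(y \in ball N x).
  by case yN: (y \in ball N x) => //=; apply/esym; move/fsubsetP: (sub_ballS N x); exact.
rewrite /csize /sphere -count_cat leq_eqVlt; apply/orP; left; apply/eqP.
by apply/permP; rewrite perm_filterC.
Qed.

End balls.

(** Gives the upper bound [1 / (1 - n t)] for [(1 + t) ^ n] when [n t < 1], a converse to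
    Bernoulli's inequality. *)
Lemma expr_inv_bound (R : realType) (t : R) n : 0 <= t -> (1 + t) ^+ n * (1 - n%:R * t) <= 1.
Proof.
move=> t0; elim: n => [|n IHn]; first by rewrite expr0 mul0r subr0 mul1r.
apply: le_trans IHn; rewrite exprSr -mulrA ler_wpM2l //.
  by rewrite exprn_ge0 // addr_ge0.
have n0 : 0 <= n%:R :> R by [].
rewrite -natr1; nra.
Qed.

Lemma exploration_constants (R : realType) (b : nat) : exists s theta : R,
  [/\ 0 <= s, 1 < theta, theta <= 1 + s &
      theta ^+ b * (1 + s * (1 + s) ^+ b / 2) <= 1 + s].
Proof.
have b1 : 0 < b.+1%:R :> R by [].
(* [b s <= 1/4] keeps [(1 + s) ^ b] below [4/3], so the bracket is at most [1 + 2 s / 3];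
   [b t <= s / 6] leaves room for [(1 + t) ^ b], as [1 + 2 s / 3 <= (1 + s) (1 - b t)]. *)
pose s : R := (4 * b.+1%:R)^-1; pose t : R := s / (6 * b.+1%:R).
have bE : b.+1%:R = b%:R + 1 :> R by rewrite natr1.
have b0 : 0 <= b%:R :> R by [].
have s0 : 0 < s by rewrite invr_gt0 mulr_gt0.
have t0 : 0 < t by rewrite divr_gt0 // mulr_gt0.
have sb : 4 * (b%:R * s) + 4 * s = 1.
  by rewrite /s bE; field; rewrite -bE; exact: lt0r_neq0.
have tb : 6 * (b%:R * t) + 6 * t = s.
  by rewrite /t bE; field; rewrite -bE; exact: lt0r_neq0.
have bs0 : 0 <= b%:R * s by rewrite mulr_ge0 // ltW.
have bt0 : 0 <= b%:R * t by rewrite mulr_ge0 // ltW.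
have hs := @expr_inv_bound _ s b (ltW s0); have ht := @expr_inv_bound _ t b (ltW t0).
exists s, (1 + t); split; [exact: ltW|by rewrite ltrDl|by rewrite lerD2l; lra|].
have p1 : 0 <= (1 + s) ^+ b by rewrite exprn_ge0 // addr_ge0 // ltW.
have p2 : 0 <= (1 + t) ^+ b by rewrite exprn_ge0 // addr_ge0 // ltW.
move: hs ht p1 p2; set x := _ ^+ b; set y := (1 + t) ^+ b => hs ht p1 p2.
have x43 : x <= 4 / 3 by nra.
have h : 1 + s * x / 2 <= 1 + 2 / 3 * s by nra.
apply: (@le_trans _ _ (y * (1 + 2 / 3 * s))); first by rewrite ler_wpM2l.
have h2 : 1 + 2 / 3 * s <= (1 + s) * (1 - b%:R * t) by nra.
apply: (@le_trans _ _ (y * ((1 + s) * (1 - b%:R * t)))); first by rewrite ler_wpM2l.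
rewrite mulrCA -[leRHS]mulr1 ler_wpM2l //; lra.
Qed.

Section subcritical.
Context {R : realType} {V : choiceType} {G : sgraph V}.
Variable D : nat.
Hypotheses (fin : forall x, finite_set (nbhd G x)) (deg : forall x, (degree G x <= D)%N).

(* The spheres are disjoint: among the first [4 M], one carries at most [1 / 4]. *)
Lemma sphere_expectation (p M : R) : 0 <= p <= 1 -> chi_bound (G := G) p M ->
  exists N, forall x, exists2 n, (n < N)%N &
    bern p (1 - p) (edges_at G (ball G n.+1 x)) (fun w => (csize (sphere G n x) w x)%:R)
      <= 1 / 4.
Proof.
move=> p01 chiM; have [p0 q0] : 0 <= p /\ 0 <= 1 - p by case/andP: p01; rewrite subr_ge0.
pose N := (Num.truncn (4 * `|M|)).+1.
have NM : 4 * M < N%:R.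
  by rewrite (le_lt_trans _ (truncnS_gt _)) // ler_wpM2l // ler_norm.
exists N => x; apply: contrapT => noN.
have big n : (n < N)%N -> 1 / 4 <= bern p (1 - p) (edges_at G (ball G N x))
    (fun w => (csize (sphere G n x) w x)%:R).
  move=> nN; have [le14|/ltW gt14] := leP (bern p (1 - p) (edges_at G (ball G n.+1 x))
    (fun w => (csize (sphere G n x) w x)%:R)) (1 / 4); first by case: noN; exists n.
  apply: (le_trans gt14); apply: bern_sub; rewrite ?edges_at_uniq //.
    move=> e /edges_at_touch[y yn ye]; apply: mem_edges_at ye => //.
    elim: N nN {NM noN} => // N' IHN; rewrite ltnS leq_eqVlt => /orP[/eqP <- //|/IHN].
    by move/fsubsetP: (sub_ballS G N' x); exact.
  by move=> w w' ww'; rewrite ler_nat; exact: csize_mono.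
have := chiM (edges_at G (ball G N x)) (ball G N x) x (edges_at_uniq _ _) (fset_uniq _).
apply/negP; rewrite -ltNge; apply: (@lt_le_trans _ _ (\sum_(n < N) (1 / 4))).
  by rewrite sumr_const card_ord -mulr_natl; lra.
apply: (le_trans (ler_sum _ (fun (n : 'I_N) _ => big n (ltn_ord n)))).
rewrite -bern_sum; apply: bern_le => // w _.
by rewrite -natr_sum ler_nat sum_csize_sphere.
Qed.

(** Finite-size criterion. The expected number of exits from a ball involves at most [D * b] edges,
    hence is Lipschitz in the parameter: at most 1/4 at [p], it stays at most 1/2 within [delta],
    and the exploration applies. The radius may vary with the centre, but it is bounded by [N],
    which makes [delta] uniform. *)
Lemma subcritical_neighborhood (p M : R) : 0 <= p <= 1 -> chi_bound (G := G) p M ->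
  exists2 delta : R, 0 < delta & exists theta C : R, 1 < theta /\
    forall p', 0 <= p' <= 1 -> `|p' - p| <= delta ->
    forall (l : seq (edge G)) U x, uniq l -> uniq U ->
      bern p' (1 - p') l (fun w => theta ^+ csize U w x) <= C.
Proof.
move=> p01 /(sphere_expectation p01)[N hN].
have /choice[n nP] x : exists n, (n < N)%N /\
    bern p (1 - p) (edges_at G (ball G n.+1 x)) (fun w => (csize (sphere G n x) w x)%:R)
      <= 1 / 4.
  by have [n nN h] := hN x; exists n.
pose b := (D.+1 ^ N)%N; pose delta : R := (4 * (D * b * b).+1%:R)^-1.
have [s [theta [s0 theta1 theta_s contract]]] := exploration_constants R b.
exists delta; first by rewrite invr_gt0 mulr_gt0.
exists theta, (1 + s); split => // p' p'01 pp' l U x ul uU.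
pose S x := ball G (n x).+1 x; pose Bd x := sphere G (n x) x.
have nN y : (n y < N)%N by case: (nP y).
have Sb y : (#|` S y| <= b)%N.
  by rewrite (leq_trans (size_ball deg _ _)) // leq_pexp2l.
have Bdb y : (size (Bd y) <= b)%N.
  by rewrite (leq_trans _ (Sb y)) // size_filter count_size.
apply: (@exponential_moment _ _ _ p' p'01 S Bd b) => //.
- by move=> y; exact: ball_center.
- by move=> y; rewrite mem_filter ball_center.
- move=> u y z yS yz zS; rewrite mem_filter -[_ \in enum_fset _]/(y \in S u) yS andbT.
  by apply: contra zS => yB; exact: ballS yB yz.
- move=> y k uk; have [p0 q0] : 0 <= p' /\ 0 <= 1 - p' by case/andP: p'01; rewrite subr_ge0.
  pose m := seq.filter (fun e : edge G => (val e `<=` S y)%fset) k.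
  have iexits : increasing (fun w : edge G -> bool => (exits S Bd y w)%:R : R).
    move=> w w' ww'; rewrite ler_nat; apply: csize_mono => e.
    by rewrite /inside => /andP[-> /ww' ->].
  apply: (@le_trans _ _ (bern p' (1 - p') m (fun w => (exits S Bd y w)%:R))).
    rewrite (@bern_filter _ _ p' _ k (fun e : edge G => (val e `<=` S y)%fset)) //.
      by rewrite addrC subrK.
    move=> w; congr (_%:R); rewrite /exits; congr csize; apply/funext => e.
    by rewrite /inside andbA andbb.
  apply: (@le_trans _ _ (bern p' (1 - p') (edges_at G (S y)) (fun w => (exits S Bd y w)%:R))).
    apply: bern_sub; rewrite ?filter_uniq ?edges_at_uniq // => e.
    rewrite mem_filter => /andP[/fsubsetP eS _].
    have [u [v [_ euv]]] := edgeP e.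
    by apply: (@mem_edges_at _ _ fin _ _ u); [apply: eS|]; rewrite euv !inE eqxx.
  apply: (@le_trans _ _ (bern p' (1 - p') (edges_at G (S y))
      (fun w => (csize (Bd y) w y)%:R))).
    apply: bern_le => // w _; rewrite ler_nat; apply: csize_mono => e.
    by rewrite /inside => /andP[].
  have h0 (w : edge G -> bool) : 0 <= ((csize (Bd y) w y)%:R : R) <= b%:R.
    by rewrite ler0n ler_nat (leq_trans (csize_le _ _ _)).
  have /ler_normlP[_ lip] := bern_lipschitz p01 (edges_at G (S y)) p'01 h0.
  have [_ q14] := nP y.
  have hs : (size (edges_at G (S y)))%:R * b%:R * `|p' - p| <= 1 / 4.
    apply: (@le_trans _ _ ((D * b * b).+1%:R * delta)); last first.
      by rewrite /delta invfM mulrCA divff // mulr1 div1r.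
    apply: ler_pM => //; rewrite -natrM ler_nat (leq_trans _ (leqnSn _)) // leq_mul //.
    by rewrite (leq_trans (size_edges_at deg _)) // leq_mul.
  by move: lip hs q14; rewrite -/(S y) -/(Bd y); lra.
- exact: ltW.
Qed.

Lemma chi_of_exponential (p theta C : R) : 0 <= p <= 1 -> 1 < theta ->
  (forall (l : seq (edge G)) U x, uniq l -> uniq U ->
    bern p (1 - p) l (fun w => theta ^+ csize U w x) <= C) ->
  chi_bound (G := G) p (C / (theta - 1)).
Proof.
move=> /andP[p0 p1] theta1 expC l U x ul uU.
rewrite ler_pdivlMr ?subr_gt0 // mulrC -bernZ; apply: le_trans (expC l U x ul uU).
apply: bern_le; rewrite ?subr_ge0 // => w _.
elim: (csize U w x) => [|k IHk]; first by rewrite mulr0 expr0.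
have t1 : 1 <= theta ^+ k by rewrite exprn_ege1 // ltW.
rewrite -natr1 exprS; nra.
Qed.

End subcritical.

(** * The random walk and its capacity *)

Lemma fin_addl_eq0 (R : realDomainType) (r : R) (x : \bar R) :
  r%:E = (r%:E + x)%E -> x = 0%E.
Proof.
by case: x => // x [] /esym/eqP; rewrite -{2}[r]addr0 (inj_eq (addrI _)) => /eqP ->.
Qed.

Section random_walk_operator.
Context {R : realType} {V : choiceType} (G : sgraph V).
Implicit Types (f g : V -> R) (A B : set V) (x y : V).

(** The transition operator of the walk. *)
Definition Pop f x : R := (degree G x)%:R^-1 * \sum_(y <- nbs G x) f y.

(** The probability, from [x], of no visit to [A] at times [1, ..., N]. As for [T_A], time 0 does
    not count. *)
Fixpoint avoid A (N : nat) x : R :=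
  if N is N'.+1 then Pop (fun y => if y \in A then 0 else avoid A N' y) x else 1.

Definition esc A x : R := limn (fun N => avoid A N x).

Lemma Pop_le f g x : (forall y, f y <= g y) -> Pop f x <= Pop g x.
Proof. by move=> fg; rewrite /Pop ler_wpM2l ?invr_ge0 // ler_sum. Qed.

Lemma eq_Pop f g x : f =1 g -> Pop f x = Pop g x.
Proof. by move=> fg; rewrite /Pop; congr (_ * _); apply: eq_bigr => y _. Qed.

Lemma Pop_ge0 f x : (forall y, 0 <= f y) -> 0 <= Pop f x.
Proof. by move=> f0; rewrite mulr_ge0 ?invr_ge0 // sumr_ge0. Qed.

Lemma PopD f g x : Pop (fun y => f y + g y) x = Pop f x + Pop g x.
Proof. by rewrite /Pop big_split mulrDr. Qed.

Lemma PopZ c f x : Pop (fun y => c * f y) x = c * Pop f x.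
Proof. by rewrite /Pop -mulr_sumr mulrCA. Qed.

Lemma PopN f x : Pop (fun y => - f y) x = - Pop f x.
Proof. by rewrite /Pop sumrN mulrN. Qed.

Lemma Pop_sum (I : Type) (r : seq I) (F : I -> V -> R) x :
  Pop (fun y => \sum_(i <- r) F i y) x = \sum_(i <- r) Pop (F i) x.
Proof. by rewrite /Pop exchange_big /= mulr_sumr. Qed.

Hypotheses (infV : infinite_set [set: V]) (cG : connected_graph G)
  (bG : bounded_degree G).

Let dpos x : (0 < degree G x)%N. Proof. exact: degree_gt0. Qed.

Let fin x : finite_set (nbhd G x). Proof. exact: nbhd_finite. Qed.

Lemma Pop_cst c x : Pop (fun=> c) x = c.
Proof.
rewrite /Pop big_const_seq count_predT iter_addr_0 -[c *+ _]mulr_natl.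
by rewrite mulrA -[size _]/(degree G x) mulVf ?mul1r // pnatr_eq0 -lt0n.
Qed.

Lemma avoid_ge0 A N x : 0 <= avoid A N x.
Proof. by elim: N x => //= N IHN x; apply: Pop_ge0 => y; case: ifP. Qed.

Lemma avoid_le1 A N x : avoid A N x <= 1.
Proof.
elim: N x => //= N IHN x; rewrite -[leRHS](Pop_cst 1 x).
by apply: Pop_le => y; case: ifP.
Qed.

Lemma avoidS_le A N x : avoid A N.+1 x <= avoid A N x.
Proof.
elim: N x => [|N IHN] x; first exact: avoid_le1.
by apply: Pop_le => y; case: ifP => // _; exact: IHN.
Qed.

Lemma cvg_avoid A x : avoid A N x @[N --> \oo] --> esc A x.
Proof.
apply: nonincreasing_is_cvgn.
  by apply/nonincreasing_seqP => N; exact: avoidS_le.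
by exists 0 => _ [N _ <-]; exact: avoid_ge0.
Qed.

Lemma esc_ge0 A x : 0 <= esc A x.
Proof.
apply: limr_ge; first exact: cvg_avoid.
by apply: nearW => N; exact: avoid_ge0.
Qed.

Lemma esc_le1 A x : esc A x <= 1.
Proof.
apply: limr_le; first exact: cvg_avoid.
by apply: nearW => N; exact: avoid_le1.
Qed.

Section walk_law.
Variable o : V.
Local Notation mu := (walk G o : probability (trajectories o) R).

Let weight n (s : nat -> V) : R :=
  (s 0%N == o)%:R * \prod_(i < n) transition G (s i) (s i.+1).

Lemma measurable_coordinate i B :
  measurable ([set S | B (S i)] : set (trajectories o)).
Proof. by apply: sub_sigma_algebra; exists i, B. Qed.

Lemma measurable_coordinates (B : nat -> set V) :
  measurable ([set S | forall i, B i (S i)] : set (trajectories o)).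
Proof.
rewrite (_ : [set _ | _] = \bigcap_i [set S : trajectories o | B i (S i)]).
  by apply: bigcapT_measurable => i; exact: measurable_coordinate.
by apply/seteqP; split => S /= h i; [move=> _|apply: h].
Qed.

Let path_event n (s : nat -> V) N A : set (trajectories o) :=
  [set S | forall i, ((i <= n)%N -> S i = s i) /\
                     ((n < i <= n + N)%N -> ~ A (S i))].

Let mpath n s N A : measurable (path_event n s N A).
Proof.
exact: (@measurable_coordinates (fun i => [set v | ((i <= n)%N -> v = s i) /\
                     ((n < i <= n + N)%N -> ~ A v)])).
Qed.

(** The state space is infinite: finitely many values are split off and all the others stay lumped
    together. *)
Lemma split_coordinate (E : set (trajectories o)) i (r : seq V) : measurable E -> uniq r ->
  mu E = (\sum_(y <- r) mu (E `&` [set S | S i = y]) +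
          mu (E `&` [set S | S i \notin r]))%E.
Proof.
move=> mE; elim: r => [|y r IHr] /=.
  by rewrite big_nil add0e [X in E `&` X](_ : _ = setT) ?setIT //; apply/seteqP.
move=> /andP[yr ur]; rewrite big_cons (IHr ur) -addeA addeCA; congr (_ + _)%E.
rewrite -measureU; first last.
- rewrite -subset0 => S [[_ /= ->] [_ /=]]; rewrite inE eqxx //.
- by apply: measurableI => //; exact: (@measurable_coordinate i [set v | v \notin y :: r]).
- by apply: measurableI => //; exact: (@measurable_coordinate i [set v | v = y]).
congr (mu _); rewrite -setIUr; congr (_ `&` _).
apply/seteqP; split => S /=.
  by move=> Sr; case: (eqVneq (S i) y) => [|Sy]; [left|right; rewrite inE negb_or Sy].
by case=> [->//|]; rewrite inE negb_or => /andP[].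
Qed.

Lemma weight_snoc n s y :
  weight n.+1 (fun i => if (i <= n)%N then s i else y) = weight n s * transition G (s n) y.
Proof.
rewrite /weight big_ord_recr /= leqnn ltnn mulrA; congr (_ * _ * _).
by apply: eq_bigr => i _; rewrite ltnW ltn_ord.
Qed.

Lemma path_event_snoc n s N A y :
  path_event n s N.+1 A `&` [set S | S n.+1 = y] =
  if y \in A then set0 else path_event n.+1 (fun i => if (i <= n)%N then s i else y) N A.
Proof.
apply/seteqP; split => S.
  case=> [SE /= Sy]; case: ifPn => yA.
    have [_] := SE n.+1; rewrite Sy ltnSn addnS ltnS leq_addr => /(_ isT); apply.
    exact: set_mem yA.
  move=> i; split.
    rewrite leq_eqVlt ltnS => /orP[/eqP->|ni]; first by rewrite ltnn.
    by rewrite ni; case: (SE i) => ->.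
  by move=> /andP[ni iM]; case: (SE i) => _; apply; rewrite (ltnW ni) addnS -addSn.
case: ifPn => yA // SE.
have Sy : S n.+1 = y by have [+ _] := SE n.+1; rewrite ltnn; apply.
split => // i; split.
  by move=> ni; have [+ _] := SE i; rewrite ni; apply; exact: leqW.
move=> /andP[]; rewrite leq_eqVlt addnS -addSn => /orP[/eqP <- _|ni iM].
  by rewrite Sy => yA'; rewrite mem_set in yA.
by have [_] := SE i; apply; rewrite ni.
Qed.

Lemma path_event_snoc0 n s A y :
  path_event n s 0 A `&` [set S | S n.+1 = y] =
  path_event n.+1 (fun i => if (i <= n)%N then s i else y) 0 A.
Proof.
apply/seteqP; split => S.
  case=> [SE /= Sy] i; split.
    rewrite leq_eqVlt ltnS => /orP[/eqP->|ni]; first by rewrite ltnn.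
    by rewrite ni; case: (SE i) => ->.
  by rewrite addn0 => /andP[/leq_trans h1 /h1]; rewrite ltnn.
move=> SE; split; last by have [+ _] := SE n.+1; rewrite /= ltnn; apply.
move=> i; split.
  by move=> ni; have [+ _] := SE i; rewrite ni; apply; exact: leqW.
by rewrite addn0 => /andP[/leq_trans h1 /h1]; rewrite ltnn.
Qed.

Lemma transition_nbs x y : y \in nbs G x -> transition G x y = (degree G x)%:R^-1 :> R.
Proof. by rewrite in_nbs // /transition => ->. Qed.

(** The Markov property, read off from the law of finite paths: the next step is absorbed into the
    prescribed path, and the induction on [N] is over all prescribed paths. *)
Lemma walk_path_event n s N A : mu (path_event n s N A) = (weight n s * avoid A N (s n))%:E.
Proof.
have law n' s' : mu (path_event n' s' 0 A) = (weight n' s')%:E.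
  rewrite -(walkP R o infV cG bG n' s'); congr (mu _); apply/seteqP; split => S /=.
    by move=> h i; case: (h i).
  by move=> h i; split; [exact: h|rewrite addn0 => /andP[/leq_trans h1 /h1]; rewrite ltnn].
elim: N n s => [|N IHN] n s; first by rewrite mulr1 law.
have ur := fset_uniq (nbs G (s n)).
(* The transitions to the neighbours already carry the whole mass, so the next position is almost
   surely a neighbour. *)
have rest0 : mu (path_event n s 0 A `&` [set S | S n.+1 \notin enum_fset (nbs G (s n))]) = 0%E.
  have := split_coordinate n.+1 (mpath n s 0 A) ur.
  rewrite law (eq_big_seq (fun=> (weight n s * (degree G (s n))%:R^-1)%:E)); last first.
    by move=> y yn; rewrite path_event_snoc0 law weight_snoc transition_nbs.
  rewrite sumEFin -mulr_sumr big_const_seq count_predT iter_addr_0.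
  rewrite -[_^-1 *+ _]mulr_natl -[size _]/(degree G (s n)) divff ?mulr1; last first.
    by rewrite pnatr_eq0 -lt0n.
  exact: fin_addl_eq0.
rewrite (split_coordinate n.+1 (mpath n s N.+1 A) ur).
rewrite [X in (_ + X)%E](_ : _ = 0%E) ?adde0; last first.
  apply: (subset_measure0 _ _ _ rest0).
  - by apply: measurableI => //; exact: (@measurable_coordinate n.+1 [set v | v \notin enum_fset (nbs G (s n))]).
  - by apply: measurableI => //; exact: (@measurable_coordinate n.+1 [set v | v \notin enum_fset (nbs G (s n))]).
  - move=> S [SE ?]; split => // i; split; first by case: (SE i).
    by rewrite addn0 => /andP[/leq_trans h1 /h1]; rewrite ltnn.
rewrite (eq_big_seq (fun y => (weight n s * ((degree G (s n))%:R^-1 *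
   (if y \in A then 0 else avoid A N y)))%:E)); last first.
  move=> y yn; rewrite path_event_snoc; case: ifP => _; first by rewrite measure0 !mulr0.
  by rewrite IHN weight_snoc transition_nbs // ltnn mulrA.
by rewrite sumEFin -!mulr_sumr.
Qed.

Lemma hitting_time_infty A (S : nat -> V) :
  hitting_time A S = +oo%E :> \bar R <-> forall i, (0 < i)%N -> ~ A (S i).
Proof.
split => [/ereal_inf_pinfty h i i0 Ai|h].
  by have /h : [set n%:R%:E | n in [set n | (1 <= n)%N /\ A (S n)]] (i%:R%:E : \bar R);
    [exists i|].
by apply/ereal_inf_pinfty => _ [i [i0 Ai] <-]; case: (h i i0).
Qed.

Lemma escape_probabilityE A : escape_probability G A o = (esc A o)%:E.
Proof.
pose E N := path_event 0 (fun=> o) N A.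
have EE N : mu (E N) = (avoid A N o)%:E.
  by rewrite walk_path_event /weight big_ord0 eqxx !mul1r.
have mE N : measurable (E N) by exact: mpath.
have -> : escape_probability G A o = mu (\bigcap_N E N).
  have mT : measurable ([set S | hitting_time A S = +oo%E :> \bar R] : set (trajectories o)).
    rewrite (_ : [set _ | _] = [set S | forall i, [set v | (0 < i)%N -> ~ A v] (S i)]).
      exact: (@measurable_coordinates (fun i => [set v | (0 < i)%N -> ~ A v])).
    by apply/seteqP; split => S /hitting_time_infty.
  (* Trajectories are arbitrary maps; those that do not start at [o] have to be discarded as a null
     set. *)
  rewrite /escape_probability (split_coordinate 0 mT (r := [:: o])) // big_seq1.
  rewrite [X in (_ + X)%E](_ : _ = 0%E) ?adde0; last first.
    have := split_coordinate 0 measurableT (r := [:: o]) isT.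
    rewrite big_seq1 !setTI => h.
    have o1 : mu [set S | S 0%N = o] = 1%E.
      have <- : mu (E 0%N) = 1%E by rewrite EE.
      congr (mu _); apply/seteqP; split => S /=.
        by move=> So i; split; [rewrite leqn0 => /eqP ->|case: i].
      by move=> /(_ 0%N)[+ _]; apply.
    have mo : measurable ([set S | S 0%N \notin [:: o]] : set (trajectories o)).
      exact: (@measurable_coordinate 0%N [set v | v \notin [:: o]]).
    have o0 : mu [set S | S 0%N \notin [:: o]] = 0%E.
      by move: h; rewrite o1 probability_setT; exact: fin_addl_eq0.
    apply: (subset_measure0 _ _ _ o0) => //; exact: measurableI.
  suff -> : [set S : trajectories o | hitting_time A S = +oo%E :> \bar R] `&`
      [set S | S 0%N = o] = \bigcap_N E N by [].
  apply/seteqP; split => S.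
    case=> /hitting_time_infty h /= So N _ i; split; first by rewrite leqn0 => /eqP ->.
    by rewrite add0n => /andP[i0 _]; exact: h.
  move=> h; split; last by have [+ _] := h 0%N I 0%N; apply.
  by apply/hitting_time_infty => i i0; have [_] := h i I i; apply; rewrite i0 add0n /=.
have h1 : mu \o E @ \oo --> mu (\bigcap_N E N).
  apply: nonincreasing_cvg_mu => //.
  - by rewrite [X in (X < _)%E](EE 0%N) ltry.
  - exact: bigcapT_measurable.
  - move=> n m nm; apply/subsetPset => S SE i; have [h1 h2] := SE i; split => //.
    by move=> /andP[i0 im]; apply: h2; rewrite i0 (leq_trans im) // leq_add2l.
have h2 : mu \o E @ \oo --> (esc A o)%:E.
  apply: cvg_EFin; first by apply: nearW => N /=; rewrite EE.
  have -> : fine \o (mu \o E) = (fun N => avoid A N o).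
    by apply/funext => N; rewrite /= [X in fine X](EE N).
  exact: cvg_avoid.
exact: (cvg_unique (F := mu \o E @ \oo) _ h1 h2).
Qed.

End walk_law.
End random_walk_operator.

Lemma cvg_sum_seq (R : realType) (I : Type) (r : seq I) (F : nat -> I -> R) (f : I -> R) :
  (forall i, F N i @[N --> \oo] --> f i) ->
  \sum_(i <- r) F N i @[N --> \oo] --> \sum_(i <- r) f i.
Proof.
move=> Ff; elim: r => [|i r IHr].
  by rewrite big_nil; under eq_fun do rewrite big_nil; exact: cvg_cst.
by rewrite big_cons; under eq_fun do rewrite big_cons; exact: cvgD.
Qed.

Section automorphisms.
Context {R : realType} {V : choiceType} (G : sgraph V).
Hypothesis fin : forall x, finite_set (nbhd G x).
Variable phi : V -> V.
Hypothesis aut : graph_automorphism G phi.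

Lemma aut_inj : injective phi.
Proof. by case: aut => /bij_inj. Qed.

Lemma nbs_aut x : perm_eq (nbs G (phi x)) (map phi (nbs G x)).
Proof.
case: aut => -[psi phiK psiK] adjphi; apply: uniq_perm; first exact: fset_uniq.
  by rewrite map_inj_uniq ?fset_uniq //; exact: aut_inj.
move=> y; rewrite -[y in RHS]psiK (mem_map aut_inj).
rewrite -[LHS]/(y \in nbs G (phi x)) -[RHS]/(psi y \in nbs G x) !in_nbs //.
by rewrite -[RHS]adjphi psiK.
Qed.

Lemma degree_aut x : degree G (phi x) = degree G x.
Proof. by have /perm_size := nbs_aut x; rewrite size_map. Qed.

Lemma Pop_aut (f : V -> R) x : Pop G f (phi x) = Pop G (fun y => f (phi y)) x.
Proof. by rewrite /Pop degree_aut (perm_big _ (nbs_aut x)) /= big_map. Qed.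

Lemma esc_aut (A B : set V) x : (forall y, (phi y \in B) = (y \in A)) ->
  esc G B (phi x) = esc G A x :> R.
Proof.
move=> AB; rewrite /esc; congr (limn _); apply/funext => N.
elim: N x => //= N IHN x; rewrite Pop_aut; apply: eq_Pop => y.
by rewrite AB IHN.
Qed.

End automorphisms.

(** * Hitting probabilities, reversibility and capacity *)

Section potential_theory.
Context {R : realType} {V : choiceType} (G : sgraph V).
Implicit Types (f g : V -> R) (A B : {fset V}) (x y z : V).
Hypotheses (infV : infinite_set [set: V]) (cG : connected_graph G)
  (bG : bounded_degree G).

Let fin x : finite_set (nbhd G x). Proof. exact: nbhd_finite. Qed.

(** The [n]-step transition probability. *)
Definition kern n x y : R := iter n (Pop G) (fun z => (z == y)%:R) x.

Arguments kern : simpl never.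

(** The probability of a visit to [A] at some time [n >= 0]; unlike in [esc], time 0 counts. *)
Definition hit A x : R := 1 - (if x \in A then 0 else esc G [set` A] x).

Definition cap A : R := \sum_(x <- A) esc G [set` A] x.

Lemma kern_ge0 n x y : 0 <= kern n x y.
Proof. by elim: n x => [|n IHn] x; rewrite ?ler0n //; exact: Pop_ge0. Qed.

Lemma iter_Pop_le n f g x : (forall y, f y <= g y) ->
  iter n (Pop G) f x <= iter n (Pop G) g x.
Proof. by move=> fg; elim: n x => [|n IHn] x //=; exact: Pop_le. Qed.

Lemma iter_Pop_ge0 n f x : (forall y, 0 <= f y) -> 0 <= iter n (Pop G) f x.
Proof. by move=> f0; elim: n x => [|n IHn] x //=; exact: Pop_ge0. Qed.

Lemma iter_Pop_sum (I : Type) (r : seq I) (F : I -> V -> R) n x :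
  iter n (Pop G) (fun y => \sum_(i <- r) F i y) x = \sum_(i <- r) iter n (Pop G) (F i) x.
Proof. by elim: n x => [|n IHn] x //=; rewrite -Pop_sum; exact: eq_Pop. Qed.

Lemma iter_PopZ n c f x : iter n (Pop G) (fun y => c * f y) x = c * iter n (Pop G) f x.
Proof. by elim: n x => [|n IHn] x //=; rewrite -PopZ; exact: eq_Pop. Qed.

Lemma iter_PopD n f g x :
  iter n (Pop G) (fun y => f y + g y) x = iter n (Pop G) f x + iter n (Pop G) g x.
Proof. by elim: n x => [|n IHn] x //=; rewrite -PopD; exact: eq_Pop. Qed.

Lemma cvg_iter_Pop n (F : nat -> V -> R) f :
  (forall x, F M x @[M --> \oo] --> f x) ->
  forall x, iter n (Pop G) (F M) x @[M --> \oo] --> iter n (Pop G) f x.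
Proof.
move=> Ff; elim: n => [|n IHn] x //=; rewrite /Pop.
by apply: cvgMr; apply: cvg_sum_seq => y; exact: IHn.
Qed.

Lemma esc_Pop (A : set V) x :
  esc G A x = Pop G (fun y => if y \in A then 0 else esc G A y) x :> R.
Proof.
have h1 : avoid G A N.+1 x @[N --> \oo] --> (esc G A x : R).
  by rewrite (cvg_shiftS (fun N => avoid G A N x : R)); exact: cvg_avoid.
have h2 : avoid G A N.+1 x @[N --> \oo] -->
    Pop G (fun y => if y \in A then 0 else esc G A y : R) x.
  apply: (@cvg_iter_Pop 1 (fun N y => if y \in A then 0 else avoid G A N y)) => y.
  by case: ifP => _; [exact: cvg_cst|exact: cvg_avoid].
exact: (cvg_unique _ h1 h2).
Qed.

Lemma mem_fset_set A x : (x \in [set` A]) = (x \in A).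
Proof. by apply/idP/idP; rewrite inE. Qed.

Lemma hit_ge0 A x : 0 <= hit A x.
Proof. by rewrite /hit subr_ge0; case: ifP => // _; exact: esc_le1. Qed.

Lemma hit_le1 A x : hit A x <= 1.
Proof. by rewrite /hit lerBlDr lerDl; case: ifP => // _; exact: esc_ge0. Qed.

Lemma hit_in A x : x \in A -> hit A x = 1.
Proof. by rewrite /hit => ->; rewrite subr0. Qed.

Lemma Pop_hit A x : Pop G (hit A) x = 1 - esc G [set` A] x.
Proof.
rewrite /hit PopD PopN Pop_cst // esc_Pop.
by congr (_ - _); apply: eq_Pop => y; rewrite mem_fset_set.
Qed.

(* The hitting probability of [A] is the potential of the charge [esc] on [A]. *)
Lemma hit_potential A x :
  hit A x = Pop G (hit A) x + \sum_(y <- A) esc G [set` A] y * (x == y)%:R.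
Proof.
rewrite Pop_hit; case: (boolP (x \in A)) => xA.
  rewrite hit_in // (bigD1_seq x) ?fset_uniq //= eqxx mulr1 big1 ?addr0 ?subrK //.
  by move=> y /negbTE; rewrite eq_sym => ->; rewrite mulr0.
rewrite /hit (negbTE xA) big_seq big1 ?addr0 // => y yA.
by case: eqVneq => [xy|]; rewrite ?mulr0 // xy -[_ \in _]/(y \in A) yA in xA *.
Qed.

(** [hit_potential] telescoped. The left side is the probability that the last visit to [A] occurs
    before time [N]; the subtracted term is that of a visit at time [N] or later. *)
Lemma last_exit A N x :
  \sum_(n < N) \sum_(y <- A) esc G [set` A] y * kern n x y = hit A x - iter N (Pop G) (hit A) x.
Proof.
elim: N => [|N IHN]; first by rewrite big_ord0 subrr.
rewrite big_ord_recr /= IHN.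
have -> : iter N (Pop G) (hit A) x = Pop G (iter N (Pop G) (hit A)) x +
    \sum_(y <- A) esc G [set` A] y * kern N x y.
  transitivity (iter N (Pop G) (fun z => Pop G (hit A) z +
      \sum_(y <- A) esc G [set` A] y * (z == y)%:R) x).
    by congr (iter _ _ _ _); apply/funext => z; exact: hit_potential.
  rewrite iter_PopD -iterSr iter_Pop_sum; congr (_ + _).
  by apply: eq_bigr => y _; rewrite iter_PopZ.
by ring.
Qed.

(** Along the walk, the expected value of [f] drops by at least [g0] for each visit to [A]; the
    drops are telescoped. *)
Lemma superharmonic_visits A f (g0 : R) :
  (forall x, Pop G f x + g0 * (x \in A)%:R <= f x) -> forall N x,
  g0 * \sum_(n < N) \sum_(y <- A) kern n x y <= f x - iter N (Pop G) f x.
Proof.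
move=> Pf N x; elim: N x => [|N IHN] x; first by rewrite big_ord0 mulr0 subrr.
rewrite big_ord_recr /= mulrDr.
have : iter N (Pop G) (fun z => Pop G f z + g0 * (z \in A)%:R) x <= iter N (Pop G) f x.
  exact: iter_Pop_le.
rewrite iter_PopD iter_PopZ -iterSr.
have -> : iter N (Pop G) (fun z => (z \in A)%:R) x = \sum_(y <- A) kern N x y.
  rewrite -iter_Pop_sum; congr (iter _ _ _ _); apply/funext => z.
  case: (boolP (z \in A)) => zA.
    rewrite (bigD1_seq z) ?fset_uniq //= eqxx big1 ?addr0 // => y.
    by rewrite eq_sym => /negbTE ->.
  rewrite big_seq big1 // => y yA; case: eqVneq => // zy.
  by rewrite zy -[_ \in _]/(y \in enum_fset A) yA in zA.
have := IHN x; rewrite /=; lra.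
Qed.

Section regular.
Variable d : nat.
Hypothesis reg : forall x, degree G x = d.

(** The decomposition at the last step instead of the first. On a regular graph the transition
    operator is symmetric for the counting measure, so both take the same form. *)
Lemma kern_right n x y : kern n.+1 x y = Pop G (fun z => kern n x z) y.
Proof.
elim: n x => [|n IHn] x.
  rewrite /kern /= /Pop !reg; congr (_ * _).
  have sumE (a b : V) : \sum_(z <- nbs G a) (z == b)%:R = (adj G a b)%:R :> R.
    rewrite -(in_nbs fin); case: (boolP (b \in nbs G a)) => ab.
      rewrite (bigD1_seq b) ?fset_uniq //= eqxx big1 ?addr0 // => z /negbTE -> //.
    rewrite big_seq big1 // => z za; case: eqVneq => // zb.
    by move: ab; rewrite -zb -[_ \in _]/(z \in enum_fset (nbs G a)) za.
  rewrite sumE adj_sym -sumE; apply: eq_bigr => z _.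
  by rewrite eq_sym.
transitivity (Pop G (fun z => kern n.+1 z y) x); first by [].
under eq_Pop do rewrite IHn.
transitivity (Pop G (fun z => d%:R^-1 * \sum_(v <- nbs G y) kern n z v) x).
  by apply: eq_Pop => z; rewrite /Pop reg.
by rewrite PopZ Pop_sum [RHS]/Pop reg.
Qed.

Lemma kern_sym n x y : kern n x y = kern n y x.
Proof.
elim: n x y => [|n IHn] x y; first by rewrite /kern /= eq_sym.
rewrite kern_right; transitivity (Pop G (fun z => kern n z x) y) => //.
by apply: eq_Pop => z; rewrite IHn.
Qed.

Hypothesis green : forall x y, exists M, forall N, \sum_(n < N) kern n x y <= M.

(** The union bound over the times of a visit, in the form of an induction on [M]. *)
Lemma hit_le_visits A M x :
  1 - (if x \in A then 0 else avoid G [set` A] M x) <=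
  \sum_(n < M.+1) \sum_(y <- A) kern n x y.
Proof.
have start z N : z \in A -> 1 <= \sum_(n < N.+1) \sum_(y <- A) kern n z y.
  move=> zA; rewrite big_ord_recl (bigD1_seq z) ?fset_uniq //= -addrA.
  rewrite [X in X + _](_ : _ = 1) ?lerDl; last by rewrite /kern /= eqxx.
  apply: addr_ge0; apply: sumr_ge0 => i _; first exact: kern_ge0.
  by apply: sumr_ge0 => y _; exact: kern_ge0.
elim: M x => [|M IHM] x.
  case: ifP => xA; first by rewrite subr0 start.
  by rewrite subrr !sumr_ge0 // => i _; rewrite sumr_ge0 // => y _; exact: kern_ge0.
case: ifP => xA; first by rewrite subr0 start.
rewrite big_ord_recl -[leLHS]add0r lerD //.
  by rewrite sumr_ge0 // => y _; exact: kern_ge0.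
pose v y : R := if y \in A then 0 else avoid G [set` A] M y.
have -> : 1 - avoid G [set` A] M.+1 x = Pop G (fun y => 1 - v y) x.
  rewrite PopD PopN Pop_cst //=; congr (_ - _).
  by apply: eq_Pop => y; rewrite mem_fset_set.
apply: (le_trans (Pop_le _ _ IHM)); rewrite Pop_sum ler_sum // => i _.
by rewrite Pop_sum.
Qed.

Lemma visits_tail A x (e : R) : 0 < e -> exists N0, forall N M, (N0 <= N)%N ->
  \sum_(n < M) \sum_(y <- A) kern (N + n) x y <= e.
Proof.
move=> e0; pose v n := \sum_(y <- A) kern n x y.
have v0 n : 0 <= v n by rewrite sumr_ge0 // => y _; exact: kern_ge0.
have /choice[b bP] y := green x y.
have vb N : \sum_(n < N) v n <= \sum_(y <- A) b y.
  by rewrite /v exchange_big /=; apply: ler_sum => y _; exact: bP.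
have : cvgn (series v).
  apply: nondecreasing_is_cvgn; first exact: nondecreasing_series.
  by exists (\sum_(y <- A) b y) => _ [N _ <-]; rewrite /series /= big_mkord.
move=> /cauchy_cvgP/cauchy_seriesP/(_ _ e0) [[P1 P2] [[N1 _ hN1] [N2 _ hN2]] hP].
exists (maxn N1 N2) => N M; rewrite geq_max => /andP[N1N N2N].
have /= := hP (N, N + M)%N; rewrite /= => /(_ _)/ltW h.
rewrite (le_trans _ (h _)) //; last first.
  by split; [exact: hN1|apply: hN2; rewrite /= (leq_trans N2N) // leq_addr].
rewrite (le_trans _ (ler_norm _)) // -{2}[N]add0n big_addn addKn big_mkord.
by apply: ler_sum => n _; rewrite addnC.
Qed.

(** This is the probability of a visit at time [N] or later, at most a tail of the convergent Green
    series. Its vanishing makes [last_exit] exact in the limit. *)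
Lemma cvg_iter_hit A x : iter N (Pop G) (hit A) x @[N --> \oo] --> (0 : R).
Proof.
apply/cvgr0Pnorm_le => e e0; have [N0 hN0] := visits_tail A x e0.
exists N0 => // N /= N0N.
rewrite ger0_norm; last first.
  by apply: iter_Pop_ge0 => z; exact: hit_ge0.
pose F M y : R := 1 - (if y \in A then 0 else avoid G [set` A] M y).
have FN : iter N (Pop G) (F M) x @[M --> \oo] --> iter N (Pop G) (hit A) x.
  apply: cvg_iter_Pop => y; rewrite /F /hit; apply: cvgB; first exact: cvg_cst.
  by case: ifP => _; [exact: cvg_cst|exact: cvg_avoid].
rewrite -(cvg_lim _ FN) //; apply: limr_le; first exact: cvgP FN.
apply: nearW => M; apply: le_trans (hN0 N M.+1 N0N).
apply: (le_trans (iter_Pop_le N x (hit_le_visits A M))).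
rewrite iter_Pop_sum; apply: ler_sum => n _; rewrite iter_Pop_sum; apply: ler_sum => y _.
by rewrite /kern -iterD.
Qed.

(* Reversibility turns the last-exit decomposition, summed over the points of
   [A], into the number of visits to [A], which is dominated by [f / g0]. *)
Lemma cap_lower_bound A f (g0 C : R) : 0 <= g0 -> (forall x, 0 <= f x) ->
  (forall x, Pop G f x + g0 * (x \in A)%:R <= f x) -> (forall x, x \in A -> f x <= C) ->
  g0 * (#|` A|)%:R <= C * cap A.
Proof.
move=> g00 f0 Pf fC.
have visits := superharmonic_visits Pf.
have key N : g0 * \sum_(z <- A) (1 - iter N (Pop G) (hit A) z) <= C * cap A.
  have -> : \sum_(z <- A) (1 - iter N (Pop G) (hit A) z) =
      \sum_(y <- A) esc G [set` A] y * \sum_(n < N) \sum_(z <- A) kern n y z.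
    transitivity (\sum_(z <- A) \sum_(n < N) \sum_(y <- A) esc G [set` A] y * kern n z y).
      rewrite big_seq [RHS]big_seq; apply: eq_bigr => z zA.
      by rewrite last_exit hit_in.
    under eq_bigr do rewrite exchange_big.
    rewrite exchange_big /=; apply: eq_bigr => y _.
    rewrite mulr_sumr exchange_big /=; apply: eq_bigr => n _.
    by rewrite mulr_sumr; apply: eq_bigr => z _; rewrite kern_sym.
  rewrite mulr_sumr /cap mulr_sumr big_seq [leRHS]big_seq; apply: ler_sum => y yA.
  rewrite mulrCA mulrC ler_wpM2r ?esc_ge0 //.
  apply: (le_trans (visits N y)); rewrite lerBlDr (le_trans (fC _ yA)) // lerDl.
  exact: iter_Pop_ge0.
have lim : g0 * \sum_(z <- A) (1 - iter N (Pop G) (hit A) z) @[N --> \oo] -->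
    (g0 * \sum_(z <- A) (1 - 0) : R).
  by apply: cvgMr; apply: cvg_sum_seq => z; apply: cvgB; [exact: cvg_cst|exact: cvg_iter_hit].
have -> : g0 * (#|` A|)%:R = g0 * \sum_(z <- A) (1 - 0).
  by rewrite subr0 big_const_seq count_predT iter_addr_0.
rewrite -(cvg_lim _ lim) //; apply: limr_le; first exact: cvgP lim.
exact: nearW.
Qed.

(** By reversibility, integrating [hit A] against the charge [esc] of [B] is the same as integrating
    [hit B] against that of [A]; the latter is [cap A], because [hit B] is 1 on [A]. *)
Lemma cap_diff A B : (A `<=` B)%fset ->
  cap B - cap A = \sum_(x <- B) esc G [set` B] x * (1 - hit A x).
Proof.
move=> /fsubsetP AB.
have lim A' B' : \sum_(x <- B') esc G [set` B'] x * (hit A' x - iter N (Pop G) (hit A') x)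
    @[N --> \oo] --> (\sum_(x <- B') esc G [set` B'] x * (hit A' x - 0) : R).
  by apply: cvg_sum_seq => z; apply: cvgMr; apply: cvgB; [exact: cvg_cst|exact: cvg_iter_hit].
have swap N : \sum_(x <- B) esc G [set` B] x * (hit A x - iter N (Pop G) (hit A) x) =
    \sum_(x <- A) esc G [set` A] x * (hit B x - iter N (Pop G) (hit B) x).
  under eq_bigr do rewrite -last_exit mulr_sumr.
  under [RHS]eq_bigr do rewrite -last_exit mulr_sumr.
  rewrite exchange_big [RHS]exchange_big /=; apply: eq_bigr => n _.
  under eq_bigr do rewrite mulr_sumr.
  under [RHS]eq_bigr do rewrite mulr_sumr.
  rewrite exchange_big /=; apply: eq_bigr => y _; apply: eq_bigr => x _.
  by rewrite kern_sym mulrCA.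
have E : \sum_(x <- B) esc G [set` B] x * (hit A x - 0) = cap A.
  have h := lim A B; rewrite (_ : (fun N => _) = (fun N =>
    \sum_(x <- A) esc G [set` A] x * (hit B x - iter N (Pop G) (hit B) x))) in h; last first.
    by apply/funext => N; exact: swap.
  rewrite (cvg_unique _ h (lim B A)) // /cap big_seq [RHS]big_seq; apply: eq_bigr => x xA.
  by rewrite subr0 hit_in ?mulr1 // AB.
rewrite -E /cap -sumrB; apply: eq_bigr => x _; ring.
Qed.

Lemma cap_mono A B : (A `<=` B)%fset -> cap A <= cap B.
Proof.
move=> AB; rewrite -subr_ge0 cap_diff // sumr_ge0 // => x _.
by rewrite mulr_ge0 ?esc_ge0 // subr_ge0 hit_le1.
Qed.

Lemma cap_ge0 A : 0 <= cap A.
Proof. by rewrite sumr_ge0 // => x _; exact: esc_ge0. Qed.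

(** The neighbour [y] is one from which the walk may escape [A = {o}]. By [cap_diff] the increment
    is the product of the escape probabilities of [B = {o, y}] and of [A] from [y]. If the first
    vanished, [hit A] and [hit B] would both be multiples of the Green function with pole [o], equal
    to 1 at [o] and so equal everywhere, although at [y] only [hit B] is 1. *)
Lemma cap_strict o : 0 < (esc G [set` [fset o]%fset] o : R) ->
  exists2 y, adj G o y & cap [fset o]%fset < cap [fset o; y]%fset.
Proof.
set A := [fset o]%fset => eo.
have [y oy ey] : exists2 y, adj G o y & 0 < (esc G [set` A] y : R).
  apply: contrapT => no; move: eo; rewrite esc_Pop /Pop big_seq big1 ?mulr0 ?ltxx //.
  move=> y yo; case: ifP => // _; apply/eqP; rewrite eq_le esc_ge0 // andbT leNgt.
  apply/negP => ey; apply: no; exists y => //; rewrite -in_nbs //.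
have yo : y != o by apply: contraTneq oy => ->; rewrite adj_irr.
have yA : y \notin A by rewrite inE.
have hy : hit A y = 1 - esc G [set` A] y by rewrite /hit (negbTE yA).
exists y => //; set B := [fset o; y]%fset.
have AB : (A `<=` B)%fset by apply/fsubsetP => z; rewrite !inE => ->.
have oB : o \in B by rewrite !inE eqxx.
have yB : y \in B by rewrite !inE eqxx orbT.
have sumB (F : V -> R) : \sum_(x <- B) F x = F o + F y.
  rewrite /B big_fsetU1 ?big_seq_fset1 //= inE eq_sym //.
rewrite -subr_gt0 cap_diff // sumB (hit_in (A := A)) ?inE ?eqxx // subrr mulr0 add0r hy.
rewrite subKr mulr_gt0 // lt_def esc_ge0 // andbT; apply/eqP => e0.
have limB x : esc G [set` B] o * \sum_(n < N) kern n x o @[N --> \oo] --> hit B x.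
  have -> : (fun N => esc G [set` B] o * \sum_(n < N) kern n x o) =
      (fun N => hit B x - iter N (Pop G) (hit B) x).
    apply/funext => N; rewrite -last_exit mulr_sumr; apply: eq_bigr => n _.
    by rewrite sumB e0 mul0r addr0.
  by rewrite -[X in _ --> X]subr0; apply: cvgB; [exact: cvg_cst|exact: cvg_iter_hit].
have limA x : esc G [set` A] o * \sum_(n < N) kern n x o @[N --> \oo] --> hit A x.
  have -> : (fun N => esc G [set` A] o * \sum_(n < N) kern n x o) =
      (fun N => hit A x - iter N (Pop G) (hit A) x).
    apply/funext => N; rewrite -last_exit mulr_sumr; apply: eq_bigr => n _.
    by rewrite big_seq_fset1.
  by rewrite -[X in _ --> X]subr0; apply: cvgB; [exact: cvg_cst|exact: cvg_iter_hit].
have prop x : esc G [set` A] o * hit B x = esc G [set` B] o * hit A x.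
  have h1 : esc G [set` A] o * (esc G [set` B] o * \sum_(n < N) kern n x o) @[N --> \oo]
      --> esc G [set` A] o * hit B x by apply: cvgMr; exact: limB.
  have h2 : esc G [set` A] o * (esc G [set` B] o * \sum_(n < N) kern n x o) @[N --> \oo]
      --> esc G [set` B] o * hit A x.
    by under eq_fun do rewrite mulrCA; apply: cvgMr; exact: limA.
  exact: (cvg_unique _ h1 h2).
have := prop o; rewrite !hit_in ?inE ?eqxx // !mulr1 => eAB.
have := prop y; rewrite hit_in // mulr1 -eAB hy mulrBr mulr1 => /eqP.
rewrite -subr_eq0 opprB addrCA subrr addr0 mulf_eq0 => /orP[] /eqP h.
  by rewrite h ltxx in eo.
by rewrite h ltxx in ey.
Qed.

End regular.

(** On the diagonal, [last_exit] for [{y}] bounds the visits by the inverse of the escape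
    probability. Off the diagonal, each step of a path from [y] costs a factor [d], since the walk
    makes that step with probability [1 / d]. *)
Lemma green_of_transient d : (forall x, degree G x = d) ->
  (forall x, 0 < (esc G [set` [fset x]%fset] x : R)) ->
  forall x y, exists M, forall N, \sum_(n < N) kern n x y <= M.
Proof.
move=> reg tr x y; have [p [+ <-]] := cG y x.
elim/last_ind: p => [_|p z IHp].
  exists (esc G [set` [fset y]%fset] y)^-1 => N; rewrite /=.
  have h : esc G [set` [fset y]%fset] y * \sum_(n < N) kern n y y =
      1 - iter N (Pop G) (hit [fset y]%fset) y.
    rewrite -(hit_in (A := [fset y]%fset) (x := y)) ?inE // -last_exit mulr_sumr.
    by apply: eq_bigr => n _; rewrite big_seq_fset1.
  rewrite -(ler_pM2l (tr y)) h mulfV ?gt_eqF // lerBlDr lerDl.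
  by apply: iter_Pop_ge0 => z; exact: hit_ge0.
rewrite rcons_path last_rcons => /andP[/IHp[M hM] pz]; exists (d%:R * M) => N.
apply: le_trans (ler_wpM2l _ (hM N.+1)) => //; rewrite big_ord_recl /= mulrDr.
rewrite -[leLHS]add0r lerD //; first by rewrite mulr_ge0 ?kern_ge0.
rewrite mulr_sumr; apply: ler_sum => n _; rewrite /kern /= /Pop reg.
rewrite mulrA mulfV ?mul1r; last by rewrite -(reg z) pnatr_eq0 -lt0n degree_gt0.
rewrite (bigD1_seq z) ?fset_uniq //=; first by rewrite lerDl sumr_ge0 // => u _; exact: kern_ge0.
by rewrite -[_ \in _]/(z \in nbs G (last y p)) in_nbs.
Qed.

End potential_theory.

(** * Percolation and finite clusters *)

Lemma fset_code (V : choiceType) : countable [set: V] ->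
  exists c : {fset V} -> nat, injective c.
Proof.
move=> /countable_injP[f /in2TT finj].
exists (fun A => choice.pickle (map f (enum_fset A) : seq nat)) => A B.
by move=> /(pcan_inj choice.pickleK) /(inj_map finj) /val_inj.
Qed.

Lemma code_inv (V : choiceType) (c : {fset V} -> nat) : injective c ->
  exists dec : nat -> option {fset V}, pcancel c dec /\ forall k A, dec k = Some A -> c A = k.
Proof.
move=> cinj; pose dec k := if pselect (exists A, c A = k) is left h
  then Some (projT1 (cid h)) else None.
exists dec; split => [A|k A]; rewrite /dec.
  case: pselect => [h|[]]; last by exists A.
  by congr Some; apply: cinj; case: cid.
by case: pselect => // h [<-]; case: cid.
Qed.

(** Sums over finite sets of vertices become series over [nat], which have partial sums and commute
    with the integral; indices that encode nothing contribute 0. *)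
Lemma esum_decode (R : realType) (T : choiceType) (c : T -> nat) (dec : nat -> option T)
    (a : T -> \bar R) : pcancel c dec -> (forall k x, dec k = Some x -> c x = k) ->
  (forall x, 0 <= a x)%E ->
  (\esum_(x in [set: T]) a x = \sum_(k <oo) (if dec k is Some x then a x else 0))%E.
Proof.
move=> decK cdec a0; rewrite nneseries_esumT; last by move=> k; case: (dec k).
have bij : set_bij [set: T] (range c) c.
  split; [by move=> x _; exists x| |by move=> _ [x _ <-]; exists x].
  by move=> x y _ _ /(congr1 dec); rewrite !decK => -[].
transitivity (\esum_(k in range c) (if dec k is Some x then a x else 0))%E.
  by rewrite (reindex_esum _ _ _ _ bij); apply: eq_esum => x _; rewrite decK.
rewrite [LHS]esum_mkcond; apply: eq_esum => k _; case: ifPn => //.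
case dk: (dec k) => [x|] //; rewrite notin_setE => -[]; exists x => //.
exact: cdec.
Qed.

Lemma asbool_indic (R : realType) (T : Type) (P : set T) (w : T) :
  `[< P w >]%:R = \1_P w :> R.
Proof.
by rewrite indicE; case: asboolP => h; [rewrite mem_set|rewrite memNset].
Qed.

Section percolation_measure.
Context {R : realType} {V : choiceType} (G : sgraph V).
Hypotheses (infV : infinite_set [set: V]) (cG : connected_graph G)
  (bG : bounded_degree G).
Implicit Types (A B : {fset V}) (l : seq (edge G)) (w : configurations G).

Let fin x : finite_set (nbhd G x). Proof. exact: nbhd_finite. Qed.

Lemma ball_exhausts o x : exists n, x \in ball G n o.
Proof.
have [p [op <-]] := cG o x; elim/last_ind: p op => [_|p z IHp].
  by exists 0%N; exact: ball_center.
rewrite rcons_path last_rcons => /andP[/IHp[n pn] pz].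
by exists n.+1; exact: ballS pn pz.
Qed.

Lemma sub_ball o n m : (n <= m)%N -> (ball G n o `<=` ball G m o)%fset.
Proof.
elim: m => [|m IHm]; first by rewrite leqn0 => /eqP ->.
rewrite leq_eqVlt => /orP[/eqP -> //|nm].
exact: fsubset_trans (IHm nm) (sub_ballS _ _ _).
Qed.

Lemma fset_in_ball o A : exists n, (A `<=` ball G n o)%fset.
Proof.
have /choice[n nP] x : exists n, x \in ball G n o by exact: ball_exhausts.
exists (\max_(x <- A) n x); apply/fsubsetP => x xA.
apply: (fsubsetP (sub_ball _ _)) (nP x).
by rewrite (@leq_bigmax_seq _ _ xpredT n x).
Qed.

Lemma edges_at_sub A B : (A `<=` B)%fset -> {subset edges_at G A <= edges_at G B}.
Proof.
move=> /fsubsetP AB e /edges_at_touch[x xA xe].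
by apply: mem_edges_at xe => //; exact: AB.
Qed.

Local Notation window n o := (edges_at G (ball G n o)).

Lemma cluster_window w o x : cluster w o x ->
  exists n, cluster (restr (window n o) w) o x /\ x \in ball G n o.
Proof.
apply: (@cluster_ind _ _ _ _ (fun x => exists n,
  cluster (restr (window n o) w) o x /\ x \in ball G n o)).
  by exists 0%N; split; [exact: cluster_refl|exact: ball_center].
move=> y z _ [n [oy yn]] yz; exists n.+1.
have mono : subconfig (restr (window n o) w) (restr (window n.+1 o) w).
  move=> e; rewrite /restr => /andP[en ->]; rewrite andbT.
  by apply: edges_at_sub en; exact: sub_ballS.
have yS : y \in ball G n.+1 o by apply: (fsubsetP (sub_ballS G n o)).
split; last exact: ballS yn (open_adj_adj yz).
apply: (cluster_step (cluster_mono mono oy)).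
case/open_adjP: yz => e [eyz we]; apply/open_adjP; exists e; split => //.
by rewrite /restr we andbT; apply: mem_edges_at yS _ => //; rewrite eyz !inE eqxx.
Qed.

(** The edges with an end in [A] decide the event: those inside must connect [A], those that leave
    it must be closed. This is why the probability of a shape is the polynomial [shape_prob]. *)
Lemma cluster_eqP w o A : cluster w o = [set` A] <->
  cluster (restr (edges_at G A) w) o = [set` A].
Proof.
have restr_on_A y z : y \in A -> open_adj w y z -> open_adj (restr (edges_at G A) w) y z.
  move=> yA /open_adjP[e [eyz we]]; apply/open_adjP; exists e; split => //.
  by rewrite /restr we andbT; apply: mem_edges_at yA _ => //; rewrite eyz !inE eqxx.
split => [CA|CA].
  apply/seteqP; split => [x|x /= xA].
    by move=> /(cluster_mono (@subconfig_restr _ _ _)); rewrite CA.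
  have : cluster w o x by rewrite CA.
  apply: (@cluster_ind _ _ _ _ (fun x => cluster (restr (edges_at G A) w) o x)).
    exact: cluster_refl.
  move=> y z oy IHy yz; apply: cluster_step IHy _; apply: restr_on_A yz.
  by move: oy; rewrite CA.
apply/seteqP; split => [x|x xA]; last first.
  by apply: (cluster_mono (@subconfig_restr _ (edges_at G A) w)); rewrite CA.
apply: (cluster_invariant (A := [set` A])) => [|y z /= yA yz].
  by rewrite -CA; exact: cluster_refl.
suff : [set` A] z by []; rewrite -CA; apply: cluster_step (restr_on_A _ _ yA yz).
by rewrite CA.
Qed.

Definition shape_prob (p : R) o A : R :=
  bern p (1 - p) (edges_at G A) (fun w => `[< cluster w o = [set` A] >]%:R).

Lemma measurable_edge (e : edge G) : measurable [set w : configurations G | w e].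
Proof. by apply: sub_sigma_algebra; exists e, [set b | b = true]. Qed.

Lemma measurable_restr l (Q : set (edge G -> bool)) :
  measurable [set w : configurations G | Q (restr l w)].
Proof.
elim: l Q => [|e l IHl] Q.
  have [Q0|Q0] := pselect (Q (fun=> false)).
    by rewrite (_ : [set _ | _] = setT) //; apply/seteqP; split.
  by rewrite (_ : [set _ | _] = set0) //; apply/seteqP; split.
rewrite (_ : [set _ | _] =
  ([set w : configurations G | w e] `&` [set w : configurations G | Q (upd e (restr l w))])
  `|` (~` [set w : configurations G | w e] `&` [set w : configurations G | Q (restr l w)])).
  apply: measurableU; apply: measurableI.
  - exact: measurable_edge.
  - exact: (IHl (fun w => Q (upd e w))).
  - by apply: measurableC; exact: measurable_edge.
  - exact: IHl.
apply/seteqP; split => w /=.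
  have [we|we] := boolP (w e); first by rewrite -(upd_restr l we); left.
  by rewrite (restr_cons_closed _ we) => Qw; right; split => //; exact/negP.
by case=> -[we]; [rewrite upd_restr|rewrite restr_cons_closed //; exact/negP].
Qed.

Lemma measurable_fun_restr l (F : (edge G -> bool) -> R) (D : set (configurations G)) :
  measurable D -> measurable_fun D (fun w => (F (restr l w))%:E : \bar R).
Proof.
move=> mD _ Y mY; apply: measurableI => //.
exact: (measurable_restr l (fun w => Y (F w)%:E)).
Qed.

Section parameter.
Variable p : R.
Hypothesis p01 : 0 <= p <= 1.
Local Notation mu := (percolation G p).

Let p0 : 0 <= p. Proof. by case/andP: p01. Qed.
Let q0 : 0 <= 1 - p. Proof. by case/andP: p01; rewrite subr_ge0. Qed.

Lemma measurable_cylinder (F : {fset edge G}) (b : edge G -> bool) :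
  measurable [set w : configurations G | forall e, e \in F -> w e = b e].
Proof.
rewrite (_ : [set _ | _] = [set w | (forall e, e \in F -> restr (enum_fset F) w e = b e)]).
  exact: (measurable_restr (enum_fset F) (fun w => forall e, e \in F -> w e = b e)).
by apply/seteqP; split => w /= h e eF; have := h e eF; rewrite /restr eF.
Qed.

Lemma integral_restr l (F : (edge G -> bool) -> R) : uniq l -> (forall w, 0 <= F w) ->
  (\int[mu]_w (F (restr l w))%:E = (bern p (1 - p) l F)%:E)%E.
Proof.
move=> ul F0.
pose D (E : {fset edge G}) (b : edge G -> bool) : set (configurations G) :=
  [set w | forall e, e \in E -> w e = b e].
have mD E b : measurable (D E b) by exact: measurable_cylinder.
(* Peeling off an edge conditions on its state, so the induction carries an arbitrary cylinder on
   edges outside the remaining list. *)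
suff H : forall (E : {fset edge G}) b, (forall e, e \in l -> e \notin E) ->
  (\int[mu]_(w in D E b) (F (restr l w))%:E =
   ((\prod_(e <- E) (if b e then p else 1 - p)) * bern p (1 - p) l F)%:E)%E.
  have := H fset0 (fun=> false) (fun _ _ => isT).
  rewrite big_seq_fset0 mul1r => <-; congr (integral _ _ _).
  by apply/seteqP; split => // w _ e.
elim: l ul F F0 => [|e l IHl] /= ul F F0 E b lE.
  rewrite (eq_integral (cst (F (fun=> false))%:E)) ?integral_cst //.
  by rewrite [X in (_ * X)%E](percolationP p01 cG bG E b) EFinM muleC.
case/andP: ul => el ul.
have eE : e \notin E by apply: lE; rewrite mem_head.
have lE' : forall f, f \in l -> f \notin (e |` E)%fset.
  move=> f fl; rewrite !inE negb_or lE ?inE ?fl ?orbT // andbT.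
  by apply: contraNneq el => <-.
pose b1 f := if f == e then true else b f.
pose b0 f := if f == e then false else b f.
have DE (c : bool) : D (e |` E)%fset (fun f => if f == e then c else b f) =
    D E b `&` [set w | w e = c].
  apply/seteqP; split => w /=.
    move=> h; split; last by have := h e; rewrite !inE eqxx; exact.
    move=> f fE; have := h f; rewrite !inE fE orbT => -> //.
    by case: eqVneq => // fe; rewrite -fe fE in eE.
  case=> h we f; rewrite !inE; case: eqVneq => [->//|_] /=; exact: h.
have -> : D E b = D (e |` E)%fset b1 `|` D (e |` E)%fset b0.
  rewrite !DE -setIUr (_ : _ `|` _ = setT) ?setIT //.
  by apply/seteqP; split => // w _ /=; case: (w e); [left|right].
rewrite ge0_integral_setU //; first last.
- apply/disj_setPS => w []; rewrite !DE => -[_ /= we] [_ /=].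
  by rewrite we.
- by move=> w _; rewrite lee_fin.
- apply: (measurable_fun_restr (e :: l)).
  exact: measurableU.
rewrite (eq_integral (fun w => (F (upd e (restr l w)))%:E)); last first.
  move=> w; rewrite inE DE => -[_ /= we].
  by rewrite upd_restr.
rewrite (eq_integral (D := D (e |` E)%fset b0) (fun w => (F (restr l w))%:E)); last first.
  move=> w; rewrite inE DE => -[_ /= we].
  by rewrite restr_cons_closed // we.
rewrite (IHl ul (fun w => F (upd e w))) // IHl // -EFinD; congr EFin.
rewrite !big_fsetU1 //= /b1 /b0 !eqxx.
have E1 (c : bool) : \prod_(f <- E) (if if f == e then c else b f then p else 1 - p) =
    \prod_(f <- E) (if b f then p else 1 - p).
  rewrite big_seq [RHS]big_seq; apply: eq_bigr => f fE.
  by case: eqVneq => // fe; rewrite -fe -[_ \in _]/(f \in enum_fset E) fE in eE.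
by rewrite !E1; ring.
Qed.

Lemma probability_restr l (Q : set (edge G -> bool)) : uniq l ->
  mu [set w | Q (restr l w)] = (bern p (1 - p) l (fun w => `[< Q w >]%:R))%:E.
Proof.
move=> ul; rewrite -integral_restr // -[LHS]mul1e -[LHS]integral_cst //; last first.
  exact: measurable_restr.
rewrite [LHS]integral_mkcond; apply: eq_integral => w _; rewrite patchE.
by case: asboolP => h; [rewrite mem_set|rewrite memNset].
Qed.

Lemma probability_shape o A : mu [set w | cluster w o = [set` A]] = (shape_prob p o A)%:E.
Proof.
rewrite /shape_prob -(probability_restr (fun w => cluster w o = [set` A])) ?edges_at_uniq //.
suff -> : [set w | cluster w o = [set` A]] =
  [set w : configurations G | cluster (restr (edges_at G A) w) o = [set` A]] by [].
by apply/seteqP; split => w /= h; [exact/(cluster_eqP w o A).1|exact/(cluster_eqP w o A).2].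
Qed.

Lemma measurable_shape o A : measurable [set w : configurations G | cluster w o = [set` A]].
Proof.
rewrite (_ : [set _ | _] =
  [set w | cluster (restr (edges_at G A) w) o = [set` A]]).
  exact: (measurable_restr _ (fun w => cluster w o = [set` A])).
by apply/seteqP; split => w /= h; [exact/(cluster_eqP w o A).1|exact/(cluster_eqP w o A).2].
Qed.

Lemma shape_prob_ge0 o A : 0 <= shape_prob p o A.
Proof. by apply: bern_ge0. Qed.

Let size_in n o w : \bar R := (csize (ball G n o) (restr (window n o) w) o)%:R%:E.

Lemma csize_le_counting U l w o : uniq U ->
  ((csize U (restr l w) o)%:R%:E <= (counting (cluster w o) : \bar R))%E.
Proof.
move=> uU; rewrite /counting; case: asboolP => [fC|_]; last by rewrite leey.
rewrite lee_fin ler_nat /csize -size_filter; apply: uniq_leq_size.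
  by rewrite filter_uniq.
move=> x; rewrite mem_filter => /andP[/set_mem xC _].
rewrite -[_ \in _]/(x \in fset_set (cluster w o)) in_fset_set // mem_set //.
exact: (cluster_mono (@subconfig_restr _ _ _) xC).
Qed.

Lemma size_in_nd o w : nondecreasing_seq (fun n => size_in n o w).
Proof.
apply/nondecreasing_seqP => n; rewrite lee_fin ler_nat /csize -!size_filter.
apply: uniq_leq_size => [|x]; first by rewrite filter_uniq ?fset_uniq.
rewrite !mem_filter => /andP[/set_mem xC xB]; apply/andP; split; last first.
  by apply: (fsubsetP (sub_ballS _ _ _)) xB.
rewrite /= mem_set //; apply: cluster_mono xC => e; rewrite /restr => /andP[en ->].
by rewrite andbT; apply: edges_at_sub en; exact: sub_ballS.
Qed.

(** Any finite part of the cluster is joined to [o] within a large window, also when the cluster is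
    infinite; monotone convergence then applies to [counting]. *)
Lemma cvg_size_in o w : size_in n o w @[n --> \oo] --> (counting (cluster w o) : \bar R).
Proof.
have -> : counting (cluster w o) = ereal_sup (range (fun n => size_in n o w)) :> \bar R.
  apply/eqP; rewrite eq_le; apply/andP; split; last first.
    by apply: ge_ereal_sup => _ [n _ <-]; apply: csize_le_counting; rewrite fset_uniq.
  have low (B : {fset V}) : [set` B] `<=` cluster w o ->
      ((#|` B|)%:R%:E <= ereal_sup (range (fun n => size_in n o w)))%E.
    move=> BC.
    have /choice[n nP] x : exists n, x \in B ->
        cluster (restr (window n o) w) o x /\ x \in ball G n o.
      have [xB|xB] := boolP (x \in B); last by exists 0%N.
      by have [n h] := cluster_window (BC _ xB); exists n.
    pose m := \max_(x <- B) n x.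
    apply: (@le_trans _ _ (size_in m o w)); last by apply: ereal_sup_ubound; exists m.
    rewrite lee_fin ler_nat /csize -size_filter; apply: uniq_leq_size => [|x xB].
      exact: fset_uniq.
    have nm : (n x <= m)%N by rewrite /m (@leq_bigmax_seq _ _ xpredT n x).
    have [xC xb] := nP x xB; rewrite mem_filter; apply/andP; split; last first.
      exact: (fsubsetP (sub_ball _ nm)) xb.
    rewrite /= mem_set //; apply: cluster_mono xC => e; rewrite /restr => /andP[en ->].
    by rewrite andbT; apply: edges_at_sub en; exact: sub_ball.
  rewrite /counting; case: asboolP => fC; first by apply: low; rewrite fset_setK.
  rewrite leye_eq; apply/eqP/eqyP => r r0.
  have [B BC Br] := infinite_set_fset (Num.truncn r).+1 fC.
  apply: le_trans (low _ BC); rewrite lee_fin.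
  by apply: (le_trans (ltW (truncnS_gt _))); rewrite ler_nat.
exact: ereal_nondecreasing_cvgn (@size_in_nd o w).
Qed.

Let msize_in n o : measurable_fun setT (size_in n o).
Proof.
exact: (measurable_fun_restr (window n o) (fun w => (csize (ball G n o) w o)%:R)).
Qed.

Lemma measurable_counting o :
  measurable_fun setT (fun w : configurations G => counting (cluster w o) : \bar R).
Proof.
apply: (emeasurable_fun_cvg (fun n => size_in n o)) => [n|w _]; first exact: msize_in.
exact: cvg_size_in.
Qed.

Lemma counting_ge0 (X : set V) : (0 <= (counting X : \bar R))%E.
Proof. by rewrite /counting; case: asboolP => // _; rewrite lee_fin. Qed.

Lemma csize_le_expected l U o (M : R) : (expected_cluster_size G p o <= M%:E)%E ->
  uniq l -> uniq U -> bern p (1 - p) l (fun w => (csize U w o)%:R) <= M.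
Proof.
move=> EM ul uU; rewrite -lee_fin; apply: le_trans EM; rewrite -integral_restr //.
apply: ge0_le_integral => //.
- exact: (measurable_fun_restr l (fun w => (csize U w o)%:R)).
- exact: measurable_counting.
- by move=> w _; exact: csize_le_counting.
Qed.

Lemma expected_le o (M : R) :
  (forall n, bern p (1 - p) (window n o) (fun w => (csize (ball G n o) w o)%:R) <= M) ->
  (expected_cluster_size G p o <= M%:E)%E.
Proof.
move=> bM; rewrite /expected_cluster_size.
have := @cvg_monotone_convergence _ _ _ mu setT measurableT (fun n => size_in n o).
move=> /(_ (fun n => msize_in n o) (fun n w _ => _) (fun w _ => size_in_nd o w)) h.
have {}h : (\int[mu]_w size_in n o w @[n --> \oo] --> \int[mu]_w counting (cluster w o))%E.
  rewrite (eq_integral (fun w => limn (fun n => size_in n o w))).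
    by apply: h => n w; rewrite lee_fin.
  by move=> w _; apply/esym/cvg_lim => //; exact: cvg_size_in.
rewrite -(cvg_lim _ h) //; apply: lime_le; first exact: cvgP h.
apply: nearW => n; rewrite (integral_restr (F := fun w => (csize (ball G n o) w o)%:R)) //.
  by rewrite lee_fin.
exact: edges_at_uniq.
Qed.

Lemma infinite_cluster_null o : (expected_cluster_size G p o < +oo)%E ->
  {ae mu, forall w, finite_set (cluster w o)}.
Proof.
move=> Efin.
have int : mu.-integrable setT (fun w => counting (cluster w o)).
  apply/integrableP; split; first exact: measurable_counting.
  rewrite (eq_integral (fun w => counting (cluster w o))) // => w _.
  by rewrite gee0_abs // counting_ge0.
have := integrable_ae measurableT int; apply: filterS => w /(_ I).
by rewrite /counting; case: asboolP.
Qed.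

Definition shape_fun (Phi : {fset V} -> R) o w : \bar R :=
  if `[< finite_set (cluster w o) >] then (Phi (fset_set (cluster w o)))%:E else 0%E.

(** The events that the cluster has a given finite shape are disjoint, so the integrand is pointwise
    a series with at most one nonzero term. *)
Lemma shape_fun_integral (Phi : {fset V} -> R) o : (forall A, 0 <= Phi A) ->
  measurable_fun setT (shape_fun Phi o) /\
  (\int[mu]_w shape_fun Phi o w =
   \esum_(A in [set: {fset V}]) (Phi A * shape_prob p o A)%:E)%E.
Proof.
move=> Phi0; have [c cinj] := fset_code (connected_countable cG bG).
have [dec [decK cdec]] := code_inv cinj.
pose t k w : \bar R := if dec k is Some A then
  (Phi A * `[< cluster w o = [set` A] >]%:R)%:E else 0%E.
have t0 k w : (0 <= t k w)%E.
  by rewrite /t; case: (dec k) => // A; rewrite lee_fin mulr_ge0.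
have tE k : exists A, t k = fun w => ((if dec k is Some A then Phi A else 0) *
    (\1_[set w : configurations G | cluster w o = [set` A]] w))%:E.
  rewrite /t; case: (dec k) => [A|]; last first.
    by exists fset0; apply/funext => w; rewrite mul0r.
  by exists A; apply/funext => w; rewrite -asbool_indic.
have mt k : measurable_fun setT (t k).
  have [A ->] := tE k; apply/measurable_EFinP; apply: measurable_funM => //.
  by apply: measurable_indic; exact: measurable_shape.
have single (a : nat -> \bar R) k0 : (forall k, 0 <= a k)%E ->
    (forall k, k != k0 -> a k = 0%E) -> (\sum_(k <oo) a k = a k0)%E.
  move=> a0 ak; rewrite nneseries_esumT // -(esum_set1 (t := k0)) // [RHS]esum_mkcond.
  apply: eq_esum => k _; case: ifPn => [/set_mem -> //|].
  by rewrite notin_setE /= => /eqP; exact: ak.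
have sumt w : shape_fun Phi o w = (\sum_(k <oo) t k w)%E.
  rewrite /shape_fun; case: asboolP => fC.
    rewrite (single _ (c (fset_set (cluster w o)))) //.
      by rewrite /t decK asboolT ?mulr1 // fset_setK.
    move=> k; rewrite /t; case dk: (dec k) => [A|] //; rewrite -(cdec _ _ dk).
    case: asboolP => [->|_]; last by rewrite mulr0.
    by rewrite set_fsetK eqxx.
  rewrite eseries0 // => k _ _; rewrite /t; case: (dec k) => // A.
  by rewrite asboolF ?mulr0 // => CA; apply: fC; rewrite CA; exact: finite_fset.
have meas : measurable_fun setT (shape_fun Phi o).
  apply: (eq_measurable_fun (fun w => \sum_(k <oo) t k w)%E).
    by move=> w _; rewrite sumt.
  by apply: ge0_emeasurable_sum => // k w _ _; exact: t0.
split => //; under eq_integral => w _ do rewrite sumt.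
rewrite integral_nneseries //.
have It k : (\int[mu]_w t k w =
    if dec k is Some A then (Phi A * shape_prob p o A)%:E else 0)%E.
  rewrite /t; case: (dec k) => [A|]; last by rewrite integral0.
  transitivity ((Phi A)%:E * \int[mu]_w (\1_[set w : configurations G |
      cluster w o = [set` A]] w)%:E)%E.
    rewrite -ge0_integralZl_EFin //.
    by apply/measurable_EFinP; apply: measurable_indic; exact: measurable_shape.
  rewrite integral_indic //; last exact: measurable_shape.
  by rewrite setIT [X in (_ * X)%E](probability_shape o A) EFinM.
under eq_eseriesr do rewrite It.
by rewrite (esum_decode decK cdec) // => A; rewrite lee_fin mulr_ge0 //; exact: shape_prob_ge0.
Qed.

End parameter.
End percolation_measure.

(** * Analyticity *)

Section majorants.
Context {R : realType}.
Implicit Types (P Q S T : {poly R}) (r h : R).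

(** Coefficientwise domination survives sums and products, which are all that [bern] is made of. *)
Definition majorizes S T := forall j, `|T`_j| <= S`_j.

Lemma majorizes_add S T S' T' : majorizes S T -> majorizes S' T' ->
  majorizes (S + S') (T + T').
Proof. by move=> h h' j; rewrite !coefD (le_trans (ler_normD _ _)) // lerD. Qed.

Lemma majorizes_mul S T S' T' : majorizes S T -> majorizes S' T' ->
  majorizes (S * S') (T * T').
Proof.
move=> h h' j; rewrite !coefM (le_trans (ler_norm_sum _ _ _)) // ler_sum // => i _.
by rewrite normrM ler_pM.
Qed.

Lemma majorizes_bern (E : eqType) (S T S' T' : {poly R}) (l : seq E)
    (F : (E -> bool) -> bool) : majorizes S T -> majorizes S' T' ->
  majorizes (bern S S' l (fun w => (F w)%:R)) (bern T T' l (fun w => (F w)%:R)).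
Proof.
move=> h h'; elim: l F => [|e l IHl] F /=.
  by case: (F _) => j; rewrite ?coef1 ?coef0 ?normr0 // normr_nat.
by apply: majorizes_add; apply: majorizes_mul => //; exact: IHl.
Qed.

Lemma majorizesZ c S T : 0 <= c -> majorizes S T -> majorizes (c *: S) (c *: T).
Proof. by move=> c0 h j; rewrite !coefZ normrM ger0_norm // ler_wpM2l. Qed.

Lemma majorant_ge0 S T j : majorizes S T -> 0 <= S`_j.
Proof. by move=> /(_ j); exact: le_trans. Qed.

Lemma majorant_coef S T r j : 0 <= r -> majorizes S T -> S`_j * r ^+ j <= S.[r].
Proof.
move=> r0 ST; rewrite (@horner_coef_wide _ (maxn (size S) j.+1)) ?leq_maxl //.
have jm : (j < maxn (size S) j.+1)%N by rewrite leq_max ltnSn orbT.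
rewrite (bigD1 (Ordinal jm)) //= lerDl sumr_ge0 // => i _.
by rewrite mulr_ge0 ?exprn_ge0 //; exact: majorant_ge0 ST.
Qed.

(** In the tail, [(|h| / r) ^ j <= (|h| / r) ^ n] takes out the common factor and leaves the
    majorant evaluated at [r]. *)
Lemma majorant_tail S T r h n : 0 < r -> `|h| <= r -> majorizes S T ->
  `|T.[h] - \sum_(j < n) T`_j * h ^+ j| <= (`|h| / r) ^+ n * S.[r].
Proof.
move=> r0 hr ST; pose m := maxn n (maxn (size S) (size T)).
have hr1 : 0 <= `|h| / r <= 1 by rewrite divr_ge0 ?(ltW r0) // ler_pdivrMr // mul1r.
have [q0 q1] := andP hr1.
have nm : (n <= m)%N by rewrite leq_maxl.
have Tm : (size T <= m)%N by rewrite /m !leq_max leqnn !orbT.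
have Sm : (size S <= m)%N by rewrite /m !leq_max leqnn !orbT.
rewrite (horner_coef_wide _ Tm) (horner_coef_wide _ Sm).
rewrite -(big_mkord xpredT (fun j => T`_j * h ^+ j)).
rewrite -(big_mkord xpredT (fun j => T`_j * h ^+ j)).
rewrite -(big_mkord xpredT (fun j => S`_j * r ^+ j)).
rewrite (big_cat_nat (leq0n n) nm) /= addrAC subrr add0r (big_cat_nat (leq0n n) nm) /=.
rewrite mulrDr -[leLHS]add0r lerD //.
  by rewrite mulr_ge0 ?exprn_ge0 // sumr_ge0 // => i _;
     rewrite mulr_ge0 ?exprn_ge0 ?(ltW r0) //; exact: majorant_ge0 ST.
rewrite (le_trans (ler_norm_sum _ _ _)) // mulr_sumr big_nat [leRHS]big_nat.
apply: ler_sum => j /andP[nj _].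
have -> : (`|h| / r) ^+ n * (S`_j * r ^+ j) = S`_j * ((`|h| / r) ^+ n * r ^+ j) by ring.
rewrite normrM ler_pM //.
have -> : `|h ^+ j| = (`|h| / r) ^+ j * r ^+ j.
  by rewrite -exprMn divfK ?gt_eqF // normrX.
by rewrite ler_wpM2r ?exprn_ge0 ?(ltW r0) // ler_wiXn2l.
Qed.

(* Interchanging the two summations needs only finite sums: the tail of the
   power series of each polynomial is controlled by its majorant. *)
Lemma power_series_of_majorants (S T : nat -> {poly R}) (f : R -> R) (D : set R) (r M : R) :
  0 < r -> (forall k, majorizes (S k) (T k)) ->
  (forall K, \sum_(k < K) (S k).[r] <= M) ->
  (forall h, D h -> `|h| < r -> \sum_(k < K) (T k).[h] @[K --> \oo] --> f h) ->
  exists a : nat -> R, forall h n, D h -> `|h| < r ->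
    `|f h - \sum_(j < n) a j * h ^+ j| <= (`|h| / r) ^+ n * M.
Proof.
move=> r0 ST SM Tf.
have cv j : cvgn (fun K => \sum_(k < K) (T k)`_j).
  have -> : (fun K => \sum_(k < K) (T k)`_j) = series (fun k => (T k)`_j).
    by apply/funext => K; rewrite /series /= big_mkord.
  apply: normed_cvg; apply: nondecreasing_is_cvgn.
    by apply: nondecreasing_series => k _ _; exact: normr_ge0.
  exists (M / r ^+ j) => _ [K _ <-]; rewrite /= /series /= big_mkord.
  rewrite ler_pdivlMr ?exprn_gt0 // mulr_suml; apply: le_trans (SM K).
  apply: ler_sum => k _; apply: le_trans (majorant_coef j (ltW r0) (ST k)).
  by rewrite ler_wpM2r ?exprn_ge0 ?(ltW r0) //; exact: ST.
exists (fun j => limn (fun K => \sum_(k < K) (T k)`_j)) => h n Dh hr.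
pose u K : R := \sum_(k < K) ((T k).[h] - \sum_(j < n) (T k)`_j * h ^+ j).
have cu : u K @[K --> \oo] -->
    f h - \sum_(j < n) limn (fun K => \sum_(k < K) (T k)`_j) * h ^+ j.
  have -> : u = fun K => \sum_(k < K) (T k).[h] -
      \sum_(j < n) (\sum_(k < K) (T k)`_j) * h ^+ j.
    apply/funext => K; rewrite /u sumrB; congr (_ - _).
    by rewrite exchange_big /=; apply: eq_bigr => j _; rewrite mulr_suml.
  apply: cvgB; first exact: Tf.
  by apply: cvg_sum_seq => j; apply: cvgMl; exact: cv.
have cu' : `|u K| @[K --> \oo] -->
    `|f h - \sum_(j < n) limn (fun K => \sum_(k < K) (T k)`_j) * h ^+ j|.
  exact: cvg_norm cu.
rewrite -(cvg_lim _ cu') //.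
apply: limr_le; first exact: cvgP cu'.
apply: nearW => K; rewrite (le_trans (ler_norm_sum _ _ _)) //.
apply: (@le_trans _ _ (\sum_(k < K) (`|h| / r) ^+ n * (S k).[r])).
  by apply: ler_sum => k _; exact: majorant_tail (ltW hr) (ST k).
by rewrite -mulr_sumr ler_wpM2l // exprn_ge0 // divr_ge0 ?(ltW r0).
Qed.

Lemma series_of_taylor_bound (a : nat -> R) (y h r M : R) : 0 < r -> `|h| < r ->
  (forall n, `|y - \sum_(j < n) a j * h ^+ j| <= (`|h| / r) ^+ n * M) ->
  series (fun n => a n * h ^+ n) @ \oo --> y.
Proof.
move=> r0 hr tail.
have q1 : `|(`|h| / r)| < 1.
  by rewrite ger0_norm ?divr_ge0 ?(ltW r0) // ltr_pdivrMr // mul1r.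
have c0 : (`|h| / r) ^+ n * M @[n --> \oo] --> (0 : R).
  by rewrite -[X in _ --> X](mul0r M); apply: cvgMl; exact: cvg_expr.
have c1 : y - series (fun n => a n * h ^+ n) n @[n --> \oo] --> (0 : R).
  apply/norm_cvg0P; apply: (@squeeze_cvgr _ _ _ _ (fun=> 0) (fun n => (`|h| / r) ^+ n * M)) => //.
    by apply: nearW => n; rewrite normr_ge0 /= /series /= big_mkord.
  exact: cvg_cst.
have c2 : y - (y - series (fun n => a n * h ^+ n) n) @[n --> \oo] --> y - 0.
  by apply: cvgB c1; exact: cvg_cst.
rewrite subr0 in c2; apply: cvg_trans c2; apply: near_eq_cvg.
by apply: nearW => n; rewrite subKr.
Qed.

End majorants.

(** * Invariance of percolation under graph automorphisms *)

Section percolation_automorphism.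
Context {V : choiceType} (G : sgraph V).
Implicit Types (A B : {fset V}) (x y o : V).

Lemma is_edge_image (phi : V -> V) (e : edge G) :
  (forall x y, adj G (phi x) (phi y) = adj G x y) ->
  is_edge G [fset phi x | x in val e]%fset.
Proof.
move=> aphi; have [x [y [xy exy]]] := edgeP e; apply/asboolP; exists (phi x), (phi y).
rewrite aphi; split => //; apply/fsetP => z; rewrite exy !inE; apply/imfsetP/orP.
  by case=> u /=; rewrite !inE => /orP[/eqP->|/eqP->] ->; rewrite eqxx; [left|right].
by case=> /eqP ->; [exists x|exists y]; rewrite ?inE ?eqxx ?orbT.
Qed.

Definition edge_image (phi : V -> V)
    (aphi : forall x y, adj G (phi x) (phi y) = adj G x y) (e : edge G) : edge G :=
  exist (fun e => is_true (is_edge G e)) _ (is_edge_image e aphi).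

Variables (phi psi : V -> V).
Hypotheses (phiK : cancel phi psi) (psiK : cancel psi phi)
  (aphi : forall x y, adj G (phi x) (phi y) = adj G x y).

Lemma adj_inverse x y : adj G (psi x) (psi y) = adj G x y.
Proof. by rewrite -aphi !psiK. Qed.

Let ephi := edge_image aphi.
Let epsi := edge_image adj_inverse.

Let fimK (f g : V -> V) A : cancel f g ->
  ([fset g x | x in [fset f x | x in A]] = A)%fset.
Proof.
move=> fK; apply/fsetP => z; apply/imfsetP/idP => /=.
  by case=> _ /imfsetP[y /= yA ->] ->; rewrite fK.
by move=> zA; exists (f z); rewrite ?fK //; apply/imfsetP; exists z.
Qed.

Lemma edge_imageK : cancel ephi epsi.
Proof. by move=> e; apply: val_inj; rewrite /= fimK. Qed.

Lemma edge_imageVK : cancel epsi ephi.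
Proof. by move=> e; apply: val_inj; rewrite /= fimK. Qed.

Definition push_config (w : edge G -> bool) : edge G -> bool := fun e => w (epsi e).

Lemma bern_push (K : comNzRingType) (a b : K) (l : seq (edge G)) F :
  bern a b (map ephi l) F = bern a b l (fun w => F (push_config w)).
Proof. exact: (bern_map _ _ _ _ edge_imageK edge_imageVK). Qed.

Lemma fset2_image (f : V -> V) x y : ([fset f z | z in [fset x; y]] = [fset f x; f y])%fset.
Proof.
apply/fsetP => z; rewrite !inE; apply/imfsetP/orP.
  by case=> u /=; rewrite !inE => /orP[/eqP->|/eqP->] ->; rewrite eqxx; [left|right].
by case=> /eqP ->; [exists x|exists y]; rewrite ?inE ?eqxx ?orbT.
Qed.

Lemma open_adj_push w x y : open_adj (push_config w) (phi x) (phi y) = open_adj w x y.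
Proof.
apply/open_adjP/open_adjP => -[e [exy we]].
  by exists (epsi e); split => //=; rewrite exy fset2_image !phiK.
exists (ephi e); split; first by rewrite /= exy fset2_image.
by rewrite /push_config edge_imageK.
Qed.

Lemma cluster_push w x y : cluster (push_config w) (phi x) (phi y) <-> cluster w x y.
Proof.
split => [|xy].
  move: (phi y) (phiK y) => z <-; move: z.
  apply: (@cluster_ind _ _ _ _ (fun z => cluster w x (psi z))).
    by rewrite phiK; exact: cluster_refl.
  move=> u v _ xu uv; apply: cluster_step xu _.
  by rewrite -open_adj_push !psiK.
move: y xy; apply: (@cluster_ind _ _ _ _ (fun y => cluster (push_config w) (phi x) (phi y))).
  exact: cluster_refl.
by move=> u v _ xu uv; apply: cluster_step xu _; rewrite open_adj_push.
Qed.

Lemma csize_push U w x : csize (map phi U) (push_config w) (phi x) = csize U w x.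
Proof.
rewrite /csize count_map; apply: eq_count => y /=.
by apply/idP/idP => /set_mem /cluster_push h; rewrite mem_set.
Qed.

Hypothesis fin : forall x, finite_set (nbhd G x).

Lemma edges_at_image A :
  perm_eq (edges_at G [fset phi x | x in A]%fset) (map ephi (edges_at G A)).
Proof.
apply: uniq_perm; first exact: edges_at_uniq.
  by rewrite map_inj_uniq ?edges_at_uniq //; exact: can_inj edge_imageK.
move=> e; rewrite -[e in RHS]edge_imageVK (mem_map (can_inj edge_imageK)).
apply/idP/idP => /edges_at_touch[x].
  move=> /imfsetP[y /= yA ->] ye; apply: (mem_edges_at fin yA).
  by rewrite /=; apply/imfsetP; exists (phi y); rewrite ?phiK.
move=> xA /= /imfsetP[y /= ye xy]; apply: (mem_edges_at fin _ ye).
by apply/imfsetP; exists x; rewrite // xy psiK.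
Qed.

Lemma shape_prob_image (R : realType) (p : R) o A :
  shape_prob G p (phi o) [fset phi x | x in A]%fset = shape_prob G p o A.
Proof.
rewrite /shape_prob (bern_perm _ _ _ (edges_at_uniq _ _) (edges_at_image A)) bern_push.
apply: eq_bern => w; congr (nat_of_bool _)%:R.
have mem_im y : (phi y \in [fset phi x | x in A]%fset) = (y \in A).
  by apply/imfsetP/idP => [[z /= zA /(can_inj phiK) ->]|yA] //; exists y.
apply/asboolP/asboolP => CA.
  apply/seteqP; split => y /=.
    by move=> /cluster_push; rewrite CA /= mem_im.
  by move=> yA; apply/cluster_push; rewrite CA /= mem_im.
apply/seteqP; split => y; rewrite -[y]psiK.
  by move=> /cluster_push; rewrite CA /= mem_im.
by rewrite /= mem_im => yA; apply/cluster_push; rewrite CA.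
Qed.

End percolation_automorphism.

(** * Finite expected cluster size below the critical point *)

Section critical_point.
Context {R : realType} {V : choiceType} (G : sgraph V).
Hypotheses (infV : infinite_set [set: V]) (cG : connected_graph G)
  (bG : bounded_degree G) (tG : vertex_transitive G).
Implicit Types (p M : R).

Let fin x : finite_set (nbhd G x). Proof. exact: nbhd_finite. Qed.

Lemma vertex_transitive_degree x y : degree G x = degree G y.
Proof. by have [f af <-] := tG x y; rewrite (degree_aut fin af). Qed.

(** An automorphism that sends [x] to [o] carries windows along, so the expectation at the single
    vertex [o] bounds windows with any root. *)
Lemma chi_bound_of_expected p M o : 0 <= p <= 1 ->
  (expected_cluster_size G p o <= M%:E)%E -> chi_bound (G := G) p M.
Proof.
move=> p01 EM l U x ul uU; have [phi [[psi phiK psiK] aphi] phix] := tG x o.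
have inj := can_inj (edge_imageK phiK psiK aphi).
have := csize_le_expected cG bG p01 (l := map (edge_image aphi) l) (U := map phi U) EM.
rewrite !map_inj_uniq //; last exact: can_inj phiK.
move=> /(_ ul uU); rewrite (bern_push phiK psiK) -phix.
by under eq_bern do rewrite (csize_push phiK psiK).
Qed.

Lemma expected_of_chi_bound p M o : 0 <= p <= 1 -> chi_bound (G := G) p M ->
  (expected_cluster_size G p o <= M%:E)%E.
Proof.
move=> p01 chiM; apply: expected_le => // n.
by apply: chiM; rewrite ?edges_at_uniq ?fset_uniq.
Qed.

Lemma expected_ge0 p o : (0 <= expected_cluster_size G p o :> \bar R)%E.
Proof. by apply: integral_ge0 => w _; exact: counting_ge0. Qed.

Lemma chi_bound_finite p o : 0 <= p <= 1 -> expected_cluster_size G p o <> +oo%E ->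
  exists M, chi_bound (G := G) p M.
Proof.
move=> p01 Efin; exists (fine (expected_cluster_size G p o)).
apply: (@chi_bound_of_expected p _ o) => //; rewrite fineK //.
by rewrite ge0_fin_numE ?expected_ge0 // ltey; apply/eqP.
Qed.

Let pT_set o := [set p : R | 0 <= p <= 1 /\ expected_cluster_size G p o = +oo%E].

Lemma pT_lbound o : has_lbound (pT_set o).
Proof. by exists 0 => p [/andP[]]. Qed.

Lemma below_pT p o : 0 <= p < p_T G o ->
  p < 1 /\ exists M, chi_bound (G := G) p M.
Proof.
move=> /andP[p0 ppT].
have [q [/andP[q0 q1] Eq]] : exists q, pT_set o q.
  apply: contrapT => noq; move: ppT; rewrite /p_T -/(pT_set o).
  (* The infimum of the empty set is 0 here, which is not above [p]. *)
  suff -> : pT_set o = set0 by rewrite inf0 ltNge p0.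
  by apply/seteqP; split => // q Sq; apply: noq; exists q.
have p1 : p < 1.
  apply: lt_le_trans ppT (le_trans _ q1); apply: ge_inf; first exact: pT_lbound.
  by split => //; rewrite q0.
split => //; apply: (@chi_bound_finite p o); first by rewrite p0 ltW.
move=> Ep; move: ppT; apply/negP; rewrite -leNgt; apply: ge_inf; first exact: pT_lbound.
by split => //; rewrite p0 ltW.
Qed.

End critical_point.

(** * Expansion of [c_p] over cluster shapes *)

Section analyticity.
Context {R : realType} {V : choiceType} (G : sgraph V).
Hypotheses (infV : infinite_set [set: V]) (cG : connected_graph G)
  (bG : bounded_degree G).
Implicit Types (A B : {fset V}) (o x y : V).

Let fin x : finite_set (nbhd G x). Proof. exact: nbhd_finite. Qed.

Lemma measurable_connection o y :
  measurable [set w : configurations G | cluster w o y].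
Proof.
rewrite (_ : [set _ | _] = \bigcup_n [set w : configurations G |
    cluster (restr (edges_at G (ball G n o)) w) o y]).
  by apply: bigcupT_measurable => n; exact: (measurable_restr _ (fun w => cluster w o y)).
apply/seteqP; split => w /=.
  by move=> /(cluster_window bG)[n [oy _]]; exists n.
by case=> n _; apply: cluster_mono; exact: subconfig_restr.
Qed.

Lemma measurable_esc o :
  measurable_fun setT (fun w : configurations G => esc G (cluster w o) o : R).
Proof.
apply: (measurable_fun_cvg (h := fun N (w : configurations G) =>
  avoid G (cluster w o) N o)); last first.
  by move=> w _; exact: cvg_avoid.
move=> N; rewrite -[X in measurable_fun _ X]/(fun w : configurations G =>
  avoid G (cluster w o) N o); move: {2}o.
elim: N => [|N IHN] x; first exact: measurable_cst.
have -> : (fun w : configurations G => avoid G (cluster w o) N.+1 x : R) = (fun w =>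
    (degree G x)%:R^-1 * \sum_(y <- nbs G x)
      (if y \in cluster w o then 0 else avoid G (cluster w o) N y)) by [].
apply: measurable_funM; first exact: measurable_cst.
apply: measurable_sum => y.
have mconn : measurable_fun setT (fun w : configurations G => y \in cluster w o).
  apply: (@measurable_fun_bool _ _ _ _ true).
  rewrite setTI (_ : _ @^-1` _ = [set w | cluster w o y]); first exact: measurable_connection.
  by apply/seteqP; split => w /=; [exact: set_mem|exact: mem_set].
exact: (measurable_fun_ifT mconn (@measurable_cst _ _ _ R setT 0) (IHN y)).
Qed.

Lemma measurable_escape_size o : measurable_fun setT (fun w : configurations G =>
  (counting (cluster w o) * escape_probability G (cluster w o) o)%E : \bar R).
Proof.
apply: emeasurable_funM; first exact: measurable_counting.
have -> : (fun w : configurations G => escape_probability G (cluster w o) o) =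
    (fun w => (esc G (cluster w o) o : R)%:E).
  by apply/funext => w; rewrite escape_probabilityE.
by apply/measurable_EFinP; exact: measurable_esc.
Qed.

Definition escape_size o A : R := (#|` A|)%:R * esc G [set` A] o.

Lemma escape_size_ge0 o A : 0 <= escape_size o A.
Proof. by rewrite mulr_ge0 // esc_ge0. Qed.

Lemma c_ereal_shapes o (p : R) : 0 <= p <= 1 -> (expected_cluster_size G p o < +oo)%E ->
  c_ereal G o p = \esum_(A in [set: {fset V}]) (escape_size o A * shape_prob G p o A)%:E.
Proof.
move=> p01 Efin.
have [ms <-] := shape_fun_integral cG bG p01 o (escape_size_ge0 o).
rewrite /c_ereal; apply: ge0_ae_eq_integral => //.
- exact: measurable_escape_size.
- by move=> w _; rewrite mule_ge0 // counting_ge0.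
- move=> w _; rewrite /shape_fun; case: asboolP => // _.
  by rewrite lee_fin escape_size_ge0.
- have := infinite_cluster_null bG Efin; apply: filterS => w fC _.
  rewrite escape_probabilityE // /counting /shape_fun asboolT // -EFinM.
  by rewrite /escape_size fset_setK.
Qed.

Lemma c_ereal_fin o (p : R) : (expected_cluster_size G p o < +oo)%E ->
  c_ereal G o p \is a fin_num.
Proof.
move=> Efin; have m0 : (0 <= c_ereal G o p)%E.
  by apply: integral_ge0 => w _; rewrite mule_ge0 // counting_ge0.
rewrite ge0_fin_numE //; apply: le_lt_trans Efin; apply: ge0_le_integral => //.
- by move=> w _; rewrite mule_ge0 // counting_ge0.
- exact: measurable_escape_size.
- exact: measurable_counting.
- move=> w _; rewrite -[leRHS]mule1 lee_wpmul2l ?counting_ge0 //.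
  by rewrite escape_probabilityE // lee_fin esc_le1.
Qed.

Lemma shape_prob_window (p : R) o A (l : seq (edge G)) : uniq l ->
  {subset edges_at G A <= l} ->
  shape_prob G p o A = bern p (1 - p) l (fun w => `[< cluster w o = [set` A] >]%:R).
Proof.
move=> ul Al; transitivity (bern p (1 - p) (seq.filter (mem (edges_at G A)) l)
    (fun w => `[< cluster w o = [set` A] >]%:R)).
  apply: bern_perm; first exact: edges_at_uniq.
  apply: uniq_perm; rewrite ?edges_at_uniq ?filter_uniq // => e.
  by rewrite mem_filter /=; case: (boolP (e \in edges_at G A)) => // /Al ->.
apply/esym/bern_filter => [|w]; first by rewrite addrC subrK.
congr (nat_of_bool _)%:R; apply/asboolP/asboolP => h.
  exact/(cluster_eqP bG w o A).1.
exact/(cluster_eqP bG w o A).2.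
Qed.

(** The first [K] shapes fit in a common ball, where they are disjoint events on each of which the
    window functional dominates [Phi]. The ball can always be enlarged, so positive radii
    suffice. *)
Lemma sum_shape_le (p : R) o (Phi : {fset V} -> R) (F : nat -> (edge G -> bool) -> R)
    (C : R) (dec : nat -> option {fset V}) c :
  0 <= p <= 1 -> (forall k A, dec k = Some A -> c A = k) -> (forall n w, 0 <= F n w) ->
  (forall n w A, cluster w o = [set` A] -> (A `<=` ball G n o)%fset -> Phi A <= F n w) ->
  (forall n, (0 < n)%N -> bern p (1 - p) (edges_at G (ball G n o)) (F n) <= C) ->
  forall K, \sum_(k < K) (if dec k is Some A then Phi A * shape_prob G p o A else 0) <= C.
Proof.
move=> p01 cdec F0 PhiF bC K.
have [p0 q0] : 0 <= p /\ 0 <= 1 - p by case/andP: p01; rewrite subr_ge0.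
have [n nP] : exists n, forall k A, (k < K)%N -> dec k = Some A -> (A `<=` ball G n.+1 o)%fset.
  have /choice[m mP] k : exists m, forall A, dec k = Some A -> (A `<=` ball G m o)%fset.
    case: (dec k) => [A|]; last by exists 0%N.
    by have [m mA] := fset_in_ball cG bG o A; exists m => _ [<-].
  exists (\max_(k < K) m k) => k A kK /mP /fsubset_trans; apply; apply: sub_ball.
  by apply: leqW; rewrite (leq_bigmax (Ordinal kK)).
apply: le_trans (bC n.+1 isT); set l := edges_at _ _.
rewrite (eq_bigr (fun k : 'I_K => bern p (1 - p) l (fun w => if dec k is Some A then
    Phi A * `[< cluster w o = [set` A] >]%:R else 0))); last first.
  move=> k _; case dk: (dec k) => [A|]; last by rewrite bern0.
  rewrite bernZ (@shape_prob_window p o A l) ?edges_at_uniq //.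
  by apply: edges_at_sub => //; apply: nP dk.
rewrite -bern_sum; apply: bern_le => // w _.
have [[k0 [A [dk CA]]]|none] := pselect (exists (k0 : 'I_K) A,
    dec k0 = Some A /\ cluster w o = [set` A]).
  rewrite (bigD1 k0) //= dk asboolT // mulr1 big1 ?addr0; last first.
    move=> k kk0; case dk': (dec k) => [A'|] //; rewrite asboolF ?mulr0 // => CA'.
    case/eqP: kk0; apply: val_inj; rewrite /= -(cdec _ _ dk) -(cdec _ _ dk').
    by congr c; apply/fsetP => y; have := congr1 (fun X : set V => y \in X) CA';
      rewrite CA !mem_fset_set.
  exact: PhiF CA (nP _ _ (ltn_ord k0) dk).
rewrite big1 // => k _; case dk: (dec k) => [A|] //.
by rewrite asboolF ?mulr0 // => CA; apply: none; exists k, A.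
Qed.

Lemma card_le_csize n o (w : edge G -> bool) A : cluster w o = [set` A] -> (A `<=` ball G n o)%fset ->
  (#|` A| <= csize (ball G n o) w o)%N.
Proof.
move=> CA /fsubsetP An; rewrite /csize -size_filter; apply: uniq_leq_size => [|y yA].
  exact: fset_uniq.
rewrite mem_filter /= CA mem_fset_set; apply/andP; split => //.
exact: An.
Qed.

Hypothesis tG : vertex_transitive G.

Lemma expansion_radius (x p0 theta : R) (D : nat) : 0 <= x < p0 -> p0 < 1 -> 1 < theta ->
  exists eta r : R, [/\ 0 < eta, 0 < r, x + r <= p0, (1 + eta) ^+ D.+1 <= theta &
    1 - x + r <= (1 + eta) * (1 - x - r)].
Proof.
move=> /andP[x0 xp0] p01 theta1.
have D0 : 0 < D.+1%:R :> R by [].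
(* With this choice [expr_inv_bound] gives [(1 + eta) ^ (D + 1) <= 1 / (1 - (D + 1) eta) =
   theta]. *)
pose eta : R := (1 - theta^-1) / D.+1%:R.
have theta0 : 0 < theta by exact: lt_trans theta1.
have it0 : 0 < theta^-1 by rewrite invr_gt0.
have it1 : theta^-1 < 1 by rewrite invf_lt1.
have eta0 : 0 < eta by rewrite divr_gt0 // subr_gt0.
have eta1 : eta <= 1.
  rewrite ler_pdivrMr // mul1r (@le_trans _ _ 1) ?ler1n //; lra.
(* The last inequality amounts to [(2 + eta) r <= eta (1 - x)]; as [eta <= 1] and [x < p0], the
   divisor 3 is enough. *)
pose r := Num.min (p0 - x) (eta * (1 - p0) / 3).
have r0 : 0 < r by rewrite lt_min subr_gt0 xp0 /= divr_gt0 // mulr_gt0 // subr_gt0.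
have r1 : r <= p0 - x by rewrite ge_min lexx.
have r2 : r <= eta * (1 - p0) / 3 by rewrite ge_min lexx orbT.
exists eta, r; split => //; first by lra.
  have := @expr_inv_bound _ eta D.+1 (ltW eta0).
  rewrite (_ : 1 - _ = theta^-1); last first.
    by rewrite /eta mulrC divfK ?subKr // gt_eqF.
  by rewrite ler_pdivrMr ?mul1r.
have : eta * x <= eta * p0 by rewrite ler_pM2l // ltW.
have : eta * r <= r by rewrite -[leRHS]mul1r ler_wpM2r // ltW.
lra.
Qed.

(** The remainder at every order serves twice: [n] growing gives the power series, [n = 2] the
    derivative. Summability is paid for by an exponential moment at [p0], strictly between [x] and
    [p_T]. *)
Lemma c_taylor o (x : R) : 0 <= x < p_T G o ->
  exists (a : nat -> R) (r M : R), 0 < r /\ forall (y : R) n, 0 <= y < p_T G o -> `|y - x| < r ->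
    `|c_ G o y - \sum_(j < n) a j * (y - x) ^+ j| <= (`|y - x| / r) ^+ n * M.
Proof.
move=> /andP[x0 xT]; have [D deg] := bG.
have {}deg y : (degree G y <= D)%N by case: (deg y).
pose p0 := (x + p_T G o) / 2.
have xp0 : x < p0 by rewrite /p0; lra.
have p0T : 0 <= p0 < p_T G o by apply/andP; split; rewrite /p0; lra.
have [p01 [M0 chi0]] := below_pT cG bG tG p0T.
have p0I : 0 <= p0 <= 1 by apply/andP; split; lra.
have [delta delta0 [theta [C [theta1 bC]]]] := subcritical_neighborhood fin deg p0I chi0.
have {}bC := bC p0 p0I; rewrite subrr normr0 in bC; have {}bC := bC (ltW delta0).
have [eta [r [eta0 r0 xr eta_theta rho]]] : exists eta r : R, [/\ 0 < eta, 0 < r, x + r <= p0,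
    (1 + eta) ^+ D.+1 <= theta & 1 - x + r <= (1 + eta) * (1 - x - r)].
  by apply: expansion_radius => //; rewrite x0.
have [c cinj] := fset_code (connected_countable cG bG).
have [dec [decK cdec]] := code_inv cinj.
(* For [s = -1] this is the probability of the shape expanded around [x]; for [s = 1] all
   coefficients are nonnegative and dominate those of [s = -1]. *)
pose poly_at (s : R) A : {poly R} := bern (x%:P + 'X) ((1 - x)%:P + s *: 'X) (edges_at G A)
  (fun w => `[< cluster w o = [set` A] >]%:R).
pose T k := if dec k is Some A then escape_size o A *: poly_at (-1) A else 0.
pose S k := if dec k is Some A then escape_size o A *: poly_at 1 A else 0.
have hornerE' s A h : (poly_at s A).[h] = bern (x + h) (1 - x + s * h) (edges_at G A)
    (fun w => `[< cluster w o = [set` A] >]%:R).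
  rewrite /poly_at horner_bern !hornerD !hornerC hornerZ hornerX.
  by apply: eq_bern => w; case: asbool; rewrite ?hornerC.
have ST k : majorizes (S k) (T k).
  rewrite /S /T; case: (dec k) => [A|]; last by move=> j; rewrite coef0 normr0.
  apply: majorizesZ; first exact: escape_size_ge0.
  apply: majorizes_bern => j; rewrite !coefD !coefC ?coefZ !coefX.
    by case: eqP => _; case: eqP => _; rewrite ?ger0_norm ?addr0 ?add0r ?addr_ge0.
  have x1 : 0 <= 1 - x by lra.
  case: j => [|[|j]] /=; rewrite ?mulr0 ?addr0 ?add0r ?mulr1 ?normrN ?normr0 ?normr1 //.
  by rewrite ger0_norm.
have sumS K : \sum_(k < K) (S k).[r] <= eta^-1 * C.
  have xrI : 0 <= x + r <= 1 by apply/andP; split; lra.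
  have bCr n : bern (x + r) (1 - (x + r)) (edges_at G (ball G n o))
     (fun w => theta ^+ csize (ball G n o) w o) <= C.
    apply: le_trans (bC _ (ball G n o) o (edges_at_uniq _ _) (fset_uniq _)).
    apply: bern_mono_p => //; first by rewrite xr ltW.
    move=> w w' ww'; rewrite ler_weXn2l ?csize_mono // ltW //.
  have theta0 : 0 <= theta by lra.
  have := sum_shape_le (Phi := fun A => theta ^+ #|` A|) xrI cdec
    (fun n w => exprn_ge0 _ theta0) _ (fun n _ => bCr n) K.
  move=> /(_ (fun n w A CA An => ler_weXn2l (ltW theta1) (card_le_csize CA An))).
  move=> /(ler_wpM2l (x := eta^-1)) -/(_ _)/(le_trans _); apply; last by rewrite invr_ge0 ltW.
  rewrite mulr_sumr; apply: ler_sum => k _; rewrite /S.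
  case: (dec k) => [A|]; last by rewrite horner0 mulr0.
  rewrite hornerZ hornerE' mul1r.
  have q1 : 0 <= shape_prob G (x + r) o A by exact: shape_prob_ge0.
  have e1 : 1 <= 1 + eta by lra.
  (* These weights do not add up to 1, but they are at most [1 + eta] times those of the parameter
     [x + r], and the shape involves at most [D |A|] edges. *)
  have step : bern (x + r) (1 - x + r) (edges_at G A)
        (fun w => `[< cluster w o = [set` A] >]%:R) <=
      (1 + eta) ^+ (D * #|` A|) * shape_prob G (x + r) o A.
    apply: (@le_trans _ _ (bern ((1 + eta) * (x + r)) ((1 + eta) * (1 - (x + r)))
        (edges_at G A) (fun w => `[< cluster w o = [set` A] >]%:R))).
      apply: bern_le_weights => //.
        by apply/andP; split; first lra; rewrite -[leLHS]mul1r ler_wpM2r //; lra.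
      by apply/andP; split; [lra|rewrite opprD addrA].
    rewrite bern_scale ler_wpM2r // ler_weXn2l //; exact: size_edges_at.
  (* [eta n <= (1 + eta) ^ n] absorbs the factor [|A|] at the price of one more power per vertex,
     whence the exponent [D + 1]. *)
  have nb : (#|` A|)%:R <= eta^-1 * (1 + eta) ^+ #|` A|.
    rewrite mulrC ler_pdivlMr //.
    elim: (#|` A|) => [|n IHn]; first by rewrite mul0r expr0.
    have en : 1 <= (1 + eta) ^+ n by rewrite exprn_ege1.
    by rewrite -natr1 exprS; nra.
  apply: (@le_trans _ _ ((#|` A|)%:R * ((1 + eta) ^+ (D * #|` A|) * shape_prob G (x + r) o A))).
    apply: ler_pM => //; first exact: escape_size_ge0.
      by apply: bern_ge0 => //; lra.
    by rewrite /escape_size -[leRHS]mulr1 ler_wpM2l // esc_le1.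
  apply: (@le_trans _ _ (eta^-1 * (1 + eta) ^+ #|` A| *
      ((1 + eta) ^+ (D * #|` A|) * shape_prob G (x + r) o A))).
    by rewrite ler_wpM2r // mulr_ge0 // exprn_ge0 // (le_trans _ e1).
  rewrite -!mulrA ler_wpM2l ?invr_ge0 ?(ltW eta0) // mulrA ler_wpM2r //.
  rewrite -exprD -mulSn exprM lerXn2r // nnegrE ?exprn_ge0 //; lra.
have Tc h : `[0, p_T G o[%classic (x + h) -> `|h| < r ->
    \sum_(k < K) (T k).[h] @[K --> \oo] --> c_ G o (x + h).
  rewrite /= in_itv /= => xhT hr; have [xh1 [Mh chih]] := below_pT cG bG tG xhT.
  have xhI : 0 <= x + h <= 1 by case/andP: xhT => -> _; rewrite ltW.
  have Ecl : (expected_cluster_size G (x + h) o < +oo)%E.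
    by rewrite (le_lt_trans (expected_of_chi_bound cG bG o xhI chih)) // ltry.
  have tE k : (if dec k is Some A then
      (escape_size o A * shape_prob G (x + h) o A)%:E else 0%E) = ((T k).[h])%:E.
    rewrite /T; case: (dec k) => [A|]; last by rewrite horner0.
    by rewrite hornerZ hornerE' mulN1r /shape_prob opprD addrA.
  have T0 k : 0 <= (T k).[h].
    rewrite -lee_fin -tE; case: (dec k) => // A; rewrite lee_fin mulr_ge0 ?escape_size_ge0 //.
    exact: shape_prob_ge0.
  have cE : c_ereal G o (x + h) = (\sum_(k <oo) ((T k).[h])%:E)%E.
    rewrite c_ereal_shapes // (esum_decode decK cdec).
      by apply: eq_eseriesr => k _; exact: tE.
    by move=> A; rewrite lee_fin mulr_ge0 ?escape_size_ge0 ?shape_prob_ge0.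
  have cfin : c_ereal G o (x + h) \is a fin_num by exact: c_ereal_fin.
  have cv : (\sum_(0 <= k < K) ((T k).[h])%:E)%E @[K --> \oo] --> (c_ G o (x + h))%:E.
    have h1 : cvgn (fun K => \sum_(0 <= k < K) ((T k).[h])%:E)%E.
      by apply: is_cvg_nneseries => k _ _; rewrite lee_fin.
    by rewrite /c_ fineK // cE.
  have -> : (fun K => \sum_(k < K) (T k).[h]) =
      fine \o (fun K => \sum_(0 <= k < K) ((T k).[h])%:E)%E.
    by apply/funext => K; rewrite /= sumEFin /= big_mkord.
  exact: fine_cvg cv.
have [a aP] := power_series_of_majorants (D := [set h | `[0, p_T G o[%classic (x + h)])
  (f := fun h => c_ G o (x + h)) r0 ST sumS Tc.
exists a, r, (eta^-1 * C); split => // y n yT yr.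
have := aP (y - x) n; rewrite /= addrCA subrr addr0 in_itv /=; exact.
Qed.

End analyticity.

(** * Mass transport and the derivative *)

Section shape_sums.
Context {R : realType} {V : choiceType} (G : sgraph V).
Hypotheses (cG : connected_graph G) (bG : bounded_degree G).
Variables (p : R) (o : V) (Phi : {fset V} -> R).
Hypotheses (p01 : 0 <= p <= 1) (Phi0 : forall A, 0 <= Phi A).

Let term0 A : (0 <= (Phi A * shape_prob G p o A)%:E)%E.
Proof. by rewrite lee_fin mulr_ge0 // shape_prob_ge0. Qed.

Lemma esum_shape_le (F : nat -> (edge G -> bool) -> R) (C : R) :
  (forall n w, 0 <= F n w) ->
  (forall n w A, cluster w o = [set` A] -> (A `<=` ball G n o)%fset -> Phi A <= F n w) ->
  (forall n, (0 < n)%N -> bern p (1 - p) (edges_at G (ball G n o)) (F n) <= C) ->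
  (\esum_(A in [set: {fset V}]) (Phi A * shape_prob G p o A)%:E <= C%:E)%E.
Proof.
move=> F0 PhiF bC; have [c cinj] := fset_code (connected_countable cG bG).
have [dec [decK cdec]] := code_inv cinj.
rewrite (esum_decode decK cdec) //; apply: lime_le.
  by apply: is_cvg_nneseries => k _ _; case: (dec k).
apply: nearW => K; rewrite big_mkord.
rewrite (eq_bigr (fun k : 'I_K =>
  (if dec k is Some A then Phi A * shape_prob G p o A else 0)%:E)); last first.
  by move=> k _; case: (dec k).
by rewrite sumEFin lee_fin; apply: (sum_shape_le cG bG p01 cdec F0 PhiF bC).
Qed.

Lemma bern_le_esum_shape (l : seq (edge G)) (F : (edge G -> bool) -> R) :
  (expected_cluster_size G p o < +oo)%E -> uniq l -> (forall w, 0 <= F w) ->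
  (forall w A, cluster w o = [set` A] -> F (restr l w) <= Phi A) ->
  ((bern p (1 - p) l F)%:E <= \esum_(A in [set: {fset V}]) (Phi A * shape_prob G p o A)%:E)%E.
Proof.
move=> Efin ul F0 FPhi; have [ms <-] := shape_fun_integral cG bG p01 o Phi0.
rewrite -integral_restr //; apply: ae_ge0_le_integral => //.
- by move=> w _; rewrite lee_fin.
- exact: (measurable_fun_restr l F measurableT).
- by move=> w _; rewrite /shape_fun; case: asboolP => // _; rewrite lee_fin.
- have := infinite_cluster_null bG Efin; apply: filterS => w fC _.
  by rewrite /shape_fun asboolT // lee_fin; apply: FPhi; rewrite fset_setK.
Qed.

End shape_sums.

(** * Graphs on which a group acts by left translations; mass transport *)

Section group_graph.
Context {R : realType} {V : choiceType} (G : sgraph V).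
Hypotheses (infV : infinite_set [set: V]) (cG : connected_graph G)
  (bG : bounded_degree G).
Variables (o : V) (op : V -> V -> V) (inv : V -> V).
Hypotheses (opA : associative op) (opo : left_id o op) (opV : left_inverse o inv op)
  (op_adj : forall x y z, adj G (op x y) (op x z) = adj G y z).
Implicit Types (A B : {fset V}) (x y : V) (p : R).

Let fin x : finite_set (nbhd G x). Proof. exact: nbhd_finite. Qed.

Lemma opVK x : cancel (op x) (op (inv x)).
Proof. by move=> y; rewrite opA opV opo. Qed.

Lemma op_right_inv x : op x (inv x) = o.
Proof. by rewrite -[LHS]opo -{1}(opV (inv x)) -opA (opVK x) opV. Qed.

Lemma opKV x : cancel (op (inv x)) (op x).
Proof. by move=> y; rewrite opA op_right_inv opo. Qed.

Lemma op_right_id x : op x o = x.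
Proof. by rewrite -(opV x) opKV. Qed.

Lemma op_invK x : inv (inv x) = x.
Proof. by rewrite -[LHS]op_right_id -(opV x) opVK. Qed.

Lemma op_automorphism x : graph_automorphism G (op x).
Proof.
split; last exact: op_adj.
by exists (op (inv x)); [exact: opVK|exact: opKV].
Qed.

Lemma group_vertex_transitive : vertex_transitive G.
Proof.
move=> x y; exists (op (op y (inv x))); first exact: op_automorphism.
by rewrite -opA opV op_right_id.
Qed.

Let tau x A : {fset V} := [fset op x y | y in A]%fset.

Let mem_tau x y A : (op x y \in tau x A) = (y \in A).
Proof.
by apply/imfsetP/idP => [[z /= zA /(can_inj (opVK x)) ->]|yA] //; exists y.
Qed.

Lemma esum_fsetE A (f : V -> R) : (forall x, 0 <= f x) ->
  (\esum_(x in [set` A]) (f x)%:E = (\sum_(x <- A) f x)%:E)%E.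
Proof.
move=> f0; rewrite esum_fset; [|exact: finite_fset|by move=> x _; rewrite lee_fin].
by rewrite fsbig_finite ?finite_fset //= set_fsetK sumEFin.
Qed.

(* Mass transport: the involution [(A, x) |-> (x^-1 A, x^-1)] exchanges the
   base point of the escape probability with the one of the cluster. *)
Lemma mass_transport p : 0 <= p <= 1 ->
  \esum_(A in [set: {fset V}]) (escape_size G o A * shape_prob G p o A)%:E =
  \esum_(A in [set: {fset V}]) (cap G A * shape_prob G p o A)%:E.
Proof.
move=> p01.
pose I := [set A : {fset V} | o \in A].
pose a A x : R := esc G [set` A] x * shape_prob G p o A.
pose b A (x : V) : R := esc G [set` A] o * shape_prob G p o A.
have sp0 A : 0 <= shape_prob G p o A by exact: shape_prob_ge0.
have a0 A x : 0 <= a A x by rewrite mulr_ge0 // esc_ge0.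
have b0 A x : 0 <= b A x by rewrite mulr_ge0 // esc_ge0.
have toI (f : {fset V} -> R) :
    \esum_(A in [set: {fset V}]) (f A * shape_prob G p o A)%:E =
    \esum_(A in I) (f A * shape_prob G p o A)%:E.
  rewrite [RHS]esum_mkcond; apply: eq_esum => A _; case: ifPn => //.
  rewrite notin_setE /I /= => oA.
  suff -> : shape_prob G p o A = 0 by rewrite mulr0.
  rewrite -[RHS](bern0 p (1 - p) (edges_at G A)); apply: eq_bern => w; rewrite asboolF // => CA; apply: oA.
  by have := @cluster_refl _ _ w o; rewrite CA.
pose P := I `*`` (fun A => [set` A]).
have -> : \esum_(A in [set: {fset V}]) (cap G A * shape_prob G p o A)%:E =
    \esum_(k in P) (a k.1 k.2)%:E.
  rewrite -(esum_esum (a := fun A x => (a A x)%:E)); last by move=> A x _ _; rewrite lee_fin.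
  rewrite toI; apply: eq_esum => A _; rewrite esum_fsetE //.
  by rewrite /cap mulr_suml.
have -> : \esum_(A in [set: {fset V}]) (escape_size G o A * shape_prob G p o A)%:E =
    \esum_(k in P) (b k.1 k.2)%:E.
  rewrite -(esum_esum (a := fun A x => (b A x)%:E)); last by move=> A x _ _; rewrite lee_fin.
  rewrite toI; apply: eq_esum => A _; rewrite esum_fsetE // /b.
  rewrite big_const_seq count_predT iter_addr_0 /escape_size -mulrA.
  by rewrite mulr_natl.
pose phi (k : {fset V} * V) := (tau (inv k.2) k.1, inv k.2).
have tauV x A : tau (inv (inv x)) (tau (inv x) A) = A.
  by apply/fsetP => y; rewrite op_invK -[y in LHS](opKV x) !mem_tau.
have phiK : involutive phi by move=> [A x]; rewrite /phi /= tauV op_invK.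
have phiP k : P k -> P (phi k).
  case: k => A x [/= oA xA]; split; rewrite /phi /=.
    by rewrite /I /= -(opV x) mem_tau.
  by rewrite -{1}[inv x]op_right_id mem_tau.
have bij : set_bij P P phi.
  split; [by move=> k; exact: phiP|by move=> k k' _ _; exact: (can_inj phiK)|].
  by move=> k Pk; exists (phi k); [exact: phiP|exact: phiK].
rewrite [RHS](reindex_esum _ _ _ _ bij); apply: eq_esum => -[A x] [/= oA xA].
congr EFin; rewrite /a /b /phi /=; congr (_ * _).
  transitivity (esc G [set` tau (inv x) A] (op (inv x) o) : R); last by rewrite op_right_id.
  apply/esym/(esc_aut fin (op_automorphism _)) => y.
  by rewrite !mem_fset_set mem_tau.
(* Translating back yields the event that the cluster of [x] is [A]. As [o] and [x] both lie in [A],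
   this is the event that the cluster of [o] is [A]. *)
transitivity (shape_prob G p (op (inv x) x) (tau (inv x) A)); last by rewrite opV.
rewrite (shape_prob_image (opVK (inv x)) (opKV (inv x)) (op_adj (inv x)) fin).
apply: eq_bern => w; congr (nat_of_bool _)%:R; apply/asboolP/asboolP => CA.
  by rewrite -CA; apply/esym/eq_cluster; rewrite CA.
by rewrite -CA; apply/esym/eq_cluster; rewrite CA.
Qed.

End group_graph.

Lemma bern_all_closed (T : eqType) (R : realFieldType) (p : R) (l : seq T)
    (F : (T -> bool) -> R) : 0 <= p <= 1 -> (forall w, 0 <= F w) ->
  (1 - p) ^+ size l * F (fun=> false) <= bern p (1 - p) l F.
Proof.
move=> /andP[p0 p1] F0; have q0 : 0 <= 1 - p by rewrite subr_ge0.
elim: l F F0 => [|e l IHl] F F0 /=; first by rewrite mul1r.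
rewrite exprS -mulrA -[leLHS]add0r lerD //; last by rewrite ler_wpM2l // IHl.
by rewrite mulr_ge0 // bern_ge0.
Qed.

Section derivative.
Context {R : realType}.

(** The quadratic bound makes [a] the derivative, and linear growth to the right of [x] forces
    [kappa <= a]; the sign needs no formula for [a]. *)
Lemma derive_of_taylor (f : R -> R) (x a r M kappa : R) : 0 < r -> 0 < kappa ->
  (forall y, `|y - x| < r -> `|f y - f x - a * (y - x)| <= (`|y - x| / r) ^+ 2 * M) ->
  (forall y, x <= y < x + r -> kappa * (y - x) <= f y - f x) ->
  derivable f x 1 /\ 0 < derive1 f x.
Proof.
move=> r0 k0 tay grow.
have M0 : 0 <= M.
  have := le_trans (normr_ge0 _) (tay (x + r / 2) _).
  rewrite addrAC subrr add0r gtr0_norm ?divr_gt0 // => /(_ _).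
  rewrite pmulr_rge0; first by apply; rewrite ltr_pdivrMr // ltr_pMr // ltr1n.
  by rewrite exprn_gt0 // !divr_gt0.
have bound h : h != 0 -> `|h| < r ->
    `|h^-1 *: (f (h *: 1 + x) - f x) - a| <= `|h| * (M / r ^+ 2).
  move=> h0 hr; have := tay (h + x); rewrite addrK => /(_ hr) t.
  have n0 : 0 < `|h| by rewrite normr_gt0.
  have -> : h^-1 *: (f (h *: 1 + x) - f x) - a = h^-1 * (f (h + x) - f x - a * h).
    have -> : h *: (1 : R) = h by rewrite /GRing.scale /= mulr1.
    by rewrite mulrBr [in RHS]mulrCA mulVf // mulr1.
  rewrite normrM normfV mulrC ler_pdivrMr // (le_trans t) //.
  by rewrite le_eqVlt; apply/orP; left; apply/eqP; field; rewrite gt_eqF.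
have lim : h^-1 *: (f (h *: 1 + x) - f x) @[h --> 0^'] --> a.
  apply/cvgrPdist_le => e e0.
  pose d := Num.min r (e / (M / r ^+ 2 + 1)).
  have C0 : 0 <= M / r ^+ 2 by rewrite divr_ge0 // exprn_ge0 // ltW.
  have d0 : 0 < d by rewrite lt_min r0 divr_gt0 // ltr_wpDl.
  near=> h; have h0 : h != 0 by near: h; exact: nbhs_dnbhs_neq.
  have hd : `|h| < d.
    near: h; apply: dnbhs0_lt => //.
  rewrite distrC (le_trans (bound h h0 _)) //.
    by rewrite (lt_le_trans hd) // ge_min lexx.
  apply: (@le_trans _ _ (e / (M / r ^+ 2 + 1) * (M / r ^+ 2))).
    by rewrite ler_wpM2r // (le_trans (ltW hd)) // ge_min lexx orbT.
  by rewrite mulrAC ler_pdivrMr ?ltr_wpDl // mulrDr mulr1 lerDl ltW.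
have der : derivable f x 1 by apply: cvgP lim.
split => //; rewrite derive1E /derive (cvg_lim _ lim) //.
suff ka : kappa <= a by exact: lt_le_trans ka.
rewrite leNgt; apply/negP => ak.
pose C := M / r ^+ 2 + 1; have C0 : 0 < C.
  by rewrite /C ltr_wpDl // divr_ge0 // exprn_ge0 // ltW.
(* At this [h] the difference quotient is at least [kappa], yet within [(kappa - a) / 2] of [a]. *)
pose h := Num.min (r / 2) ((kappa - a) / (2 * C)).
have h0 : 0 < h by rewrite lt_min !divr_gt0 ?subr_gt0 // mulr_gt0.
have hr : h < r.
  by rewrite (@le_lt_trans _ _ (r / 2)) ?ge_min ?lexx // ltr_pdivrMr // ltr_pMr // ltr1n.
have hk : h * C <= (kappa - a) / 2.
  rewrite -ler_pdivlMr // (@le_trans _ _ ((kappa - a) / (2 * C))) ?ge_min ?lexx ?orbT //.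
  by rewrite invfM mulrA.
have := bound h (lt0r_neq0 h0); rewrite gtr0_norm // => /(_ hr) /ler_normlP[_].
have -> : h^-1 *: (f (h *: 1 + x) - f x) = h^-1 * (f (h + x) - f x).
  by have -> : h *: (1 : R) = h by rewrite /GRing.scale /= mulr1.
have := grow (h + x); rewrite addrK [h + x]addrC lerDl (ltW h0) ltrD2l hr => /(_ isT) g.
have g' : kappa <= h^-1 * (f (x + h) - f x) by rewrite mulrC ler_pdivlMr.
move: hk; rewrite /C mulrDr mulr1; lra.
Unshelve. all: by end_near.
Qed.

End derivative.

(** * Mean capacity of the cluster: growth in [p] and lower bound *)

Section capacity_growth.
Context {R : realType} {V : choiceType} (G : sgraph V).
Hypotheses (infV : infinite_set [set: V]) (cG : connected_graph G)
  (bG : bounded_degree G) (tG : vertex_transitive G).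
Variables (d : nat) (o : V).
Hypotheses (reg : forall x, degree G x = d)
  (green : forall x y : V, exists M : R, forall N, \sum_(n < N) kern G n x y <= M)
  (transport : forall p : R, 0 <= p <= 1 ->
    \esum_(A in [set: {fset V}]) (escape_size G o A * shape_prob G p o A)%:E =
    \esum_(A in [set: {fset V}]) (cap G A * shape_prob G p o A)%:E).
Implicit Types (A B : {fset V}) (p : R) (w : edge G -> bool).

Let fin x : finite_set (nbhd G x). Proof. exact: nbhd_finite. Qed.

(** [cap] takes finite sets; cutting the cluster at a ball keeps its capacity an increasing function
    of the configuration. *)
Definition visible n w : {fset V} := [fset y in ball G n o | y \in cluster w o]%fset.

Lemma in_visible n w y : (y \in visible n w) = (y \in ball G n o) && (y \in cluster w o).
Proof. by rewrite /visible !inE. Qed.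

Lemma cap_visible_increasing n : increasing (fun w => cap G (visible n w) : R).
Proof.
move=> w w' ww'; apply: (cap_mono infV cG bG reg green); apply/fsubsetP => y.
rewrite !in_visible => /andP[-> /set_mem yC]; rewrite mem_set //.
exact: cluster_mono yC.
Qed.

Let pT_I p : 0 <= p < p_T G o -> 0 <= p <= 1.
Proof.
by move=> pT; have [p1 _] := below_pT cG bG tG pT; case/andP: pT => -> _; rewrite ltW.
Qed.

Let pT_fin p : 0 <= p < p_T G o -> (expected_cluster_size G p o < +oo)%E.
Proof.
move=> pT; have [_ [M chiM]] := below_pT cG bG tG pT.
exact: le_lt_trans (expected_of_chi_bound cG bG o (pT_I pT) chiM) (ltry _).
Qed.

Lemma c_capE p : 0 <= p < p_T G o ->
  (c_ G o p)%:E = \esum_(A in [set: {fset V}]) (cap G A * shape_prob G p o A)%:E.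
Proof.
move=> pT; rewrite -transport ?pT_I // -c_ereal_shapes ?pT_I ?pT_fin //.
by rewrite /c_ fineK // c_ereal_fin // pT_fin.
Qed.

(** Closing the edges outside [l] and cutting at a ball both shrink the cluster, and [cap] is
    monotone. *)
Lemma c_cap_lower p n (l : seq (edge G)) : 0 <= p < p_T G o -> uniq l ->
  bern p (1 - p) l (fun w => cap G (visible n w)) <= c_ G o p.
Proof.
move=> pT ul; rewrite -lee_fin c_capE //.
apply: (bern_le_esum_shape cG bG (pT_I pT) (cap_ge0 infV cG bG) (pT_fin pT) ul).
  by move=> w; exact: cap_ge0.
move=> w A CA; apply: (cap_mono infV cG bG reg green); apply/fsubsetP => y.
rewrite in_visible => /andP[_ /set_mem yC].
suff : [set` A] y by [].
by rewrite -CA; apply: cluster_mono yC; exact: subconfig_restr.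
Qed.

Lemma c_cap_upper p (C : R) : 0 <= p < p_T G o ->
  (forall n, (0 < n)%N -> bern p (1 - p) (edges_at G (ball G n o))
     (fun w => cap G (visible n w)) <= C) ->
  c_ G o p <= C.
Proof.
move=> pT bC; rewrite -lee_fin c_capE //.
apply: (esum_shape_le cG bG (pT_I pT) (cap_ge0 infV cG bG)
  (F := fun n w => cap G (visible n w))) => //.
  by move=> n w; exact: cap_ge0.
move=> n w A CA /fsubsetP An; rewrite (_ : visible n w = A) //.
apply/fsetP => y; rewrite in_visible CA mem_fset_set andbC.
by case: (boolP (y \in A)) => // /An ->.
Qed.

(* When all the other edges at [o] and [y] are closed, opening [e0] changes the
   cluster of [o] from [{o}] to [{o, y}]. *)
Lemma c_growth p0 : 0 <= p0 < p_T G o ->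
  (0 < (esc G [set` [fset o]%fset] o : R)) ->
  exists2 kappa : R, 0 < kappa & forall p, p0 <= p < p_T G o ->
    kappa * (p - p0) <= c_ G o p - c_ G o p0.
Proof.
move=> p0T eo; have [y oy] := cap_strict infV cG bG reg green eo.
rewrite -subr_gt0; set delta := _ - _ => delta0.
have [p01 _] := below_pT cG bG tG p0T; have p0I := pT_I p0T.
have q0 : 0 < 1 - p0 by rewrite subr_gt0.
have [e0 e0E] := edge_of_adj oy.
set B := [fset o; y]%fset; pose E := edges_at G B.
exists (delta * (1 - p0) ^+ size E); first by rewrite mulr_gt0 // exprn_gt0.
move=> p /andP[p0p pT]; have pT' : 0 <= p < p_T G o.
  by rewrite pT andbT (le_trans _ p0p) //; case/andP: p0T.
have pI := pT_I pT'; have [_ p1] := andP pI.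
set kappa := delta * _.
(* The upper bound at [p0] and the lower bound at [p] are taken in the same window, which leaves a
   comparison of two finite expectations. *)
suff : c_ G o p0 <= c_ G o p - kappa * (p - p0) by lra.
apply: c_cap_upper => // n n0; set F := fun w => _.
have iF : increasing F by exact: cap_visible_increasing.
set l := edges_at _ _; have ul : uniq l by exact: edges_at_uniq.
apply: (@le_trans _ _ (bern p (1 - p) l F - kappa * (p - p0))); last first.
  by rewrite lerB // c_cap_lower.
have e0l : e0 \in l.
  by apply: (mem_edges_at fin (ball_center _ n o)); rewrite e0E !inE eqxx.
rewrite !(bern_rem _ _ _ ul e0l) /=; set l' := rem e0 l.
have ul' : uniq l' by exact: rem_uniq.
have iF' : increasing (fun w => F (upd e0 w)).
  by move=> w w' ww'; apply/iF/subconfig_upd.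
have h1 : bern p0 (1 - p0) l' F <= bern p (1 - p) l' F.
  by apply: bern_mono_p => //; rewrite p0p.
have h2 : bern p0 (1 - p0) l' (fun w => F (upd e0 w)) <=
    bern p (1 - p) l' (fun w => F (upd e0 w)).
  by apply: bern_mono_p => //; rewrite p0p.
have h3 : kappa + bern p0 (1 - p0) l' F <= bern p0 (1 - p0) l' (fun w => F (upd e0 w)).
  have [p00 q00] : 0 <= p0 /\ 0 <= 1 - p0 by case/andP: p0I; rewrite subr_ge0.
  pose none (w : edge G -> bool) := `[< forall e, e \in E -> ~~ w e >].
  apply: (@le_trans _ _ (bern p0 (1 - p0) l' (fun w => delta * (none w)%:R + F w))).
    rewrite bernD bernZ lerD2r ler_wpM2l ?(ltW delta0) //.
    have -> : bern p0 (1 - p0) l' (fun w => (none w)%:R) =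
        bern p0 (1 - p0) (seq.filter (mem E) l') (fun w => (none w)%:R).
      apply: bern_filter => [|w]; first by rewrite addrC subrK.
      congr (nat_of_bool _)%:R; apply/asboolP/asboolP => h e eE.
        by rewrite negb_and h ?orbT.
      by have := h e eE; rewrite /= eE.
    apply: le_trans (bern_all_closed _ _ _) => //.
    rewrite /none asboolT // mulr1 ler_wiXn2l //; first by lra.
    apply: uniq_leq_size; first by rewrite filter_uniq.
    by move=> e; rewrite mem_filter => /andP[].
  apply: bern_le => // w lw.
  have [nw|nw] := boolP (none w); last by rewrite mulr0 add0r iF //; exact: subconfig_updr.
  move/asboolP: nw => nw; rewrite mulr1 -lerBrDr.
  have y1 : y \in ball G n o.
    by case: (n) n0 => // m _; apply: (ballS fin _ oy); exact: ball_center.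
  have -> : F w = cap G [fset o]%fset.
    rewrite /F; congr cap; apply/fsetP => z; rewrite in_visible in_fset1.
    apply/idP/idP => [/andP[_ /set_mem zC]|/eqP ->]; last first.
      by rewrite ball_center mem_set //; exact: cluster_refl.
    apply/eqP; move: z zC; apply: (@cluster_ind _ _ _ _ (fun z => z = o)) => //.
    move=> u v _ -> /open_adjP[e [eov we]]; have := nw e; rewrite we.
    case/(_ _)/negP => //; apply: (mem_edges_at fin (x := o)); rewrite ?eov !inE eqxx //.
  rewrite lerBrDr /delta subrK; apply: (cap_mono infV cG bG reg green).
  apply/fsubsetP => z; rewrite in_visible in_fset2 => /orP[/eqP ->|/eqP ->].
    by rewrite ball_center mem_set //; exact: cluster_refl.
  rewrite y1 mem_set //; apply: cluster_step (@cluster_refl _ _ _ _) _.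
  by apply/open_adjP; exists e0; split => //; rewrite /upd eqxx.
have p00 : 0 <= p0 by case/andP: p0I.
move: h1 h2 h3.
set x := bern _ _ _ _; set x' := bern _ _ _ _.
set z := bern _ _ _ _; set z' := bern _ _ _ _ => h1 h2 h3.
have k0 : 0 <= kappa by rewrite mulr_ge0 ?exprn_ge0 // ltW.
(* The weight of [e0] grows by [p - p0], and opening it is worth at least [kappa] ([m3]); changing
   the parameter at the other edges can only help ([m1], [m2]). *)
have m1 : 0 <= p * (z' - z) by rewrite mulr_ge0 ?subr_ge0 // (le_trans p00).
have m2 : 0 <= (1 - p) * (x' - x) by rewrite mulr_ge0 ?subr_ge0.
have m3 : 0 <= (p - p0) * (z - x - kappa).
  by rewrite mulr_ge0 ?subr_ge0 //; lra.
lra.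
Qed.

Lemma c_derivative p : 0 < p < p_T G o -> (0 < (esc G [set` [fset o]%fset] o : R)) ->
  derivable (c_ G o : R -> R) p 1 /\ 0 < derive1 (c_ G o) p.
Proof.
move=> /andP[p0 pT] eo; have pT' : 0 <= p < p_T G o by rewrite ltW.
have [kappa k0 grow] := c_growth pT' eo.
have [a [r [M [r0 tay]]]] := c_taylor infV cG bG tG pT'.
(* The expansion is available within [[0, p_T)] only, so [r'] also keeps both sides of [p] in that
   interval. *)
pose r' := Num.min r (Num.min p (p_T G o - p)).
have r'0 : 0 < r' by rewrite !lt_min r0 p0 subr_gt0.
have r'r : r' <= r by rewrite ge_min lexx.
have r'p : r' <= p by rewrite !ge_min lexx orbT.
have r'T : r' <= p_T G o - p by rewrite !ge_min lexx !orbT.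
have a0 : a 0%N = c_ G o p.
  have := tay p 1%N pT'; rewrite subrr normr0 => /(_ r0).
  rewrite mul0r expr1 mul0r big_ord_recl big_ord0 expr0 mulr1 addr0 normr_le0 subr_eq0.
  by move/eqP.
have M0 : 0 <= M.
  by have := tay p 0%N pT'; rewrite subrr normr0 => /(_ r0); rewrite expr0 mul1r => /(le_trans (normr_ge0 _)).
apply: (@derive_of_taylor _ (c_ G o) p (a 1%N) r' M kappa) => // y.
  move=> yp; have yT : 0 <= y < p_T G o.
    by move: yp; rewrite ltr_norml => /andP[? ?]; apply/andP; split; lra.
  have := tay y 2%N yT (lt_le_trans yp r'r).
  rewrite !big_ord_recl big_ord0 /= expr0 expr1 mulr1 addr0 a0 opprD addrA => /le_trans; apply.
  rewrite ler_wpM2r // lerXn2r ?nnegrE ?divr_ge0 ?(ltW r0) ?(ltW r'0) //.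
  by rewrite ler_wpM2l // lef_pV2 ?posrE.
by move=> /andP[py yr]; apply: grow; rewrite py /=; lra.
Qed.

Lemma card_visible n (w : edge G -> bool) :
  #|` visible n w| = csize (ball G n o) w o.
Proof.
rewrite /csize -size_filter; apply/perm_size/uniq_perm.
- exact: fset_uniq.
- by rewrite filter_uniq // fset_uniq.
- by move=> y; rewrite mem_filter andbC -[LHS]/(y \in visible n w) in_visible.
Qed.

(* Since [E |C| = chi] and [E |C|^2 <= chi^3], the cluster behaves as if its
   size were at most of order [chi^2]. *)
Lemma c_lower_bound p chi (g0 a b : R) : 0 <= p < p_T G o -> 0 < chi ->
  expected_cluster_size G p o = chi%:E -> chi_bound (G := G) p chi ->
  0 <= g0 -> 0 <= a -> 0 < b ->
  (forall A, g0 * (#|` A|)%:R <= ((#|` A|)%:R * a + b) * cap G A) ->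
  g0 / 4 * chi / (2 * chi ^+ 2 * a + b) <= c_ G o p.
Proof.
move=> pT chi0 Echi chiM g00 a0 b0 capA.
have pI := pT_I pT.
have [n big] : exists n, 3 / 4 * chi < bern p (1 - p) (edges_at G (ball G n o))
    (fun w => (csize (ball G n o) w o)%:R).
  apply: contrapT => no; have : (expected_cluster_size G p o <= (3 / 4 * chi)%:E)%E.
    by apply: expected_le => // n; rewrite leNgt; apply/negP => h; apply: no; exists n.
  by rewrite Echi lee_fin; move: chi0; lra.
set l := edges_at _ _ in big.
have ul : uniq l by exact: edges_at_uniq.
apply: le_trans (c_cap_lower n pT ul).
set L := 2 * chi ^+ 2; have L0 : 0 < L by rewrite mulr_gt0 // exprn_gt0.
set D := L * a + b; have D0 : 0 < D by rewrite ltr_wpDl // mulr_ge0 // ltW.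
(* [m - m^2 / L] is nonpositive beyond [L] and at most [m] below, so it replaces a truncation at
   [L]. Its expectation is at least [3 chi / 4 - chi^3 / L = chi / 4]. *)
have capL (A : {fset V}) :
    g0 / D * ((#|` A|)%:R + - L^-1 * (#|` A|)%:R ^+ 2) <= cap G A.
  have c0 : 0 <= (cap G A : R) by exact: (cap_ge0 infV cG bG).
  set m : R := (#|` A|)%:R; have m0 : 0 <= m by [].
  have [mL|mL] := leP m L; last first.
    apply: le_trans c0; rewrite mulr_ge0_le0 ?divr_ge0 ?(ltW D0) //.
    rewrite mulNr subr_le0 [leRHS]mulrC ler_pdivlMr // expr2 ler_wpM2l // ltW //.
  apply: (@le_trans _ _ (g0 / D * m)).
    rewrite ler_wpM2l ?divr_ge0 ?(ltW D0) // gerDl mulNr oppr_le0.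
    by rewrite mulr_ge0 ?sqr_ge0 // invr_ge0 ltW.
  rewrite mulrAC ler_pdivrMr // (le_trans (capA A)) // -/m mulrC ler_wpM2l //.
  by rewrite /D lerD2r ler_wpM2r.
apply: (@le_trans _ _ (bern p (1 - p) l (fun w => g0 / D *
    ((csize (ball G n o) w o)%:R + - L^-1 * (csize (ball G n o) w o)%:R ^+ 2)))); last first.
  by have /andP[p0 p1] := pI; apply: bern_le; rewrite ?subr_ge0 // => w; rewrite -card_visible.
rewrite bernZ bernD bernZ.
have sm := second_moment pI o (ltW chi0) chiM ul (fset_uniq (ball G n o)).
rewrite (_ : g0 / 4 * chi / D = g0 / D * (chi / 4)); last first.
  by field; rewrite gt_eqF.
rewrite ler_wpM2l ?divr_ge0 ?(ltW D0) //.
have : L^-1 * bern p (1 - p) l (fun w => (csize (ball G n o) w o)%:R ^+ 2) <= chi / 2.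
  rewrite mulrC ler_pdivrMr // (le_trans sm) // /L le_eqVlt; apply/orP; left; apply/eqP.
  by field.
move: big; lra.
Qed.

End capacity_growth.

Lemma theorem_analytic (R : realType) (V : choiceType) (G : sgraph V) :
  infinite_set [set: V] -> connected_graph G -> vertex_transitive G ->
  bounded_degree G -> forall o : V, analytic_on `[0, p_T G o[ (c_ G o : R -> R).
Proof.
move=> infV cG tG bG o x; rewrite /= in_itv /= => xT.
have [a [r [M [r0 tay]]]] := c_taylor infV cG bG tG xT.
exists a, r; split => // y; rewrite /= in_itv /= => yT yr.
by apply: (series_of_taylor_bound r0 yr) => n; exact: tay.
Qed.

Lemma transient_esc (R : realType) (V : choiceType) (G : sgraph V) (o : V) :
  infinite_set [set: V] -> connected_graph G -> bounded_degree G -> transient R G ->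
  0 < (esc G [set` [fset o]%fset] o : R).
Proof.
move=> infV cG bG /(_ o); rewrite -[X in (_ < X)%E]/(escape_probability G [set o] o).
by rewrite escape_probabilityE // lte_fin set_fset1.
Qed.

(** * Cayley graphs based at an arbitrary vertex *)

Section cayley_graphs.
Context {gT : groupType}.
Variable S : {fset gT}.
Local Open Scope group_scope.
Local Notation G := (cayley_graph S).

Lemma cayley_connected : generates S -> connected_graph G.
Proof.
move=> genS x y; have [s [sS xy]] := genS (x^-1 * y).
have -> : y = x * \prod_(z <- s) z by rewrite -xy mulgA mulgV mul1g.
elim: s x sS {xy} => [|z s IHs] x sS; first by exists [::]; rewrite big_nil mulg1.
have [|p [xp lp]] := IHs (x * z); first by move=> u us; apply: sS; rewrite inE us orbT.
have [z1|z1] := eqVneq z 1.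
  by exists p; move: xp lp; rewrite big_cons z1 mulg1 mul1g.
exists (x * z :: p); rewrite /= xp lp big_cons mulgA; split => //; rewrite andbT.
rewrite /cayley_adj mulKg invgM -mulgA mulVg mulg1.
rewrite sS ?mem_head // andbT; apply: contraNneq z1 => xz.
by apply/eqP/(@mulgI _ x); rewrite mulg1 -xz.
Qed.

Lemma cayley_bounded_degree : bounded_degree G.
Proof.
exists (#|` S| + #|` S|)%N => x.
pose F := ([fset x * s | s in S] `|` [fset x * s^-1 | s in S])%fset.
have sub : nbhd G x `<=` [set` F].
  move=> y /= /andP[_ /orP[xyS|yxS]]; rewrite in_fsetU; apply/orP.
    by left; apply/imfsetP; exists (x^-1 * y); rewrite // mulgA mulgV mul1g.
  right; apply/imfsetP; exists (y^-1 * x); rewrite //= invgM invgK mulgA mulgV mul1g //.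
have fx : finite_set (nbhd G x) by apply: sub_finite_set sub (finite_fset F).
split => //; rewrite /degree; apply: (@leq_trans #|` F|).
  apply: fsubset_leq_card; apply/fsubsetP => y; rewrite in_fset_set // => /set_mem.
  exact: sub.
apply: (leq_trans (leq_addr #|` [fset (x * s)%g | s in S] `&` [fset (x * s^-1)%g | s in S]|%fset _)).
by rewrite cardfsUI leq_add // leq_imfset_card.
Qed.

Variable o : gT.

(** The group law transported so that [o] becomes its identity; left translations remain
    automorphisms of the graph. *)
Definition based_mul (x y : gT) := x * o^-1 * y.

Definition based_inv (x : gT) := o * x^-1 * o.

Lemma based_mulA : associative based_mul.
Proof. by move=> x y z; rewrite /based_mul !mulgA. Qed.

Lemma based_mul_id : left_id o based_mul.
Proof. by move=> x; rewrite /based_mul mulgV mul1g. Qed.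

Lemma based_mulV : left_inverse o based_inv based_mul.
Proof.
move=> x; rewrite /based_mul /based_inv -!mulgA (mulgA o o^-1) mulgV mul1g mulVg mulg1 //.
Qed.

Lemma based_mul_adj (x y z : gT) : adj G (based_mul x y) (based_mul x z) = adj G y z.
Proof.
have E (u v : gT) : (based_mul x u)^-1 * based_mul x v = u^-1 * v.
  by rewrite /based_mul; move: (x * o^-1) => a; rewrite invgM -mulgA mulKg.
rewrite /= /cayley_adj !E /based_mul; congr (~~ _ && _).
by apply/eqP/eqP => [/mulgI|->].
Qed.

End cayley_graphs.

Lemma theorem_derivative (R : realType) (gT : groupType) (S : {fset gT}) :
  infinite_set [set: gT] -> generates S -> transient R (cayley_graph S) ->
  forall (o : gT) (p : R), 0 < p < p_T (cayley_graph S) o ->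
    derivable (c_ (cayley_graph S) o : R -> R) p 1 /\
    0 < derive1 (c_ (cayley_graph S) o) p.
Proof.
move=> infV /cayley_connected cG trG o p pT; have bG := cayley_bounded_degree S.
have tG := group_vertex_transitive (based_mulA o) (based_mul_id o) (based_mulV o)
  (based_mul_adj S o).
have eo x : 0 < (esc (cayley_graph S) [set` [fset x]%fset] x : R) by exact: transient_esc.
have reg x : degree (cayley_graph S) x = degree (cayley_graph S) o.
  exact: vertex_transitive_degree.
apply: (c_derivative infV cG bG tG reg) => //.
  exact: (green_of_transient infV cG bG reg).
exact: (mass_transport infV cG bG (based_mulA o) (based_mul_id o) (based_mulV o)
  (based_mul_adj S o)).
Qed.

(** * Divergence on the lattice *)

Lemma bern1 (T : eqType) (K : comNzRingType) (l : seq T) (F : (T -> bool) -> K) :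
  bern 1 0 l F = F (fun e => e \in l).
Proof.
by elim: l F => [|e l IHl] F //=; rewrite mul0r addr0 mul1r IHl.
Qed.

Lemma bern_zero (T : eqType) (K : comNzRingType) (l : seq T) (F : (T -> bool) -> K) :
  bern 0 1 l F = F (fun=> false).
Proof. by elim: l F => [|e l IHl] F //=; rewrite mul0r add0r mul1r IHl. Qed.

(** * Divergence of the expected cluster size at the critical point *)

Section divergence.
Context {R : realType} {V : choiceType} (G : sgraph V).
Hypotheses (infV : infinite_set [set: V]) (cG : connected_graph G)
  (bG : bounded_degree G) (tG : vertex_transitive G).
Implicit Types (p M : R) (o : V).

Let fin x : finite_set (nbhd G x). Proof. exact: nbhd_finite. Qed.

Local Notation pT_set o :=
  [set p : R | 0 <= p <= 1 /\ expected_cluster_size G p o = +oo%E].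

(** At parameter 1 every window is fully open and the cluster is the whole infinite graph. Hence
    [p_T] is the infimum of a nonempty set. *)
Lemma expected_one o : expected_cluster_size G (1 : R) o = +oo%E.
Proof.
apply: contrapT => fin1.
have I1 : 0 <= (1 : R) <= 1 by rewrite ler01 lexx.
have [M chiM] := chi_bound_finite cG bG tG I1 fin1.
pose w : configurations G := fun=> true.
have ub n : ((csize (ball G n o) (restr (edges_at G (ball G n o)) w) o)%:R%:E <= M%:E)%E.
  have -> : restr (edges_at G (ball G n o)) w = (fun e => e \in edges_at G (ball G n o)).
    by apply/funext => e; rewrite /restr andbT.
  have := chiM _ _ o (edges_at_uniq G (ball G n o)) (fset_uniq (ball G n o)).
  by rewrite subrr bern1 lee_fin.
have lim : ((csize (ball G n o) (restr (edges_at G (ball G n o)) w) o)%:R%:E : \bar R)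
    @[n --> \oo] --> (counting (cluster w o) : \bar R) by exact: cvg_size_in.
have Coo : counting (cluster w o) = +oo%E :> \bar R.
  rewrite /counting asboolF // (_ : cluster w o = setT) //.
  apply/seteqP; split => // y _; have [s [os <-]] := cG o y; exists s; split => //.
  apply: sub_path os => a b ab; apply/open_adjP; have [e eab] := edge_of_adj ab.
  by exists e.
have : (+oo <= M%:E)%E.
  rewrite -Coo -(cvg_lim _ lim) //; apply: lime_le; first exact: cvgP lim.
  exact: nearW.
by rewrite leye_eq.
Qed.

Let one_in_pT_set o : pT_set o 1.
Proof. by split; [rewrite ler01 lexx|exact: expected_one]. Qed.

Lemma pT_in01 o : 0 <= (p_T G o : R) <= 1.
Proof.
apply/andP; split; last by apply: ge_inf; [exact: pT_lbound|exact: one_in_pT_set].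
apply: lb_le_inf; first by exists 1; exact: one_in_pT_set.
by move=> p [/andP[]].
Qed.

Lemma finite_neighborhood p M o : 0 <= p <= 1 -> chi_bound (G := G) p M ->
  exists2 delta : R, 0 < delta & forall p', 0 <= p' <= 1 -> `|p' - p| <= delta ->
    expected_cluster_size G p' o <> +oo%E.
Proof.
move=> pI chiM; have [D deg] := bG; have {}deg y : (degree G y <= D)%N by case: (deg y).
have [delta d0 [theta [C [t1 bC]]]] := subcritical_neighborhood fin deg pI chiM.
exists delta => // p' p'I p'd E.
have := chi_of_exponential p'I t1 (bC p' p'I p'd).
by move=> /(expected_of_chi_bound cG bG o p'I); rewrite E leye_eq.
Qed.

(** Makes the left limit at [p_T] one over parameters in [[0, p_T)]. *)
Lemma pT_gt0 o : 0 < (p_T G o : R).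
Proof.
have chi0 : chi_bound (G := G) (0 : R) 1.
  move=> l U x _ uU; rewrite subr0 bern_zero lern1.
  rewrite /csize (eq_count (a2 := pred1 x)); last first.
    move=> y /=; apply/idP/idP => [/set_mem xy|/eqP ->]; last first.
      by rewrite mem_set //; exact: cluster_refl.
    apply/eqP; move: y xy; apply: (@cluster_ind _ _ _ _ (fun y => y = x)) => //.
    by move=> y z _ _ /open_adjP[e []].
  by rewrite count_uniq_mem // leq_b1.
have I0 : 0 <= (0 : R) <= 1 by rewrite ler01 lexx.
have [delta d0 nb] := finite_neighborhood o I0 chi0.
apply: (lt_le_trans d0); apply: lb_le_inf.
  by exists 1; exact: one_in_pT_set.
move=> q [qI Eq]; rewrite leNgt; apply/negP => qd.
apply: (nb q qI) Eq; rewrite subr0 ger0_norm ?(ltW qd) //.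
by case/andP: qI.
Qed.

(** Finiteness would extend to a neighbourhood of [p_T], which contains points of the set whose
    infimum is [p_T]. *)
Lemma expected_pT o : expected_cluster_size G (p_T G o : R) o = +oo%E.
Proof.
apply: contrapT => finT; have I := pT_in01 o.
have [M chiM] := chi_bound_finite cG bG tG I finT.
have [delta d0 nb] := finite_neighborhood o I chiM.
have hi : has_inf (pT_set o).
  split; last exact: pT_lbound.
  by exists 1; exact: one_in_pT_set.
have [q [qI Eq] qd] := inf_adherent d0 hi.
have pq : (p_T G o : R) <= q by apply: ge_inf; [exact: pT_lbound|].
apply: (nb q qI) Eq; rewrite ger0_norm ?subr_ge0 //.
by rewrite lerBlDl ltW.
Qed.

(** At [p_T] a single finite window already has expectation above [B + 1], and that expectation is
    Lipschitz in the parameter. *)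
Lemma chi_divergence o (B : R) : exists2 delta : R, 0 < delta &
  forall p, 0 <= p < p_T G o -> p_T G o - p < delta -> forall M, chi_bound (G := G) p M -> B <= M.
Proof.
have I := pT_in01 o; have [T0 T1] := andP I.
have [n big] : exists n, B + 1 < bern (p_T G o) (1 - p_T G o) (edges_at G (ball G n o))
    (fun w => (csize (ball G n o) w o)%:R).
  apply: contrapT => no; have : (expected_cluster_size G (p_T G o) o <= (B + 1)%:E)%E.
    apply: expected_le => // n; rewrite leNgt; apply/negP => h.
    by apply: no; exists n.
  by rewrite expected_pT leye_eq.
set l := edges_at _ _ in big.
pose N : R := (size l)%:R * (#|` ball G n o|)%:R.
have N0 : 0 <= N by rewrite mulr_ge0.
exists (N + 1)^-1; first by rewrite invr_gt0 ltr_wpDl.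
move=> p /andP[p0 pT] close M chiM.
have pI : 0 <= p <= 1 by rewrite p0 (le_trans (ltW pT)).
have F01 (w : edge G -> bool) :
    0 <= ((csize (ball G n o) w o)%:R : R) <= (#|` ball G n o|)%:R.
  by rewrite ler0n ler_nat csize_le.
have /ler_normlP[lip _] := bern_lipschitz I l pI F01.
have := chiM l (ball G n o) o (edges_at_uniq _ _) (fset_uniq _).
have : N * `|p - p_T G o| <= 1.
  rewrite distrC gtr0_norm ?subr_gt0 // (@le_trans _ _ (N * (N + 1)^-1)) //.
    by rewrite ler_wpM2l // ltW.
  by rewrite ler_pdivrMr ?ltr_wpDl // mul1r lerDl.
move: lip; rewrite -/N; lra.
Qed.

End divergence.

(** * Superharmonic powers, their sums and the choice of scale *)

Section inverse_power.
Context {R : realType}.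

Lemma inv_pow_taylor (s : nat) (eta : R) : 0 < eta ->
  exists2 tau0 : R, 0 < tau0 & forall t, `|t| <= tau0 ->
    0 < 1 + t /\ ((1 + t) ^+ s)^-1 <= 1 - s%:R * t + (s%:R * (s%:R + 1) / 2 + eta) * t ^+ 2.
Proof.
elim: s eta => [|s IHs] eta eta0.
  exists (1 / 2) => // t /ler_normlP[t1 t2]; split; first by lra.
  rewrite expr0 invr1 !mul0r subr0 add0r lerDl mulr_ge0 ?sqr_ge0 // ltW //.
have [tau0 tau00 tay] := IHs (eta / 2) (divr_gt0 eta0 (ltr0Sn _ _)).
(* The coefficient of [t^3] after multiplication by [1 + t]: the two sides then differ by exactly
   [t^2 (eta / 2 + C t)]. *)
pose C : R := s%:R * (s%:R + 1) / 2 + (s%:R + 1) + eta.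
have s0 : 0 <= s%:R :> R by [].
have C0 : 0 < C by rewrite /C; nra.
exists (Num.min tau0 (eta / (2 * C))).
  by rewrite lt_min tau00 divr_gt0 // mulr_gt0.
move=> t; rewrite le_min => /andP[t1 t2]; have [t0 ht] := tay t t1; split => //.
have tC : `|t| * C <= eta / 2.
  by rewrite -ler_pdivlMr // (le_trans t2) // invfM mulrA.
have tC' : - (eta / 2) <= t * C.
  by move: tC; rewrite -{1}(ger0_norm (ltW C0)) -normrM => /ler_normlP[+ _]; lra.
rewrite exprSr invfM -(ler_pM2r t0) divfK ?gt_eqF //.
apply: (le_trans ht).
rewrite -subr_ge0 -natr1 [X in 0 <= X](_ : _ = t ^+ 2 * (eta / 2 + t * C)); last first.
  by rewrite /C; field.
by rewrite mulr_ge0 ?sqr_ge0 //; lra.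
Qed.

(* [(|x|^2 + K)^-s] is superharmonic for the walk on [Z^d] as soon as
   [2 s + 2 < d] and [K] is large. *)
Lemma inverse_power_superharmonic (d s : nat) : (0 < s)%N -> (2 * s + 2 < d)%N ->
  exists2 K : R, 1 <= K & forall (x : 'I_d -> R) q, q = \sum_i x i ^+ 2 + K ->
    \sum_i (((q + 1 + 2 * x i) ^+ s)^-1 + ((q + 1 - 2 * x i) ^+ s)^-1) <=
    (2 * d)%:R * (q ^+ s)^-1.
Proof.
(* This is the slack left by [2 s + 2 < d]: it raises the quadratic coefficient to [d s / 4]. *)
move=> s0 sd; pose eta : R := d%:R * s%:R / 4 - s%:R * (s%:R + 1) / 2.
have s0R : 0 < s%:R :> R by rewrite ltr0n.
have eta0 : 0 < eta.
  have : (2 * s + 2)%:R < d%:R :> R by rewrite ltr_nat.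
  rewrite natrD natrM => h; rewrite /eta subr_gt0 (_ : _ / 2 = s%:R * (2 * s%:R + 2) / 4).
    by rewrite ltr_pM2r ?invr_gt0 // mulrC ltr_pM2r.
  by field.
have [tau0 tau00 tay] := inv_pow_taylor s eta0.
(* With [v >= K] and [x_i^2 <= v], this puts every [2 x_i / v] in the range of the Taylor bound. *)
pose K : R := 1 + 4 / tau0 ^+ 2; have K1 : 1 <= K.
  by rewrite lerDl divr_ge0 // exprn_ge0 // ltW.
exists K => // x q; set u := \sum_i _ => qE.
have u0 : 0 <= u by rewrite sumr_ge0 // => i _; rewrite sqr_ge0.
have qK : K <= q by rewrite qE lerDr.
have q0 : 0 < q by rewrite (lt_le_trans _ qK) // (lt_le_trans _ K1).
pose v := q + 1; have v0 : 0 < v by rewrite addr_gt0.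
have uv : u <= v by rewrite /v qE -addrA lerDl addr_ge0 // (le_trans _ K1).
have ti i : `|2 * x i / v| <= tau0.
  rewrite -(@ler_pXn2r _ 2) ?nnegrE ?normr_ge0 ?(ltW tau00) // real_normK ?num_real //.
  have xu : x i ^+ 2 <= u.
    by rewrite /u (bigD1 i) //= lerDl sumr_ge0 // => j _; rewrite sqr_ge0.
  have -> : (2 * x i / v) ^+ 2 = 4 * (x i ^+ 2 / v ^+ 2).
    by rewrite !exprMn exprVn; ring.
  rewrite (@le_trans _ _ (4 * v^-1)) //.
    rewrite ler_wpM2l // ler_pdivrMr ?exprn_gt0 // expr2 mulKf ?gt_eqF //.
    exact: le_trans uv.
  have vK : 4 / tau0 ^+ 2 <= v.
    by apply: (@le_trans _ _ K); [rewrite /K lerDr | rewrite (le_trans qK) // lerDl].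
  by rewrite -[leLHS]/(4 / v) ler_pdivrMr // mulrC -ler_pdivrMr ?exprn_gt0.
have term i (e : R) : e ^+ 2 = 1 -> ((v + e * (2 * x i)) ^+ s)^-1 <=
    (v ^+ s)^-1 * (1 - s%:R * (e * (2 * x i / v)) + d%:R * s%:R / 4 * (2 * x i / v) ^+ 2).
  move=> e1; have ne : `|e| = 1.
    by apply/eqP; rewrite -(@eqrXn2 _ 2) ?normr_ge0 // -normrX e1 normr1 expr1n.
  have te : `|e * (2 * x i / v)| <= tau0 by rewrite normrM ne mul1r.
  have [p1 ht] := tay _ te.
  have -> : v + e * (2 * x i) = v * (1 + e * (2 * x i / v)).
    by field; rewrite gt_eqF.
  rewrite exprMn invfM ler_wpM2l ?invr_ge0 ?exprn_ge0 ?(ltW v0) //.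
  apply: (le_trans ht); rewrite exprMn e1 mul1r lerD2l ler_wpM2r ?sqr_ge0 //.
  by rewrite /eta addrCA subrr addr0.
have pair i : ((q + 1 + 2 * x i) ^+ s)^-1 + ((q + 1 - 2 * x i) ^+ s)^-1 <=
    (v ^+ s)^-1 * (2 + d%:R * s%:R / 2 * (2 * x i / v) ^+ 2).
  have := term i 1 (expr1n _ _); have := term i (-1) (sqrr_sign _ 1).
  rewrite mul1r mulN1r -/v => h1 h2; apply: (le_trans (lerD h2 h1)).
  rewrite -mulrDr le_eqVlt; apply/orP; left; apply/eqP; congr (_ * _).
  by move: (2 * x i / v) => y; field.
apply: (le_trans (ler_sum _ (fun i _ => pair i))).
rewrite -mulr_sumr big_split /= sumr_const card_ord -mulr_sumr.
have -> : \sum_(i < d) (2 * x i / v) ^+ 2 = 4 * u / v ^+ 2.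
  rewrite /u mulr_sumr mulr_suml; apply: eq_bigr => i _.
  by rewrite !exprMn exprVn; ring.
have u2 : 4 * u / v ^+ 2 <= 4 / v.
  rewrite ler_pdivrMr ?exprn_gt0 // expr2 mulrA divfK ?gt_eqF //.
  by rewrite ler_pM2l.
(* The linear terms have cancelled between opposite neighbours, and the quadratic ones total at most
   [2 d s / q]. Since [v = q (1 + 1 / q)], the inequality [(1 + 1 / q) ^ s >= 1 + s / q] makes up
   for them. *)
have b1 : 2 *+ d + d%:R * s%:R / 2 * (4 * u / v ^+ 2) <= (2 * d)%:R * (1 + s%:R / q).
  apply: (@le_trans _ _ (2 *+ d + d%:R * s%:R / 2 * (4 / v))).
    by rewrite lerD2l ler_wpM2l // divr_ge0 // mulr_ge0.
  apply: (@le_trans _ _ (2 *+ d + d%:R * s%:R / 2 * (4 / q))).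
    rewrite lerD2l ler_wpM2l //.
    by rewrite ler_pM2l // lef_pV2 ?posrE // lerDl.
  rewrite -[2 *+ d]mulr_natr natrM le_eqVlt; apply/orP; left; apply/eqP.
  by field; rewrite gt_eqF.
apply: (@le_trans _ _ ((v ^+ s)^-1 * ((2 * d)%:R * (1 + s%:R / q)))).
  by rewrite ler_wpM2l // invr_ge0 exprn_ge0 // ltW.
rewrite mulrCA ler_wpM2l // mulrC ler_pdivrMr ?exprn_gt0 //.
have -> : (q ^+ s)^-1 * v ^+ s = (1 + q^-1) ^+ s.
  by rewrite -exprVn -exprMn; congr (_ ^+ _); rewrite /v; field; rewrite gt_eqF.
have iq : 0 <= q^-1 by rewrite invr_ge0 ltW.
elim: (s) => [|n IHn]; first by rewrite mul0r addr0 expr0.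
rewrite exprS -natr1 mulrDl mul1r; apply: le_trans (ler_wpM2l _ IHn); last by rewrite addr_ge0.
have : 0 <= n%:R * q^-1 * q^-1 by rewrite !mulr_ge0.
lra.
Qed.

End inverse_power.

Section lattice_sums.
Context {R : realType} {d : nat}.
Implicit Types (z : 'rV[int]_d) (B : seq 'rV[int]_d).

Definition norm2 z : R := \sum_i (z 0 i)%:~R ^+ 2.

Lemma norm2_ge0 z : 0 <= norm2 z.
Proof. by rewrite sumr_ge0 // => i _; rewrite sqr_ge0. Qed.

Definition in_box (j : nat) z : bool := [forall i, (`|z 0%R i| < 2 ^ j)%N].

Lemma box_count j B : uniq B -> (count (in_box j) B <= (4 * 2 ^ j) ^ d)%N.
Proof.
move=> uB; pose phi z : {ffun 'I_d -> 'I_(2 * 2 ^ j).+1} :=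
  [ffun i => inord (absz (z 0 i + (2 ^ j)%N%:Z)%R)].
have inj : {in [seq z <- B | in_box j z] &, injective phi}.
  move=> z z'; rewrite !mem_filter => /andP[/forallP bz _] /andP[/forallP bz' _] /ffunP E.
  apply/rowP => i; have := bz i; have := bz' i; have := E i; rewrite !ffunE.
  move: (z 0 i) (z' 0 i) => a b /(congr1 val) /=.
  move: (2 ^ j)%N => m + bm am; rewrite !inordK; lia.
rewrite -size_filter -(size_map phi).
have /card_uniqP <- : uniq (map phi [seq z <- B | in_box j z]).
  by rewrite map_inj_in_uniq // filter_uniq.
apply: (leq_trans (max_card _)); rewrite card_ffun !card_ord.
have [->|d0] := posnP d; first by rewrite !expn0.
by rewrite leq_exp2r // -[4%N]/(2 + 2)%N mulnDl -addn1 leq_add // muln_gt0 expn_gt0.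
Qed.

Lemma norm2_outside j z : ~~ in_box j z -> 4 ^+ j <= norm2 z.
Proof.
rewrite negb_forall => /existsP[i]; rewrite -leqNgt => ji.
rewrite /norm2 (bigD1 i) //= (@le_trans _ _ ((z 0 i)%:~R ^+ 2)) //; last first.
  by rewrite lerDl sumr_ge0 // => l _; rewrite sqr_ge0.
rewrite -real_normK ?num_real // -intr_norm -abszE.
have -> : 4 ^+ j = ((2 ^ j)%N%:R : R) ^+ 2 by rewrite natrX -exprM mulnC exprM; congr (_ ^+ _); ring.
by rewrite ler_pXn2r ?nnegrE // -pmulrn ler_nat.
Qed.

(** Dyadic shells: shell [j] has at most [8^d 2^(j d)] points, each contributing at most [4^(-j k)],
    and [d < 2 k] makes its total at most [8^d 2^(-j)]. The leading 1 accounts for the origin. *)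
Lemma inverse_power_sum (K : R) (k : nat) B : 1 <= K -> (d < 2 * k)%N -> uniq B ->
  \sum_(z <- B) ((norm2 z + K) ^+ k)^-1 <= 1 + 2 * 8 ^+ d.
Proof.
move=> K1 dk uB.
have q1 z : 1 <= norm2 z + K by rewrite (le_trans K1) // lerDr norm2_ge0.
have q0 z : 0 < (norm2 z + K) ^+ k by rewrite exprn_gt0 // (lt_le_trans _ (q1 z)).
have term z : 0 <= ((norm2 z + K) ^+ k)^-1 by rewrite invr_ge0 ltW.
have [J bJ] : exists J, forall z, z \in B -> in_box J z.
  exists (\sum_(z <- B) \sum_i `|z 0%R i|)%N => z zB; apply/forallP => i.
  apply: (@leq_ltn_trans (\sum_(z <- B) \sum_i `|z 0%R i|)%N); last exact: ltn_expl.
  rewrite (bigD1_seq z) //= (bigD1 i) //= -addnA leq_addr //.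
have key j : \sum_(z <- B | in_box j z) ((norm2 z + K) ^+ k)^-1 <=
    1 + 2 * 8 ^+ d * (1 - (2^-1) ^+ j).
  elim: j => [|j IHj].
    rewrite expr0 subrr mulr0 addr0 -big_filter.
    have : all (fun z => z == 0) [seq z <- B | in_box 0 z].
      apply/allP => z; rewrite mem_filter => /andP[/forallP bz _].
      apply/eqP/rowP => i; rewrite mxE; have := bz i.
      by rewrite expn0 ltnS leqn0 absz_eq0 => /eqP.
    have : uniq [seq z <- B | in_box 0 z] by rewrite filter_uniq.
    case: [seq z <- B | in_box 0 z] => [|z [|z' l]]; rewrite ?big_nil // ?big_seq1.
      by move=> _ _; rewrite invf_le1 // exprn_ege1.
    move=> /= /andP[zl _] /and3P[/eqP z0 /eqP z'0 _].
    by move: zl; rewrite z0 z'0 inE eqxx.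
  rewrite (bigID (in_box j)) /=.
  have -> : \sum_(z <- B | in_box j.+1 z && in_box j z) ((norm2 z + K) ^+ k)^-1 =
      \sum_(z <- B | in_box j z) ((norm2 z + K) ^+ k)^-1.
    apply: eq_bigl => z; apply: andb_idl => /forallP bz; apply/forallP => i.
    by rewrite (leq_trans (bz i)) // leq_exp2l.
  have shell : \sum_(z <- B | in_box j.+1 z && ~~ in_box j z) ((norm2 z + K) ^+ k)^-1 <=
      8 ^+ d * (2^-1) ^+ j.
    apply: (@le_trans _ _ (\sum_(z <- B | in_box j.+1 z) ((4 ^+ j) ^+ k)^-1)).
      rewrite [leRHS](bigID (in_box j)) /= -[leLHS]add0r lerD //.
        by rewrite sumr_ge0 // => z _; rewrite invr_ge0 !exprn_ge0.
      apply: ler_sum => z /andP[_ /norm2_outside zj].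
      rewrite lef_pV2 ?posrE ?q0 ?exprn_gt0 // lerXn2r ?nnegrE ?exprn_ge0 //.
        by rewrite (le_trans _ (q1 z)).
      by rewrite (le_trans zj) // lerDl (le_trans _ K1).
    rewrite big_const_seq iter_addr_0 -[leLHS]mulr_natr.
    have c : (count (in_box j.+1) B)%:R <= 8 ^+ d * (2 ^+ j) ^+ d :> R.
      have := box_count j.+1 uB; rewrite -(ler_nat R) => /le_trans; apply.
      by rewrite -exprMn natrX lerXn2r ?nnegrE // natrM natrX exprS mulrA -natrM.
    apply: (@le_trans _ _ (((4 ^+ j) ^+ k)^-1 * (8 ^+ d * (2 ^+ j) ^+ d))).
      by rewrite ler_wpM2l // invr_ge0 !exprn_ge0.
    rewrite mulrCA ler_wpM2l ?exprn_ge0 // mulrC.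
    have -> : (4 : R) ^+ j = (2 ^+ j) ^+ 2 by rewrite -exprM mulnC exprM; congr (_ ^+ _); ring.
    rewrite exprVn; set t : R := 2 ^+ j; have t1 : 1 <= t by rewrite exprn_ege1 ?ler1n.
    have t0 : 0 < t by exact: lt_le_trans t1.
    clearbody t.
    rewrite ler_pdivrMr ?exprn_gt0 // mulrC ler_pdivlMr // -exprSr -[leRHS]exprM.
    by rewrite ler_weXn2l.
  apply: (le_trans (lerD IHj shell)); rewrite exprS; lra.
apply: (@le_trans _ _ (\sum_(z <- B | in_box J z) ((norm2 z + K) ^+ k)^-1)).
  rewrite big_seq_cond [leRHS]big_seq_cond le_eqVlt; apply/orP; left; apply/eqP.
  by apply: eq_bigl => z; case: (boolP (z \in B)) => //= /bJ ->.
by apply: (le_trans (key J)); rewrite lerD2l ler_piMr //.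
Qed.

End lattice_sums.

(* Take [U ^ k] of the order of [chi ^ 2]; the ratio is then of the order of
   [chi ^ ((2 s - k) / k)]. *)
Lemma scale_choice (R : realType) (s k : nat) (C H B : R) : (s <= k < 2 * s)%N ->
  0 < C -> 0 <= H -> exists X : R, forall chi, X <= chi -> 1 <= chi /\
    exists2 U : R, 1 <= U &
      B <= C * chi / (2 * chi ^+ 2 * (U ^+ s)^-1 + U ^+ (k - s) * H).
Proof.
move=> /andP[sk ks] C0 H0.
have k0 : (0 < k)%N by lia.
have sk2 : ((k - s) * 2 < k)%N by lia.
(* The denominator will be at most [(2 + H) U^(k - s)], and [Y <= U] is what the squared inequality
   then requires. *)
pose E : R := C / (2 + H); have E0 : 0 < E by rewrite divr_gt0 // ltr_pwDl.
pose Y : R := B ^+ 2 * 2 ^+ k / E ^+ 2.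
have Y0 : 0 <= Y.
  by apply: divr_ge0; [apply: mulr_ge0; [exact: sqr_ge0|exact: exprn_ge0]|exact: sqr_ge0].
pose N := Num.truncn Y; have YN : Y < N.+1%:R by exact: truncnS_gt.
pose X : R := 1 + N.+1%:R ^+ k.
have X1 : 1 <= X by rewrite lerDl exprn_ge0.
exists X => chi Xchi; have chi1 := le_trans X1 Xchi; split => //.
have chi0 : 0 < chi by rewrite (lt_le_trans _ chi1).
(* [U] is the least such integer: minimality gives [U^k <= 2^k chi^2], and [chi >= X] makes it
   exceed [Y]. *)
have ex : exists n : nat, chi ^+ 2 <= n%:R ^+ k.
  exists (Num.truncn (chi ^+ 2)).+1.
  apply: (le_trans (ltW (truncnS_gt _))).
  by rewrite -[leLHS]expr1 ler_weXn2l // ler1n.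
case: (ex_minnP ex) => n nk nmin.
have Nn : (N < n)%N.
  rewrite ltnNge; apply/negP => nN.
  have : chi ^+ 2 <= N.+1%:R ^+ k.
    by apply: (le_trans nk); rewrite lerXn2r ?nnegrE // ler_nat ltnW.
  have : chi <= chi ^+ 2 by rewrite expr2 ler_peMr // ltW.
  move: Xchi; rewrite /X; lra.
have n0 : (0 < n)%N by exact: leq_trans Nn.
have nS : n%:R ^+ k <= 2 ^+ k * chi ^+ 2.
  have [->|n1] := eqVneq n 1%N.
    by rewrite expr1n mulr_ege1 // exprn_ege1 // ler1n.
  have nn : (n <= 2 * n.-1)%N by move: n0 n1; clear; lia.
  have /(contraNN (nmin n.-1)) : ~~ (n <= n.-1)%N by rewrite -ltnNge prednK.
  rewrite -ltNge => /ltW lt; apply: le_trans (ler_wpM2l _ lt); last by rewrite exprn_ge0.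
  by rewrite -exprMn lerXn2r ?nnegrE // -natrM ler_nat.
exists n%:R; rewrite ?ler1n //.
have Yn : Y <= n%:R by rewrite (le_trans (ltW YN)) // ler_nat.
have n1 : 1 <= n%:R :> R by rewrite ler1n.
move: n%:R n1 nS nk Yn => u u1 uS uk Yu {n nmin n0 Nn ex}.
have u0 : 0 < u by exact: lt_le_trans u1.
have den : 2 * chi ^+ 2 * (u ^+ s)^-1 + u ^+ (k - s) * H <= (2 + H) * u ^+ (k - s).
  rewrite [_ * H]mulrC [leRHS]mulrDl lerD2r -mulrA ler_wpM2l // ler_pdivrMr ?exprn_gt0 //.
  by rewrite -exprD subnK.
have den0 : 0 < 2 * chi ^+ 2 * (u ^+ s)^-1 + u ^+ (k - s) * H.
  by rewrite ltr_wpDr // ?mulr_ge0 ?exprn_ge0 ?(ltW u0) // divr_gt0 ?mulr_gt0 ?exprn_gt0.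
rewrite ler_pdivlMr //.
have [B0|B0] := leP B 0.
  by apply: (@le_trans _ _ 0); rewrite ?mulr_le0_ge0 ?mulr_ge0 // ltW.
apply: (le_trans (ler_wpM2l (ltW B0) den)).
rewrite mulrCA -ler_pdivlMl ?ltr_pwDl // mulrA [_^-1 * _]mulrC -/E; clearbody E.
rewrite -(@ler_pXn2r _ 2) // ?nnegrE ?mulr_ge0 ?exprn_ge0 ?(ltW B0) ?(ltW E0) ?(ltW chi0) ?(ltW u0) //.
rewrite [leLHS]exprMn [leRHS]exprMn.
(* Here [k < 2 s] enters, as [2 (k - s) + 1 <= k]. *)
have Yu' : Y * u ^+ ((k - s) * 2) <= u ^+ k.
  apply: (@le_trans _ _ (u * u ^+ ((k - s) * 2))); first by rewrite ler_wpM2r ?exprn_ge0 // ltW.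
  by rewrite -exprS ler_weXn2l.
have := le_trans Yu' uS; rewrite exprM /Y => h.
have {}h : B ^+ 2 * 2 ^+ k * (u ^+ (k - s)) ^+ 2 <= 2 ^+ k * chi ^+ 2 * E ^+ 2.
  by rewrite -ler_pdivrMr ?exprn_gt0 // mulrAC.
have p2 : 0 < 2 ^+ k :> R by rewrite exprn_gt0.
by rewrite -(ler_pM2l p2) mulrA [2 ^+ k * _]mulrC (le_trans h) // mulrAC -mulrA.
Qed.

(** * The lattice as a graph, and the capacity of its finite sets *)

Section lattice_graph.
Context {d : nat}.
Implicit Types (x y z : 'rV[int]_d) (i : 'I_d).
Local Notation G := (lattice d).
Local Notation e i := (delta_mx 0 i : 'rV[int]_d).

Lemma lattice_adjP x y :
  reflect (exists i, y = x + e i \/ y = x - e i) (adj G x y).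
Proof.
have -> : adj G x y = ((\sum_(i < d) absz (x 0 i - y 0 i)%R)%N == 1%N).
  rewrite /= /lattice_adj -eqz_nat; congr (_ == _).
  by rewrite -[RHS]natz natr_sum; apply: eq_bigr => i _; rewrite natz abszE.
apply: (iffP (sum_nat_eq1 _ _)) => [[i [_ xi xj]]|[i [->|->]]].
- exists i; have [y1|y1] : y 0 i = x 0 i + 1 \/ y 0 i = x 0 i - 1 by lia.
    left; apply/rowP => j; rewrite !mxE /=.
    case: eqVneq => [->|ij]; first by rewrite y1.
    by have := xj j ij isT; lia.
  right; apply/rowP => j; rewrite !mxE /=.
  case: eqVneq => [->|ij]; first by rewrite y1.
  by have := xj j ij isT; lia.
- exists i; split => //; first by rewrite !mxE !eqxx /=; lia.
  by move=> j /negbTE ji _; rewrite !mxE ji andbF /=; lia.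
- exists i; split => //; first by rewrite !mxE !eqxx /=; lia.
  by move=> j /negbTE ji _; rewrite !mxE ji andbF /=; lia.
Qed.

Definition lattice_nbs x : seq 'rV[int]_d :=
  [seq x + e i | i <- enum 'I_d] ++ [seq x - e i | i <- enum 'I_d].

Lemma mem_lattice_nbs x y : (y \in lattice_nbs x) = adj G x y.
Proof.
apply/idP/lattice_adjP; rewrite mem_cat.
  by case/orP => /mapP[i _ ->]; exists i; [left|right].
by case=> i [->|->]; apply/orP; [left|right]; apply/mapP; exists i; rewrite ?mem_enum.
Qed.

Lemma unit_vector_inj : injective (fun i => e i).
Proof.
move=> i j /rowP /(_ i); rewrite !mxE !eqxx /=.
by case: eqVneq.
Qed.

Lemma lattice_nbs_uniq x : uniq (lattice_nbs x).
Proof.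
have ux : uniq [seq x + e i | i <- enum 'I_d].
  by rewrite map_inj_uniq ?enum_uniq // => i j ij; apply/unit_vector_inj/(addrI x).
have ux' : uniq [seq x - e i | i <- enum 'I_d].
  by rewrite map_inj_uniq ?enum_uniq // => i j ij; apply/unit_vector_inj/oppr_inj/(addrI x).
rewrite cat_uniq ux ux' andbT /=.
apply/hasPn => _ /mapP[i _ ->]; apply/negP => /mapP[j _ ij].
have /rowP /(_ i) := addrI x ij.
by rewrite !mxE !eqxx /=; case: (_ == _).
Qed.

Lemma lattice_nbhd_finite x : finite_set (nbhd G x).
Proof.
apply: (sub_finite_set _ (finite_seq (lattice_nbs x))) => y.
by move=> xy; rewrite /= mem_lattice_nbs.
Qed.

Lemma perm_lattice_nbs x : perm_eq (nbs G x) (lattice_nbs x).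
Proof.
apply: uniq_perm; [exact: fset_uniq|exact: lattice_nbs_uniq|] => y.
by rewrite -[LHS]/(y \in nbs G x) (in_nbs lattice_nbhd_finite) mem_lattice_nbs.
Qed.

Lemma lattice_degree x : degree G x = (2 * d)%N.
Proof.
rewrite -[LHS]/(size (nbs G x)) (perm_size (perm_lattice_nbs x)) size_cat.
by rewrite (size_map (fun i => x + e i)) (size_map (fun i => x - e i)) size_enum_ord mul2n addnn.
Qed.

Lemma lattice_bounded_degree : bounded_degree G.
Proof.
by exists (2 * d)%N => x; rewrite lattice_degree; split => //; exact: lattice_nbhd_finite.
Qed.

Lemma lattice_infinite : (0 < d)%N -> infinite_set [set: 'rV[int]_d].
Proof.
move=> d0 fin; apply: infinite_nat.
have := finite_image (fun z : 'rV[int]_d => `|z 0%R (Ordinal d0)|%N) fin.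
congr finite_set; apply/seteqP; split => // n _.
by exists (const_mx n%:Z) => //; rewrite mxE absz_nat.
Qed.

Lemma lattice_connected : connected_graph G.
Proof.
move=> x y; have [n] := ubnP (\sum_(i < d) absz (x 0 i - y 0 i)%R)%N.
elim: n x => // n IHn x; rewrite ltnS => xn.
have [-> |xy] := eqVneq x y; first by exists [::].
have [i xi] : exists i, x 0 i != y 0 i.
  apply/existsP; apply: contraNT xy; rewrite negb_exists => /forallP h.
  by apply/eqP/rowP => i; apply/eqP; rewrite -[_ == _]negbK; exact: h.
pose z := if x 0 i < y 0 i then x + e i else x - e i.
have xz : adj G x z.
  by apply/lattice_adjP; exists i; rewrite /z; case: ifP; [left|right].
have [|p [zp lp]] := IHn z; last by exists (z :: p); split => //=; apply/andP.
apply: leq_trans xn; rewrite (bigD1 i) //= [X in (_ <= X)%N](bigD1 i) //= -addSn.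
have -> : (\sum_(j < d | j != i) absz (z 0 j - y 0 j)%R =
           \sum_(j < d | j != i) absz (x 0 j - y 0 j)%R)%N.
  apply: eq_bigr => j /negbTE ji; congr (absz (_ - _)).
  by rewrite /z; case: ifP => _; rewrite !mxE ji andbF ?addr0 ?subr0.
rewrite leq_add2r /z; case: ltrP => lt; rewrite !mxE !eqxx /=; move: xi lt.
  by move: (x 0 i) (y 0 i); clear => a b; lia.
by move: (x 0 i) (y 0 i); clear => a b; lia.
Qed.

Variable o : 'rV[int]_d.

Definition shifted_add x y := x + y - o.
Definition shifted_opp x := o - x + o.

Lemma shifted_addA : associative shifted_add.
Proof. by move=> x y z; rewrite /shifted_add !addrA addrAC. Qed.

Lemma shifted_add0 : left_id o shifted_add.
Proof. by move=> x; rewrite /shifted_add addrAC subrr add0r. Qed.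

Lemma shifted_addN : left_inverse o shifted_opp shifted_add.
Proof. by move=> x; rewrite /shifted_add /shifted_opp addrAC addrK subrK. Qed.

Lemma shifted_add_adj x y z : adj G (shifted_add x y) (shifted_add x z) = adj G y z.
Proof.
rewrite /= /lattice_adj; congr (_ == _); apply: eq_bigr => i _; congr `|_|.
by rewrite /shifted_add !mxE; ring.
Qed.

Lemma Pop_lattice (R : realType) (f : 'rV[int]_d -> R) x :
  Pop G f x = (2 * d)%:R^-1 * \sum_i (f (x + e i) + f (x - e i)).
Proof.
rewrite /Pop lattice_degree (perm_big _ (perm_lattice_nbs x)) /= big_cat /=.
rewrite (big_map (fun i => x + e i)) (big_map (fun i => x - e i)).
by rewrite big_split /= !big_enum.
Qed.

End lattice_graph.

Section lattice_walk.
Context {R : realType} {d : nat}.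
Hypothesis d0 : (0 < d)%N.
Variables (s k : nat).
Hypotheses (s0 : (0 < s)%N) (sd : (2 * s + 2 < d)%N) (sk : (s <= k)%N) (dk : (d < 2 * k)%N).
Implicit Types (x y z : 'rV[int]_d) (A : {fset 'rV[int]_d}).
Local Notation G := (lattice d).
Local Notation e i := (delta_mx 0 i : 'rV[int]_d).

Lemma norm2_step (eps : int) x i : eps ^+ 2 = 1 ->
  norm2 (x + eps *: e i) = norm2 x + 2 * eps%:~R * (x 0 i)%:~R + 1 :> R.
Proof.
move=> eps1; rewrite /norm2 (bigD1 i) //= [in RHS](bigD1 i) //=.
rewrite (eq_bigr (fun j => (x 0 j)%:~R ^+ 2)) => [|j /negbTE ji]; last first.
  by rewrite !mxE ji andbF mulr0 addr0.
have : eps%:~R ^+ 2 = 1 :> R by rewrite -rmorphXn /= eps1.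
rewrite !mxE !eqxx mulr1 rmorphD /= => e1.
have -> : ((x 0 i)%:~R + eps%:~R) ^+ 2 = (x 0 i)%:~R ^+ 2 + 2 * eps%:~R * (x 0 i)%:~R + 1 :> R.
  by rewrite sqrrD e1; ring.
by move: (\sum_(_ < d | _) _) => S; ring.
Qed.

(** All neighbours of the origin have norm 1, so the drop there is exactly [K^-s - (K + 1)^-s],
    which is [g0]. *)
Lemma lattice_superharmonic : exists K g0 : R, [/\ 1 <= K, 0 < g0 &
  forall z, Pop G (fun y => ((norm2 y + K) ^+ s)^-1) z + g0 * (z == 0)%:R <=
            ((norm2 z + K) ^+ s)^-1].
Proof.
have [K K1 HK] := @inverse_power_superharmonic R d s s0 sd.
have K0 : 0 < K by exact: lt_le_trans K1.
have n0 : norm2 (0 : 'rV[int]_d) = 0 :> R by rewrite /norm2 big1 // => i _; rewrite mxE expr0n.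
pose h y : R := ((norm2 y + K) ^+ s)^-1.
have up x i : norm2 (x + e i) = norm2 x + 2 * (x 0 i)%:~R + 1 :> R.
  by rewrite -[e i]scale1r norm2_step // mulr1.
have down x i : norm2 (x - e i) = norm2 x - 2 * (x 0 i)%:~R + 1 :> R.
  by rewrite -scaleN1r norm2_step // mulrN1z mulrN1 mulNr.
pose g0 : R := (K ^+ s)^-1 - ((K + 1) ^+ s)^-1.
have g00 : 0 < g0.
  rewrite subr_gt0 ltf_pV2 ?posrE ?exprn_gt0 ?addr_gt0 //.
  by rewrite ltrXn2r ?nnegrE ?addr_ge0 ?(ltW K0) // ?ltrDl // -lt0n.
exists K, g0; split => // z; rewrite Pop_lattice //.
have dd : 0 < (2 * d)%:R :> R by rewrite ltr0n muln_gt0.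
have [->|z0] := eqVneq z 0.
  rewrite mulr1 n0 add0r (eq_bigr (fun=> ((K + 1) ^+ s)^-1 *+ 2)) => [|i _]; last first.
    by rewrite up down n0 mxE mulr0 subr0 !add0r [1 + K]addrC mulr2n.
  rewrite sumr_const card_ord -mulrnA -[X in _ * X + _]mulr_natl mulrA mulVf ?gt_eqF // mul1r.
  by rewrite /g0 addrCA subrr addr0.
rewrite mulr0 addr0 mulrC ler_pdivrMr // mulrC.
apply: le_trans (HK (fun i => (z 0 i)%:~R) (norm2 z + K) erefl).
apply: ler_sum => i _; rewrite up down.
rewrite (_ : norm2 z + 2 * (z 0 i)%:~R + 1 + K = norm2 z + K + 1 + 2 * (z 0 i)%:~R); last by ring.
by rewrite (_ : norm2 z - 2 * (z 0 i)%:~R + 1 + K = norm2 z + K + 1 - 2 * (z 0 i)%:~R) //; ring.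
Qed.

(** Summing translates of the superharmonic function over [A] gives a function [f A] that drops by
    at least [g0] on [A]. It bounds the number of visits, hence the Green function. On [A] it is
    estimated by splitting at height [U]: far points contribute at most [U^-s] each, and near ones
    satisfy [q^-s <= U^(k - s) q^-k], with a summable right side. *)
Lemma lattice_potential : exists H g0 : R, [/\ 0 < g0, 0 <= H,
  (forall x y, exists M : R, forall N, \sum_(n < N) kern G n x y <= M) &
  forall A (U : R), 1 <= U ->
    g0 * (#|` A|)%:R <= ((#|` A|)%:R * (U ^+ s)^-1 + U ^+ (k - s) * H) * cap G A].
Proof.
have [K [g0 [K1 g00 Ph]]] := lattice_superharmonic.
pose h y : R := ((norm2 y + K) ^+ s)^-1.
have q0 z : 0 < norm2 z + K by rewrite ltr_wpDl ?norm2_ge0 // (lt_le_trans _ K1).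
have h0 z : 0 <= h z by rewrite invr_ge0 exprn_ge0 // ltW.
pose f A x : R := \sum_(y <- A) h (x - y).
have f0 A x : 0 <= f A x by rewrite sumr_ge0.
have Pf A x : Pop G (f A) x + g0 * (x \in A)%:R <= f A x.
  rewrite /f (@Pop_sum R _ G) /=.
  have -> : (x \in A)%:R = \sum_(y <- A) (x - y == 0)%:R :> R.
    under eq_bigr do rewrite subr_eq0.
    case: (boolP (x \in A)) => xA.
      rewrite (bigD1_seq x) ?fset_uniq //= eqxx big1 ?addr0 // => y.
      by rewrite eq_sym => /negbTE ->.
    by rewrite big_seq big1 // => y yA; case: eqVneq => // xy; rewrite xy yA in xA.
  rewrite mulr_sumr -big_split /=; apply: ler_sum => y _.
  apply: le_trans (Ph (x - y)); rewrite lerD2r !Pop_lattice // ler_wpM2l ?invr_ge0 //.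
  by apply: ler_sum => i _; rewrite ![x - y + _]addrAC.
have bG := @lattice_bounded_degree d; have cG := @lattice_connected d.
have infV := lattice_infinite d0.
have green x y : exists M : R, forall N, \sum_(n < N) kern G n x y <= M.
  exists (f [fset y]%fset x / g0) => N; rewrite ler_pdivlMr // mulrC.
  have := superharmonic_visits (Pf [fset y]%fset) N x.
  under eq_bigr do rewrite big_seq_fset1.
  move=> /le_trans; apply; rewrite lerBlDr lerDl; apply: iter_Pop_ge0 => z.
  exact: f0.
exists (1 + 2 * 8 ^+ d), g0; split => // A U U1; have U0 : 0 < U by exact: lt_le_trans U1.
apply: (cap_lower_bound infV cG bG (@lattice_degree d) green (ltW g00) (f0 A) (Pf A)) => x xA.
have hU z : h z <= (U ^+ s)^-1 + U ^+ (k - s) * ((norm2 z + K) ^+ k)^-1.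
  rewrite /h; set q := norm2 z + K; have [Uq|qU] := leP U q.
    rewrite (@le_trans _ _ (U ^+ s)^-1) //.
      by rewrite lef_pV2 ?posrE ?exprn_gt0 ?q0 // lerXn2r ?nnegrE // ltW // q0.
    by rewrite lerDl mulr_ge0 ?invr_ge0 ?exprn_ge0 // ltW // q0.
  rewrite (@le_trans _ _ (U ^+ (k - s) * (q ^+ k)^-1)) //; last first.
    by rewrite lerDr invr_ge0 exprn_ge0 // ltW.
  rewrite ler_pdivlMr ?exprn_gt0 ?q0 // mulrC ler_pdivrMr ?exprn_gt0 ?q0 //.
  rewrite -[in X in q ^+ X](subnK sk) exprD ler_wpM2r ?exprn_ge0 ?(ltW (q0 _)) //.
  by rewrite lerXn2r ?nnegrE ?(ltW U0) ?(ltW (q0 _)) // ltW.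
apply: (le_trans (ler_sum _ (fun y _ => hU (x - y)))).
rewrite big_split /= big_const_seq count_predT iter_addr_0 -[X in X + _]mulr_natl lerD2l.
rewrite -mulr_sumr ler_wpM2l ?exprn_ge0 ?(ltW U0) //.
rewrite -(big_map (fun y => x - y) xpredT (fun z => ((norm2 z + K) ^+ k)^-1)).
apply: inverse_power_sum => //; rewrite map_inj_uniq ?fset_uniq //.
by move=> y y' /(addrI x) /oppr_inj.
Qed.

End lattice_walk.

Lemma theorem_lattice (R : realType) (d : nat) : (11 <= d)%N -> forall o : 'rV[int]_d,
  c_ (lattice d) o p @[p --> (p_T (lattice d) o : R)^'-] --> +oo.
Proof.
move=> d11 o; have d0 : (0 < d)%N by lia.
(* [d >= 11] is what makes [k < 2 s] possible. *)
pose s := (d - 3)./2; pose k := (d + 2)./2.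
have [H [g0 [g00 H0 green capA]]] := @lattice_potential R d d0 s k
  ltac:(rewrite /s; lia) ltac:(rewrite /s; lia) ltac:(rewrite /s /k; lia) ltac:(rewrite /k; lia).
have bG := @lattice_bounded_degree d; have cG := @lattice_connected d.
have infV := lattice_infinite d0.
have tG := group_vertex_transitive (shifted_addA o) (shifted_add0 o) (shifted_addN o)
  (shifted_add_adj o).
have transport := @mass_transport R _ _ infV cG bG o _ _ (shifted_addA o) (shifted_add0 o)
  (shifted_addN o) (shifted_add_adj o).
apply/cvgryPge => B.
(* [H + 1] instead of [H] provides the positive [b] that [c_lower_bound] asks for. *)
have [X hX] : exists X : R, forall chi, X <= chi -> 1 <= chi /\ exists2 U : R, 1 <= U &
    B <= g0 / 4 * chi / (2 * chi ^+ 2 * (U ^+ s)^-1 + U ^+ (k - s) * (H + 1)).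
  apply: scale_choice; [by rewrite /s /k; lia|by rewrite divr_gt0|by rewrite addr_ge0].
have [delta delta0 div] := chi_divergence infV cG bG tG o X.
near=> p.
have pT : 0 <= p < p_T (lattice d) o.
  apply/andP; split; near: p; last exact: nbhs_left_lt.
  by apply: nbhs_left_ge; exact: pT_gt0.
have pd : p_T (lattice d) o - p < delta by near: p; exact: nbhs_left_ltBl.
have [p1 [M chiM]] := below_pT cG bG tG pT.
have pI : 0 <= p <= 1 by case/andP: pT => -> _; exact: ltW.
set E := expected_cluster_size (lattice d) p o.
have Efin : E = (fine E)%:E.
  rewrite fineK // ge0_fin_numE ?expected_ge0 //.
  exact: le_lt_trans (expected_of_chi_bound cG bG o pI chiM) (ltry _).
have chiE : chi_bound (G := lattice d) p (fine E).
  by apply: (chi_bound_of_expected cG bG tG pI (o := o)); rewrite -Efin.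
have [chi1 [U U1]] := hX _ (div p pT pd _ chiE).
move=> /le_trans; apply.
have U0 : 0 < U by exact: lt_le_trans U1.
apply: (c_lower_bound infV cG bG tG (@lattice_degree d) green transport pT) => //.
- exact: lt_le_trans chi1.
- exact: ltW.
- by rewrite invr_ge0 exprn_ge0 // ltW.
- by rewrite mulr_gt0 ?exprn_gt0 // ltr_wpDl.
- move=> A; apply: (le_trans (capA A U U1)); rewrite ler_wpM2r ?(cap_ge0 infV cG bG) // lerD2l.
  by rewrite ler_wpM2l ?exprn_ge0 ?(ltW U0) // lerDl.
Unshelve. all: by end_near.
Qed.

Theorem theorem1p4 (R : realType) :
  (forall (V : choiceType) (G : sgraph V),
     infinite_set [set: V] -> connected_graph G -> vertex_transitive G ->
     bounded_degree G -> transient R G ->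
     forall o : V, analytic_on `[0, p_T G o[ (c_ G o : R -> R))
  /\
  (forall (gT : groupType) (S : {fset gT}),
     infinite_set [set: gT] -> generates S -> transient R (cayley_graph S) ->
     forall (o : gT) (p : R), 0 < p < p_T (cayley_graph S) o ->
       derivable (c_ (cayley_graph S) o : R -> R) p 1 /\
       0 < derive1 (c_ (cayley_graph S) o) p)
  /\
  (forall d : nat, (11 <= d)%N -> forall o : 'rV[int]_d,
     c_ (lattice d) o p @[p --> (p_T (lattice d) o : R)^'-] --> +oo).
Proof.
split; [|split].
- by move=> V G infV cG tG bG _ o; exact: theorem_analytic.
- exact: theorem_derivative.
- exact: theorem_lattice.
Qed.
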